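(* Let $A\subset\mathbb Z^n$ be a vertex circuit, and let $f\in\mathbb C_*^A$. Then $f\in U_1$ if and only if $\operatorname{Arg}(f)\in\mathcal C_\Delta$, where $\Delta$ is the $A$-discriminant.
   Context: Circuits. A circuit is a set $A=\{\mathbf a_0,\dots,\mathbf a_{n+1}\}\subset\mathbb Z^n$ of $n+2$ points whose Newton polytope $\mathcal N_A=\operatorname{Conv}(A)$ is $n$-dimensional. It is a vertex circuit if $A$ equals the vertex set of $\mathcal N_A$. $\operatorname{Vol}(A)$ is the volume of $\mathcal N_A$ normalized so that the standard simplex has volume $1$. Polynomials and coamoebas. $\mathbb C_*=\mathbb C\setminus\{0\}$; $\mathbb C_*^A$ is the set of polynomials $f(z)=\sum_{k}f_kz^{\mathbf a_k}$ with all $f_k\in\mathbb C_*$, identified with coefficient vectors $(f_0,\dots,f_{n+1})$. $\operatorname{Arg}$ is the componentwise argument map $\mathbb C_*^N\to\mathbf T^N=(\mathbb R/2\pi\mathbb Z)^N$. The coamoeba of a polynomial $g$ is $\mathcal C_g=\operatorname{Arg}(\{z: g(z)=0, \text{ all } z_i\in\mathbb C_*\})$. Discriminant. The $A$-discriminant $\Delta$ is the irreducible polynomial in $f_0,\dots,f_{n+1}$ that vanishes at $f\in\mathbb C_*^A$ if and only if $f$ has a singular point in $\mathbb C_*^n$, i.e. there is $z\in\mathbb C_*^n$ with $f(z)=\partial_1f(z)=\dots=\partial_nf(z)=0$. $\mathcal C_\Delta\subset\mathbf T^{n+2}$ is its coamoeba, and $\operatorname{Arg}(f)=(\arg f_0,\dots,\arg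 f_{n+1})$. $U_k\subset\mathbb C_*^A$ denotes the set of $f$ such that the complement $\mathbf T^n\setminus\overline{\mathcal C}_f$ of the closed coamoeba has exactly $\operatorname{Vol}(A)-k$ connected components.
   Formalization: Assumes in addition that A affinely generates Z^n; otherwise the claim fails, e.g. A={(0,0),(2,0),(0,2),(2,2)}, f=(1+z_1^2)(1+z_2^2). Δ is required to be unique up to a scalar, which excludes pyramids, where no A-discriminant exists. *)

(* Defs.v *)
From HB Require Import structures.
From mathcomp Require Import all_boot all_order all_algebra.
From mathcomp Require Import all_classical all_reals all_analysis.
From mathcomp Require Import complex.
From mathcomp.multinomials Require Import -(notations) mpoly.

Set Implicit Arguments.
Unset Strict Implicit.
Unset Printing Implicit Defensive.

Import Order.TTheory GRing.Theory Num.Theory.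
Import numFieldNormedType.Exports.

Local Open Scope classical_set_scope.
Local Open Scope quotient_scope.
Local Open Scope complex_scope.
Local Open Scope ring_scope.

Definition angle_eqv (R : realType) : rel R :=
  fun x y => (x - y) / (2 * pi) \is a Num.int.

Lemma angle_eqv_equiv (R : realType) : equiv_class_of (@angle_eqv R).
Proof.
split=> [x|x y|y x z]; rewrite /angle_eqv.
- by rewrite subrr mul0r.
- by rewrite -(rpredN _ ((y - x) / _)) -mulNr opprB.
- by move=> xy yz; rewrite -(subrKA y) mulrDl rpredD.
Qed.

Canonical angle_equiv_rel (R : realType) :=
  EquivRelPack (@angle_eqv_equiv R).

(* [angle R] carries the quotient topology of R; ['rV[angle R]_n], with the
   entrywise (product) topology of matrices, is the torus (R / 2 pi Z)^n. *)
Definition angle (R : realType) : Type :=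
  quotient_topology {eq_quot (@angle_eqv R)}.

HB.instance Definition _ (R : realType) := Topological.on (angle R).

Definition angle_of (R : realType) (t : R) : angle R :=
  \pi_({eq_quot (@angle_eqv R)}) t.

(* Only meaningful for z != 0. *)
Definition arg (R : realType) (z : R[i]) : angle R :=
  angle_of (get [set t : R | z = `|z| * (cos t +i* sin t)]).

Definition Arg (R : realType) (N : nat) (z : 'rV[R[i]]_N) : 'rV[angle R]_N :=
  map_mx (@arg R) z.

Definition nonvanishing (R : realType) (N : nat) : set 'rV[R[i]]_N :=
  [set z | forall i, z 0 i != 0].

Definition coamoeba (R : realType) (N : nat) (g : 'rV[R[i]]_N -> R[i]) :
    set 'rV[angle R]_N :=
  @Arg R N @` [set z | nonvanishing z /\ g z = 0].

Definition lmonomial (R : realType) (n : nat) (e : 'rV[int]_n)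
    (z : 'rV[R[i]]_n) : R[i] :=
  \prod_(i < n) (z 0 i) ^ (e 0 i).

(* The value at z of the Laurent polynomial [\sum_k (f 0 k) z^(a k)]. *)
Definition leval (R : realType) (n N : nat) (a : 'I_N -> 'rV[int]_n)
    (f : 'rV[R[i]]_N) (z : 'rV[R[i]]_n) : R[i] :=
  \sum_(k < N) f 0 k * lmonomial (a k) z.

(* The formal partial derivative in z_i: f_k z^(a_k) is sent to
   f_k (a_k)_i z^(a_k - e_i). *)
Definition lderiv (R : realType) (n N : nat) (a : 'I_N -> 'rV[int]_n)
    (f : 'rV[R[i]]_N) (i : 'I_n) (z : 'rV[R[i]]_n) : R[i] :=
  leval (fun k => a k - delta_mx 0 i) (\row_k (f 0 k * (a k 0 i)%:~R)) z.

Definition singular (R : realType) (n N : nat) (a : 'I_N -> 'rV[int]_n)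
    (f : 'rV[R[i]]_N) : Prop :=
  exists z : 'rV[R[i]]_n,
    [/\ nonvanishing z, leval a f z = 0 & forall i, lderiv a f i z = 0].

Definition affine_hull (R : realType) (n : nat) (S : set 'rV[R]_n) :
    set 'rV[R]_n :=
  [set x | exists (m : nat) (p : 'I_m -> 'rV[R]_n) (t : 'I_m -> R),
    [/\ forall i, S (p i), \sum_(i < m) t i = 1
      & x = \sum_(i < m) t i *: p i]].

Definition convex_hull (R : realType) (n : nat) (S : set 'rV[R]_n) :
    set 'rV[R]_n :=
  [set x | exists (m : nat) (p : 'I_m -> 'rV[R]_n) (t : 'I_m -> R),
    [/\ forall i, S (p i), forall i, 0 <= t i, \sum_(i < m) t i = 1
      & x = \sum_(i < m) t i *: p i]].

(* The vertices of a convex polytope are its extreme points. *)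
Definition vertices (R : realType) (n : nat) (K : set 'rV[R]_n) :
    set 'rV[R]_n :=
  [set v | K v /\ forall (x y : 'rV[R]_n) (t : R), K x -> K y ->
    0 < t < 1 -> v = t *: x + (1 - t) *: y -> x = y].

(* The n-fold product of the Lebesgue measure of R, unfolded: the step is
   [product_measure1 lebesgue_measure (volume n')], read on row vectors. *)
Fixpoint volume (R : realType) (n : nat) : set 'rV[R]_n -> \bar R :=
  match n with
  | 0 => fun S => (\1_S 0)%:E
  | n'.+1 => fun S =>
      (\int[lebesgue_measure]_(t in [set: R])
         volume [set x : 'rV[R]_n' | S (row_mx t%:M x)])%E
  end.

Definition support_set (R : realType) (n N : nat) (a : 'I_N -> 'rV[int]_n) :
    set 'rV[R]_n :=
  range (fun k => map_mx intr (a k)).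

Arguments support_set R {n N} a.

Definition newton (R : realType) (n N : nat) (a : 'I_N -> 'rV[int]_n) :
    set 'rV[R]_n :=
  convex_hull (support_set R a).

Arguments newton R {n N} a.

Definition circuit (R : realType) (n : nat) (a : 'I_n.+2 -> 'rV[int]_n) :
    Prop :=
  injective a /\ affine_hull (newton R a) = setT.

Definition vertex_circuit (R : realType) (n : nat)
    (a : 'I_n.+2 -> 'rV[int]_n) : Prop :=
  circuit R a /\ support_set R a = vertices (newton R a).

(* The usual normalization in the theory of A-discriminants: Z^n is the lattice
   affinely generated by A.  It cannot be dropped: for the vertex circuit
   {(0,0), (2,0), (0,2), (2,2)} and f = (1 + z_1^2)(1 + z_2^2), the point (i, i)
   is singular, while Vol(A) = 8 and the complement of the coamoeba
   {theta_1 = +-pi/2} union {theta_2 = +-pi/2} has only 4 components. *)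
Definition affinely_generates (n : nat) (a : 'I_n.+2 -> 'rV[int]_n) : Prop :=
  forall v : 'rV[int]_n, exists c : 'I_n.+2 -> int,
    v = \sum_(k < n.+2) c k *: (a k - a ord0).

(* The standard n-simplex has Lebesgue measure 1 / n!. *)
Definition Vol (R : realType) (n N : nat) (a : 'I_N -> 'rV[int]_n) : \bar R :=
  (n`!%:R%:E * volume (newton R a))%E.

Arguments Vol R {n N} a.

Definition components (X : topologicalType) (S : set X) : set (set X) :=
  connected_component S @` S.

Definition U (R : realType) (n : nat) (a : 'I_n.+2 -> 'rV[int]_n) (k : nat) :
    set 'rV[R[i]]_(n.+2) :=
  [set f | nonvanishing f /\ exists m : nat,
    (components (~` closure (coamoeba (leval a f))) #= `I_m)%card /\
    (m%:R%:E = Vol R a - k%:R%:E)%E].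

Definition irreducible_element (D : comUnitRingType) (p : D) : Prop :=
  p \isn't a GRing.unit /\
  forall q r : D, p = q * r -> q \is a GRing.unit \/ r \is a GRing.unit.

Definition irreducible_singular_equation (R : realType) (n : nat)
    (a : 'I_n.+2 -> 'rV[int]_n) (P : mpoly n.+2 R[i]) : Prop :=
  irreducible_element P /\
  forall f : 'rV[R[i]]_(n.+2), nonvanishing f ->
    (meval (f 0) P = 0 <-> singular a f).

(* Delta is *the* irreducible polynomial with this property, i.e. the only one
   up to a scalar.  If A is a pyramid, no f with non-zero coefficients is
   singular, each variable f_k satisfies [irreducible_singular_equation], and
   the property determines no polynomial: there is then no A-discriminant. *)
Definition is_discriminant (R : realType) (n : nat)
    (a : 'I_n.+2 -> 'rV[int]_n) (Delta : mpoly n.+2 R[i]) : Prop :=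
  irreducible_singular_equation a Delta /\
  forall P : mpoly n.+2 R[i], irreducible_singular_equation a P ->
    exists c : R[i], P = c *: Delta.

(* Main.v *)
(* Write a zero of f with arguments theta as a positive solution t of
   sum_k t_k e^(i phi_k) = 0, where phi_k = arg f_k + <a_k, theta>. Besides this
   balance, t is only subject to sum_k b_k ln t_k = sum_k b_k ln |f_k|, where b is
   the primitive integer affine relation of A. Outside the closed coamoeba the
   phi_k can be lifted to reals with |phi_p - phi_q| < pi whenever b_p > 0 > b_q,
   and such a point can be moved, without meeting the coamoeba, to the convex set
   where all the |phi_i - phi_j| are smaller than pi. On the lifts,
   sum_k b_k phi_k = kappa + 2 pi m with kappa = sum_k b_k arg f_k and m an
   integer that determines the component. The values of m which occur are those
   with |kappa + 2 pi m| < pi V, where V is the sum of the positive b_k; cutting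
   conv A into the simplices conv (A \ a_k), b_k > 0, of volumes b_k shows
   that V = Vol A. So there are V components, except when kappa = pi V modulo
   2 pi, where there are V - 1. Finally f is singular at z if and only if the
   f_k z^(a_k) are proportional to the b_k, so that kappa = pi V modulo 2 pi is
   also the condition for Arg f to lie in the coamoeba of Delta. *)
Require Import Defs.
From HB Require Import structures.
From mathcomp Require Import all_boot all_order all_algebra.
From mathcomp Require Import all_classical all_reals all_analysis.
From mathcomp Require Import complex.
From mathcomp.multinomials Require Import -(notations) mpoly.
From mathcomp Require Import measurable_realfun.
From mathcomp Require Import ring lra zify.

Set Implicit Arguments.
Unset Strict Implicit.
Unset Printing Implicit Defensive.

Import Order.TTheory GRing.Theory Num.Theory.
Import numFieldNormedType.Exports.

Local Open Scope classical_set_scope.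
Local Open Scope complex_scope.
Local Open Scope ring_scope.

(** * Balanced arguments *)

(** For fixed arguments the balanced positive [t] form a convex set, so the values of
    [sum_k b_k ln t_k] fill an interval. When three of the unit vectors surround 0 and omit an index
    [n], [t_n] may tend to 0 and the interval is unbounded, above or below according to the sign of
    [b_n]. Triangles omitting an index of each sign thus put the point in the coamoeba whatever the
    moduli of [f]. This is the origin of the bound [pi] between opposite signs, and it uses the two
    indices of each sign that a vertex circuit provides. Antipodal arguments give such triangles, or
    a solution close to one, only after a small perturbation; hence the closed coamoeba. The hard
    case is a pair of the same sign more than [pi] apart: triangles may then exist for one sign
    only, and the moduli matter. Such a pair is turned inwards at speeds inverse to the [b_k], which
    preserves [sum_k b_k phi_k]; a monotonicity argument shows that a solution met on the way would
    give one at the start. *)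

Lemma cos_shift (R : realType) (y : R) (k : int) : cos (y + k%:~R * (2 * pi)) = cos y.
Proof.
have -> : 2 * pi = pi *+ 2 :> R by rewrite mulr_natl.
case: k => k; first by rewrite -pmulrn mulr_natl (periodicn (@cosD2pi R)).
rewrite NegzE mulrNz mulNr -pmulrn mulr_natl -[in RHS](subrK (pi *+ 2 *+ k.+1) y).
by rewrite (periodicn (@cosD2pi R)).
Qed.

Lemma sin_shift (R : realType) (y : R) (k : int) : sin (y + k%:~R * (2 * pi)) = sin y.
Proof. by rewrite -[RHS]cosBpihalf -(cos_shift _ k) -cosBpihalf addrAC. Qed.

Lemma continuous_at_sum (R : realType) (I : finType) (f : I -> R -> R) s :
  (forall i, {for s, continuous (f i)}) ->
  {for s, continuous (fun s => \sum_i f i s)}.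
Proof.
move=> cf.
have -> : (fun s => \sum_i f i s) = \sum_i f i.
  by apply/funext => x; rewrite fct_sumE.
elim/big_ind: _ => [|g h cg ch|i _]; [exact: cst_continuous| |exact: cf].
exact: cvgD.
Qed.

Section Balance.
Variables (R : realType) (I : finType).
Implicit Types (b t u w : I -> R) (c x : R).

Definition balanced u t :=
  \sum_i t i * cos (u i) = 0 /\ \sum_i t i * sin (u i) = 0.

Definition balance_value b t : R := \sum_i b i * ln (t i).

(* The arguments u are those of the terms of a polynomial at some point of the
   coamoeba: t lists the moduli of the terms, which are constrained only by the
   affine relation b. *)
Definition in_coamoeba b c u := exists t : I -> R,
  [/\ forall i, 0 < t i, balanced u t & balance_value b t = c].

Lemma balanced_shift u t x : balanced u t ->
  \sum_i t i * cos (u i - x) = 0 /\ \sum_i t i * sin (u i - x) = 0.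
Proof.
move=> [tc ts]; split.
- rewrite (eq_bigr (fun i => cos x * (t i * cos (u i)) + sin x * (t i * sin (u i)))).
    by rewrite big_split/= -!mulr_sumr tc ts !mulr0 addr0.
  by move=> i _; rewrite cosB; ring.
- rewrite (eq_bigr (fun i => cos x * (t i * sin (u i)) - sin x * (t i * cos (u i)))).
    by rewrite big_split/= sumrN -!mulr_sumr tc ts !mulr0 subr0.
  by move=> i _; rewrite sinB; ring.
Qed.

Lemma balancedB u t x : balanced u t -> balanced (fun i => u i - x) t.
Proof. exact: balanced_shift. Qed.

Lemma balancedN u t : balanced u t -> balanced (fun i => - u i) t.
Proof.
move=> [tc ts]; split.
  by rewrite -[RHS]tc; apply: eq_bigr => i _; rewrite cosN.
by apply: oppr_inj; rewrite oppr0 -sumrN -[RHS]ts; apply: eq_bigr => i _; rewrite sinN mulrN opprK.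
Qed.

Lemma in_coamoebaN b c u : in_coamoeba b c u <-> in_coamoeba b c (fun i => - u i).
Proof.
have H v : in_coamoeba b c v -> in_coamoeba b c (fun i => - v i).
  by move=> [t [t0 bal bt]]; exists t; split=> //; exact: balancedN.
split; first exact: H.
by move/H; congr in_coamoeba; apply/funext => i; rewrite opprK.
Qed.

Lemma balance_valueN b t : balance_value (fun i => - b i) t = - balance_value b t.
Proof. by rewrite /balance_value -sumrN; apply: eq_bigr => i _; rewrite mulNr. Qed.

Lemma in_coamoeba_opp b c u :
  in_coamoeba (fun i => - b i) (- c) u <-> in_coamoeba b c u.
Proof.
split=> -[t [t0 bal bt]]; exists t; split=> //.
  by apply: oppr_inj; rewrite -balance_valueN.
by rewrite balance_valueN bt.
Qed.

(** Relative to the smallest argument all imaginary parts are nonnegative, so they vanish. Every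
    argument is then [u k] or [u k + pi]; the bound between opposite signs leaves only one of the
    two values, and the real part cannot vanish. *)
Lemma not_in_coamoeba_halfplane b c u (p0 n0 : I) :
  0 < b p0 -> b n0 < 0 -> (forall i, b i != 0) ->
  (forall i j, u i - u j <= pi) ->
  (forall p n, 0 < b p -> b n < 0 -> `|u p - u n| < pi) ->
  ~ in_coamoeba b c u.
Proof.
move=> bp0 bn0 b0 upi upn [t [t0 bal _]].
have [k _ kmin] := Order.TotalTheory.arg_minP u (erefl (xpredT p0)).
have [tc ts] := balanced_shift (u k) bal.
have s0 i : 0 <= sin (u i - u k).
  by apply: sin_ge0_pi; rewrite upi subr_ge0 kmin.
have {}ts i : sin (u i - u k) = 0.
  have /eqP := ts; rewrite psumr_eq0 => [|j _]; last by rewrite mulr_ge0// ltW.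
  by move/allP/(_ i (mem_index_enum i)); rewrite /= mulf_eq0 gt_eqF//= => /eqP.
have ui i : u i = u k \/ u i = u k + pi.
  have := kmin i isT; rewrite le_eqVlt => /orP[/eqP ->|ki]; first by left.
  have := upi i k; rewrite le_eqVlt => /orP[/eqP uik|ik]; first by right; lra.
  have : 0 < sin (u i - u k) by apply: sin_gt0_pi; rewrite subr_gt0 ki.
  by rewrite ts ltxx.
have sgn i : 0 < b i \/ b i < 0 by have := b0 i; rewrite neq_lt => /orP[]; [right|left].
have same p n : 0 < b p -> b n < 0 -> u p = u n.
  move=> bp bn; have := upn p n bp bn; have := @pi_gt0 R.
  by move: (ui p) (ui n) => [->|->] [->|->] //; rewrite ltr_norml; lra.
have all_same i : u i = u k.
  have aux j : u j = u n0.
    have [bj|bj] := sgn j; first exact: same.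
    by rewrite -(same p0 j)// (same p0 n0).
  by rewrite !aux.
move: tc; under eq_bigr do rewrite all_same subrr cos0 mulr1.
move/eqP; rewrite psumr_eq0 => [|j _]; last by rewrite ltW.
by move/allP/(_ k (mem_index_enum k)); rewrite /= gt_eqF.
Qed.

Lemma continuous_balance_value b (f : I -> R -> R) s :
  (forall i, {for s, continuous (f i)}) -> (forall i, 0 < f i s) ->
  {for s, continuous (fun s => balance_value b (f ^~ s))}.
Proof.
move=> cf f0; rewrite /balance_value.
apply: (@continuous_at_sum _ _ (fun i s => b i * ln (f i s))) => i.
apply: cvgMr; apply: (@continuous_comp _ _ _ (f i) (@ln R)); first exact: cf.
exact: continuous_ln.
Qed.

(** Balance is linear in the moduli, so the segment from [t] to [t'] stays balanced, and the
    intermediate value theorem applies along it. *)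
Lemma in_coamoeba_IVT b c u t t' :
  (forall i, 0 < t i) -> (forall i, 0 < t' i) -> balanced u t -> balanced u t' ->
  balance_value b t <= c -> c <= balance_value b t' -> in_coamoeba b c u.
Proof.
move=> t0 t'0 [tc ts] [tc' ts'] tlec clet'.
pose f i (s : R) := t i + s * (t' i - t i).
have f0 i s : s \in `[0, 1]%R -> 0 < f i s.
  rewrite in_itv/= => /andP[s0 s1]; rewrite /f.
  have -> : t i + s * (t' i - t i) = (1 - s) * t i + s * t' i by ring.
  have [->|sn0] := eqVneq s 0; first by rewrite subr0 mul1r mul0r addr0.
  by rewrite ltr_wpDl// ?mulr_ge0 ?subr_ge0// ?ltW// mulr_gt0// lt_neqAle eq_sym sn0.
have [||s s01 fs] := @IVT R (fun s => balance_value b (f ^~ s)) 0 1 c ler01.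
- apply: continuous_in_subspaceT => s s01.
  apply: continuous_balance_value => i; last exact: f0 (set_mem s01).
  by apply: cvgD; [exact: cvg_cst|apply: cvgMl; exact: cvg_id].
- have -> : balance_value b (f ^~ 0) = balance_value b t.
    by congr balance_value; apply/funext => i; rewrite /f mul0r addr0.
  have -> : balance_value b (f ^~ 1) = balance_value b t'.
    by congr balance_value; apply/funext => i; rewrite /f mul1r subrKC.
  by rewrite ge_min tlec le_max clet' orbT.
exists (f ^~ s); split=> // [i|]; first exact: f0.
by rewrite /f; split; under eq_bigr do rewrite mulrDl -mulrA mulrBl;
  rewrite big_split/= -mulr_sumr sumrB ?tc ?ts ?tc' ?ts' subrr mulr0 addr0.
Qed.

End Balance.

(** * Triangles of unit vectors around the origin *)

Section Triangles.
Variables (R : realType) (I : finType).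
Implicit Types (b t u w : I -> R) (c x : R) (i j k p n : I).

(* The unit vectors of arguments u i, u j, u k surround 0 counterclockwise. *)
Definition surround u i j k :=
  [/\ 0 < sin (u j - u i), 0 < sin (u k - u j) & 0 < sin (u i - u k)].

Lemma surround_neq u i j k : surround u i j k -> [/\ i != j, j != k & k != i].
Proof.
by move=> [ij jk ki]; split; apply/eqP => e; move: ij jk ki;
  rewrite e subrr sin0 ltxx.
Qed.

Lemma big_split3 (V : zmodType) i j k (F : I -> V) : i != j -> j != k -> k != i ->
  \sum_l F l = F i + F j + F k + \sum_(l | l \notin [:: i; j; k]) F l.
Proof.
move=> ij jk ki; rewrite (bigD1 i)//= (bigD1 j) 1?eq_sym//=.
rewrite (bigD1 k)/=; last by rewrite ki eq_sym jk.
rewrite !addrA; congr (_ + _); apply: eq_bigl => l.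
by rewrite !inE !negb_or andbA.
Qed.

(** A surrounding triangle has a linear relation with positive coefficients; a large multiple of it
    makes any completion of the prescribed weights positive. *)
Lemma balanced_extend u i j k w : surround u i j k ->
  exists t, [/\ forall l, l \notin [:: i; j; k] -> t l = w l,
    forall l, l \in [:: i; j; k] -> 0 < t l & balanced u t].
Proof.
move=> sur; have [ij jk ki] := surround_neq sur.
case: sur => sij sjk ski.
set P := fun l => l \notin [:: i; j; k].
pose C := \sum_(l | P l) w l * cos (u l); pose S := \sum_(l | P l) w l * sin (u l).
pose d := sin (u j - u i).
(* [be1] and [be2] solve [be1 e^(i u_i) + be2 e^(i u_j) = -(C + i S)] by Cramer's rule. The weights
   [sin (u k - u j)], [sin (u i - u k)] and [d] cancel each other on the triangle, and [la] times
   them outweighs negative values of [be1] and [be2]. *)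
pose be1 := (S * cos (u j) - C * sin (u j)) / d.
pose be2 := (C * sin (u i) - S * cos (u i)) / d.
pose la := 1 + `|be1| / sin (u k - u j) + `|be2| / sin (u i - u k).
pose t l := if l == i then la * sin (u k - u j) + be1
  else if l == j then la * sin (u i - u k) + be2
  else if l == k then la * d else w l.
have ti : t i = la * sin (u k - u j) + be1 by rewrite /t eqxx.
have tj : t j = la * sin (u i - u k) + be2 by rewrite /t eq_sym (negbTE ij) eqxx.
have tk : t k = la * d.
  by rewrite /t (negbTE ki) eq_sym (negbTE jk) eqxx.
have tP l : P l -> t l = w l.
  by rewrite /P !inE !negb_or /t => /and3P[/negbTE-> /negbTE-> /negbTE->].
have q1 : 0 <= `|be1| / sin (u k - u j) by rewrite divr_ge0// ltW.
have q2 : 0 <= `|be2| / sin (u i - u k) by rewrite divr_ge0// ltW.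
have la0 : 0 < la by rewrite /la; lra.
have e1 : `|be1| / sin (u k - u j) * sin (u k - u j) = `|be1| by rewrite divfK ?gt_eqF.
have e2 : `|be2| / sin (u i - u k) * sin (u i - u k) = `|be2| by rewrite divfK ?gt_eqF.
exists t; split=> // [l|].
  rewrite !inE => /or3P[] /eqP->; rewrite ?ti ?tj ?tk ?mulr_gt0//.
    have := ler_norm (- be1); rewrite normrN => h.
    have := mulr_ge0 q2 (ltW sjk); rewrite /la; nra.
  have := ler_norm (- be2); rewrite normrN => h.
  have := mulr_ge0 q1 (ltW ski); rewrite /la; nra.
have dn0 : d != 0 by rewrite gt_eqF.
have dE : d = sin (u j) * cos (u i) - cos (u j) * sin (u i) by rewrite /d sinB.
split; rewrite (big_split3 _ ij jk ki) ti tj tk.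
- rewrite (eq_bigr (fun l => w l * cos (u l))); last by move=> l /tP ->.
  rewrite -/C.
  have b1 : be1 * cos (u i) + be2 * cos (u j) = - C.
    by rewrite /be1 /be2 dE; rewrite dE in dn0; field.
  rewrite /d !sinB; move: b1 => /(canRL (addrK _)); lra.
- rewrite (eq_bigr (fun l => w l * sin (u l))); last by move=> l /tP ->.
  rewrite -/S.
  have b1 : be1 * sin (u i) + be2 * sin (u j) = - S.
    by rewrite /be1 /be2 dE; rewrite dE in dn0; field.
  rewrite /d !sinB; move: b1 => /(canRL (addrK _)); lra.
Qed.

Lemma balanced_add u t w x : balanced u t -> balanced u w ->
  balanced u (fun i => t i + x * w i).
Proof.
move=> [tc ts] [wc ws]; split; under eq_bigr do rewrite mulrDl -mulrA;
  by rewrite big_split/= -mulr_sumr ?tc ?ts ?wc ?ws mulr0 addr0.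
Qed.

Lemma norm_ln_between (x y z : R) : 0 < x -> x <= y -> y <= z ->
  `|ln y| <= `|ln x| + `|ln z|.
Proof.
move=> x0 xy yz; have y0 : 0 < y by exact: lt_le_trans xy.
have z0 : 0 < z by exact: lt_le_trans yz.
have := ler_ln x0 y0; have := ler_ln y0 z0; rewrite xy yz => h1 h2.
have := ler_norm (ln z); have := ler_norm (- ln x); rewrite normrN.
have := normr_ge0 (ln z); have := normr_ge0 (ln x).
by rewrite ler_norml; lra.
Qed.

(** [z] is balanced and vanishes only at [n], while [w] is balanced and positive. In [z + e^(-x) w]
    the modulus at [n] tends to 0 as [x] grows, and since [b n < 0] its logarithm pushes the balance
    value up. *)
Lemma balance_value_unbounded b u i j k n M : surround u i j k ->
  n \notin [:: i; j; k] -> b n < 0 ->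
  exists t, [/\ forall l, 0 < t l, balanced u t & M <= balance_value b t].
Proof.
move=> sur nijk bn.
have [w [wo wi wb]] := balanced_extend (fun=> 1) sur.
have [z [zo zi zb]] := balanced_extend (fun l => (l != n)%:R) sur.
have w0 l : 0 < w l.
  by have [/wi//|/wo->] := boolP (l \in [:: i; j; k]).
have z0 l : l != n -> 0 < z l.
  by move=> ln; have [/zi//|/zo->] := boolP (l \in [:: i; j; k]); rewrite ln.
have zn : z n = 0 by rewrite zo// eqxx.
(* For [x >= 0] the other moduli stay between [z l] and [z l + w l], so [K] bounds their
   contribution; [x] is then solved for to reach [M]. *)
pose K := \sum_(l | l != n) `|b l| * (`|ln (z l)| + `|ln (z l + w l)|).
pose x := (`|M| + K + `|b n * ln (w n)|) / (- b n).
have K0 : 0 <= K by apply: sumr_ge0 => l _; rewrite mulr_ge0// addr_ge0.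
have x0 : 0 <= x by rewrite divr_ge0 ?addr_ge0// oppr_ge0 ltW.
exists (fun l => z l + expR (- x) * w l); split.
- move=> l; have [->|ln] := eqVneq l n.
    by rewrite zn add0r mulr_gt0// expR_gt0.
  by rewrite addr_gt0 ?z0// mulr_gt0// expR_gt0.
- exact: balanced_add.
rewrite /balance_value (bigD1 n)//= zn add0r lnM ?posrE ?expR_gt0// expRK.
have : - K <= \sum_(l | l != n) b l * ln (z l + expR (- x) * w l).
  rewrite /K -sumrN; apply: ler_sum => l ln.
  rewrite lerNl; apply: (le_trans (ler_norm _)); rewrite normrN normrM ler_wpM2l//.
  apply: norm_ln_between; rewrite ?z0//.
    by rewrite lerDl mulr_ge0 ?expR_ge0// ltW.
  by rewrite lerD2l ler_piMl ?(ltW (w0 l))// -expR0 ler_expR oppr_le0.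
have bx : - b n * x = `|M| + K + `|b n * ln (w n)|.
  by rewrite /x mulrCA mulfV ?mulr1// oppr_eq0 lt_eqF.
have := ler_norm (- (b n * ln (w n))); rewrite normrN.
have := ler_norm M; lra.
Qed.

(** One triangle makes the balance value as large as desired, the other as small; [c] lies in
    between. *)
Lemma in_coamoeba_triangles b c u i j k i' j' k' p n :
  surround u i j k -> n \notin [:: i; j; k] -> b n < 0 ->
  surround u i' j' k' -> p \notin [:: i'; j'; k'] -> 0 < b p ->
  in_coamoeba b c u.
Proof.
move=> s1 n1 bn s2 p2 bp.
have [t [t0 tb tM]] := balance_value_unbounded c s1 n1 bn.
have bp' : (fun l => - b l) p < 0 by rewrite oppr_lt0.
have [t' [t'0 t'b]] := balance_value_unbounded (b := fun l => - b l) (- c) s2 p2 bp'.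
rewrite balance_valueN lerN2 => t'M.
exact: in_coamoeba_IVT t'0 t0 t'b tb t'M tM.
Qed.

Lemma sin_gt0_2pi (x : R) : - (2 * pi) < x < - pi -> 0 < sin x.
Proof.
by move=> h; rewrite -sinD2pi -mulr_natl; apply: sin_gt0_pi; lra.
Qed.

Lemma surround_window u i j k : u i < u j < u k -> u j - u i < pi ->
  u k - u j < pi -> pi < u k - u i -> surround u i j k.
Proof.
move=> ijk ij jk ik; split; [apply: sin_gt0_pi; lra|apply: sin_gt0_pi; lra|].
by apply: sin_gt0_2pi; lra.
Qed.

Lemma surround_window2 u i j k : u i - 2 * pi < u j < u k -> u j - u i < - pi ->
  u k - u j < pi -> u k - u i < 0 -> - pi < u k - u i -> surround u i j k.
Proof.
move=> ijk ij jk ik ik'; split; [apply: sin_gt0_2pi; lra|apply: sin_gt0_pi; lra|].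
by apply: sin_gt0_pi; lra.
Qed.

(* The four arguments wind once around the circle. *)
Lemma in_coamoeba_winding b c u p n p' n' :
  0 < b p -> 0 < b p' -> b n < 0 -> b n' < 0 ->
  `|u p - u n| < pi -> `|u n - u p'| < pi -> `|u p' - u n'| < pi ->
  pi < u p - u n' < 3 * pi -> sin (u p - u p') != 0 -> sin (u n - u n') != 0 ->
  in_coamoeba b c u.
Proof.
move=> bp bp' bn bn'; rewrite !ltr_norml => pn np' pn' /andP[w1 w2] spp snn.
have pp : u p - u p' != pi by apply: contra_neq spp => ->; rewrite sinpi.
have nn : u n - u n' != pi by apply: contra_neq snn => ->; rewrite sinpi.
have pi0 := @pi_gt0 R.
have np : n != n' by apply/eqP => e; move: pn; rewrite e; lra.
have ppn : p != p' by apply/eqP => e; move: pn'; rewrite -e; lra.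
have pneq q m : 0 < b q -> b m < 0 -> q != m.
  by move=> bq bm; apply/eqP => e; move: bq; rewrite e; lra.
have npeq q m : 0 < b q -> b m < 0 -> m != q by move=> *; rewrite eq_sym pneq.
have [i [j [k [m [s1 n1 bm]]]]] : exists i j k m,
    [/\ surround u i j k, m \notin [:: i; j; k] & b m < 0].
  (* Which of [n] and [n'] completes [p] and [p'] to a surrounding triangle depends on the side of
     [pi] on which the gap between [p] and [p'] lies; the other one is omitted. *)
  have : u p - u p' < pi \/ pi < u p - u p'.
    by move: pp; rewrite neq_lt => /orP.
  case=> h.
    exists p, n', p', n; split=> //; last first.
      by rewrite !inE !negb_or; apply/and3P; split;
        first [exact: npeq|exact: pneq|done|rewrite eq_sym].
    by apply: surround_window2; lra.
  exists p', n, p, n'; split=> //; last first.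
      by rewrite !inE !negb_or; apply/and3P; split;
        first [exact: npeq|exact: pneq|done|rewrite eq_sym].
  by apply: surround_window; lra.
have [i' [j' [k' [m' [s2 n2 bm']]]]] : exists i j k m,
    [/\ surround u i j k, m \notin [:: i; j; k] & 0 < b m].
  have : u n - u n' < pi \/ pi < u n - u n'.
    by move: nn; rewrite neq_lt => /orP.
  case=> h.
    exists n', n, p, p'; split=> //; last first.
      by rewrite !inE !negb_or; apply/and3P; split;
        first [exact: npeq|exact: pneq|done|rewrite eq_sym].
    by apply: surround_window; lra.
  exists n', p', n, p; split=> //; last first.
      by rewrite !inE !negb_or; apply/and3P; split;
        first [exact: npeq|exact: pneq|done|rewrite eq_sym].
  by apply: surround_window; lra.
exact: in_coamoeba_triangles s1 n1 bm s2 n2 bm'.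
Qed.

(** The triangle [p'], [n], [p] omits both [q] and [n'], so it serves for the two signs. *)
Lemma in_coamoeba_wide b c u p p' q n n' :
  0 < b p -> 0 < b p' -> 0 < b q -> q != p -> q != p' ->
  b n < 0 -> b n' < 0 -> n != n' ->
  `|u p - u n| < pi -> `|u p' - u n| < pi -> pi < u p - u p' ->
  in_coamoeba b c u.
Proof.
move=> bp bp' bq qp qp' bn bn' nn; rewrite !ltr_norml => pn p'n w.
have s : surround u p' n p by apply: surround_window; lra.
have pneq r m : 0 < b r -> b m < 0 -> r != m.
  by move=> br bm; apply/eqP => e; move: br; rewrite e; lra.
have npeq r m : 0 < b r -> b m < 0 -> m != r by move=> *; rewrite eq_sym pneq.
apply: (in_coamoeba_triangles (n := n') (p := q) c s _ bn' s _ bq).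
  by rewrite !inE !negb_or; apply/and3P; split; [exact: npeq|rewrite eq_sym|exact: npeq].
by rewrite !inE !negb_or qp qp' pneq.
Qed.

End Triangles.

(** * Monotonicity of a product of moduli under rotation *)

Section Narrowing.
Variable R : realType.

Lemma is_derive_lin_trig (A B a k r : R) :
  is_derive r 1 (fun x => A * sin (a + k * x) + B * cos (a + k * x))
    (k * (A * cos (a + k * r) - B * sin (a + k * r))).
Proof.
have aff : is_derive r 1 (fun x : R => a + k * x) k.
  by apply: is_derive_eq; rewrite add0r mul1r -[RHS]mulr1.
have h1 : is_derive r 1 (A \*: (sin \o (fun x : R => a + k * x))
    + B \*: (cos \o (fun x : R => a + k * x)))
  (A *: (cos (a + k * r) * k) + B *: (- sin (a + k * r) * k)).
  by apply: is_deriveD; apply: is_deriveZ; apply: is_derive1_comp.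
by apply: (is_derive_eq h1); rewrite /GRing.scale/=; ring.
Qed.

Lemma is_derive_ln_comp (k df r : R) (f : R -> R) : 0 < f r -> is_derive r 1 f df ->
  is_derive r 1 (fun x => k * ln (f x)) (k * (df / f r)).
Proof.
move=> f0 fd.
have h : is_derive r 1 (k \*: (@ln R \o f)) (k *: ((f r)^-1 * df)).
  apply: is_deriveZ; apply: is_derive1_comp; exact: is_derive1_ln.
by apply: (is_derive_eq h); rewrite /GRing.scale/= [_^-1 * _]mulrC.
Qed.

(** With [x = sqrt N sin A], [y = sqrt N sin B], [w = sin (A + B)] and the cosines for the primed
    letters, this is an inequality between [cot A], [cot B] and [cot (A + B)]. Over a common
    denominator the numerator is a sum of two squares. *)
Lemma wedge_derivative_ge0 (p q x x' y y' N w w' : R) :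
  0 < p -> 0 < q -> 0 < x -> 0 < y -> 0 < N -> 0 < w ->
  x * y' + x' * y = N * w -> x' * y' - x * y = N * w' ->
  0 <= p * (q^-1 * x' / x) + q * (p^-1 * y' / y) - (p + q) * ((p^-1 + q^-1) * w' / w).
Proof.
move=> p0 q0 x0 y0 N0 w0 e1 e2.
have wE : w = (x * y' + x' * y) / N by rewrite e1 mulrC mulKf ?gt_eqF.
have w'E : w' = (x' * y' - x * y) / N by rewrite e2 mulrC mulKf ?gt_eqF.
have wn : x * y' + x' * y != 0 by rewrite e1 mulf_neq0 ?gt_eqF.
suff -> : p * (q^-1 * x' / x) + q * (p^-1 * y' / y) - (p + q) * ((p^-1 + q^-1) * w' / w)
    = ((p * (x' * y) - q * (y' * x)) ^+ 2 + (p + q) ^+ 2 * (x * y) ^+ 2)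
      / (p * q * (x * y) * (N * w)).
  apply: divr_ge0; first by rewrite addr_ge0 ?sqr_ge0// mulr_ge0// sqr_ge0.
  by rewrite ltW// !mulr_gt0.
rewrite w'E wE; field.
by rewrite wn !gt_eqF.
Qed.

(* The solution of [t1 * e^(i al) + t2 * e^(i be) + (C + i S) = 0] is
   [t1 = (S cos be - C sin be) / sin (be - al)] and
   [t2 = (C sin al - S cos al) / sin (be - al)]; the function [t1^p * t2^q]
   increases when [al] decreases and [be] increases at speeds 1/p and 1/q. *)
Lemma wedge_monotone (C S al be p q s : R) : 0 < p -> 0 < q -> 0 <= s ->
  let X r := S * cos (be + q^-1 * r) - C * sin (be + q^-1 * r) in
  let Y r := C * sin (al - p^-1 * r) - S * cos (al - p^-1 * r) in
  let W r := sin (be - al + (p^-1 + q^-1) * r) in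
  let g r := p * ln (X r) + q * ln (Y r) - (p + q) * ln (W r) in
  (forall r, 0 <= r <= s -> [/\ 0 < X r, 0 < Y r & 0 < W r]) ->
  g 0 <= g s.
Proof.
move=> p0 q0 s0 X Y W g pos.
pose b r := be + q^-1 * r; pose a r := al - p^-1 * r.
pose X' r := - (S * sin (b r) + C * cos (b r)).
pose Y' r := - (C * cos (a r) + S * sin (a r)).
pose W' r := cos (b r - a r).
have WE r : be - al + (p^-1 + q^-1) * r = b r - a r by rewrite /a /b; ring.
pose g' r := p * (q^-1 * X' r / X r) + q * (p^-1 * Y' r / Y r)
  - (p + q) * ((p^-1 + q^-1) * W' r / W r).
have gd r : 0 <= r <= s -> is_derive r 1 g (g' r).
  move=> /pos[X0 Y0 W0].
  have dX : is_derive r 1 X (q^-1 * X' r).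
    have := is_derive_lin_trig (- C) S be q^-1 r.
    have -> : (fun x => - C * sin (be + q^-1 * x) + S * cos (be + q^-1 * x)) = X.
      by apply/funext => x; rewrite /X; ring.
    by move=> h; apply: (is_derive_eq h); rewrite /X' /b; ring.
  have dY : is_derive r 1 Y (p^-1 * Y' r).
    have := is_derive_lin_trig C (- S) al (- p^-1) r.
    have -> : (fun x => C * sin (al + - p^-1 * x) + - S * cos (al + - p^-1 * x)) = Y.
      by apply/funext => x; rewrite /Y !mulNr.
    by move=> h; apply: (is_derive_eq h); rewrite /Y' /a; rewrite !mulNr; ring.
  have dW : is_derive r 1 W ((p^-1 + q^-1) * W' r).
    have := is_derive_lin_trig 1 0 (be - al) (p^-1 + q^-1) r.
    have -> : (fun x => 1 * sin (be - al + (p^-1 + q^-1) * x) +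
      0 * cos (be - al + (p^-1 + q^-1) * x)) = W.
      by apply/funext => x; rewrite /W; ring.
    by move=> h; apply: (is_derive_eq h); rewrite /W' WE; ring.
  apply: is_deriveB; last exact: is_derive_ln_comp.
  by apply: is_deriveD; exact: is_derive_ln_comp.
apply: (@ger0_derive1_ndecr _ g 0 s _ _ _ 0 s (lexx 0) s0 (lexx s)).
- move=> r; rewrite in_itv/= => /andP[r0 rs].
  by have [] := gd r; rewrite ?(ltW r0) ?(ltW rs).
- move=> r; rewrite in_itv/= => /andP[r0 rs].
  have rs' : 0 <= r <= s by rewrite (ltW r0) (ltW rs).
  rewrite derive1E (@derive_val _ _ _ _ _ _ _ (gd r rs')) /g'.
  have [X0 Y0 W0] := pos r rs'.
  (* [N] is the squared modulus of [C + i S], and the addition formulas give the relations [e1] and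
     [e2]. *)
  pose N := C ^+ 2 + S ^+ 2.
  have e1 : X r * Y' r + X' r * Y r = N * W r.
    by rewrite /X /Y /X' /Y' /W WE sinB /N -/(a r) -/(b r); ring.
  have e2 : X' r * Y' r - X r * Y r = N * W' r.
    by rewrite /X /Y /X' /Y' /W' cosB /N -/(a r) -/(b r); ring.
  have XY0 : 0 < X r * Y r by rewrite mulr_gt0.
  have N0 : 0 < N.
    rewrite lt_neqAle addr_ge0 ?sqr_ge0// andbT; apply/eqP => N0.
    have := N0; rewrite /N => /esym/eqP; rewrite paddr_eq0 ?sqr_ge0// !sqrf_eq0.
    by move=> /andP[/eqP C0 /eqP S0]; move: X0; rewrite /X C0 S0; lra.
  exact: (@wedge_derivative_ge0 _ _ _ _ _ _ N).
- apply: derivable_within_continuous => r; rewrite in_itv/= => rs.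
  by have [] := gd r rs.
Qed.

End Narrowing.

(** * A pair of the same sign more than a half-turn apart *)

Section Wedge.
Variables (R : realType) (I : finType).
Implicit Types (b t u v w : I -> R) (c x : R) (i j k p n : I).

(** A solution at the narrowed arguments [v] gives a balanced vector at [u] when the moduli of the
    negative indices are kept and the other two are solved for. By [wedge_monotone] its balance
    value is at most [c]; the triangle [p'], [n], [p], which omits [n'], provides values above
    [c]. *)
Lemma in_coamoeba_narrow b c u v p p' n n' (s : R) :
  0 < b p -> 0 < b p' -> p != p' -> (forall q, 0 < b q -> q = p \/ q = p') ->
  (forall i, b i != 0) -> b n < 0 -> b n' < 0 -> n != n' ->
  (forall m, b m < 0 -> `|u p - u m| < pi /\ `|u p' - u m| < pi) ->
  0 <= s ->
  v p = u p - (b p)^-1 * s -> v p' = u p' + (b p')^-1 * s ->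
  (forall m, b m < 0 -> v m = u m) ->
  pi < u p - u p' -> 0 <= v p - v p' -> in_coamoeba b c v -> in_coamoeba b c u.
Proof.
move=> bp bp' pp' P b0 bn bn' nn' near s0 vp vp' vm wide v0 cv.
have pi0 := @pi_gt0 R.
have q1 : 0 <= (b p)^-1 * s by rewrite mulr_ge0// invr_ge0 ltW.
have q2 : 0 <= (b p')^-1 * s by rewrite mulr_ge0// invr_ge0 ltW.
have sgn i : 0 < b i \/ b i < 0 by have := b0 i; rewrite neq_lt => /orP[]; [right|left].
have near' m : b m < 0 -> [/\ u p' < u m, u m < u p, u p - u m < pi & u m - u p' < pi].
  by move=> /near; rewrite !ltr_norml => -[]; move: wide; clear => *; split; lra.
(* Once the pair is at most [pi] apart, all of [v] fits in a closed half-plane and cannot be in the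
   coamoeba. *)
have [vle|vgt] := leP (v p - v p') pi.
  exfalso; apply: (not_in_coamoeba_halfplane bp bn b0 _ _ cv).
  - have hp i : 0 < b i -> v p' <= v i <= v p.
      by move=> /P[] ->; lra.
    have hm i : b i < 0 -> v p - v i < pi /\ v i - v p' < pi.
      by move=> bi; have := near' i bi; rewrite (vm i bi) vp vp' => -[]; lra.
    move=> i j; have [bi|bi] := sgn i; have [bj|bj] := sgn j.
    + have := hp i bi; have := hp j bj; lra.
    + have := hp i bi; have := hm j bj; lra.
    + have := hm i bi; have := hp j bj; lra.
    + have := near' i bi; have := near' j bj; rewrite (vm i bi) (vm j bj) => -[? ? ? ?] [*]; lra.
  - move=> q m /P[] -> bm; have [h1 h2 h3 h4] := near' m bm;
      rewrite (vm m bm) ltr_norml; lra.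
case: cv => t [t0 [tc ts] tb].
pose C := \sum_(m | (m != p) && (m != p')) t m * cos (u m).
pose S := \sum_(m | (m != p) && (m != p')) t m * sin (u m).
have neg m : (m != p) && (m != p') -> b m < 0.
  by move=> /andP[mp mp']; have [/P[] e|//] := sgn m; [move: mp|move: mp']; rewrite e eqxx.
have p'p : p' != p by rewrite eq_sym.
have splitF (F : I -> R) :
    \sum_i F i = F p + F p' + \sum_(m | (m != p) && (m != p')) F m.
  by rewrite (bigD1 p)//= (bigD1 p')//= addrA.
have vC : \sum_(m | (m != p) && (m != p')) t m * cos (v m) = C.
  by apply: eq_bigr => m /neg bm; rewrite (vm m bm).
have vS : \sum_(m | (m != p) && (m != p')) t m * sin (v m) = S.
  by apply: eq_bigr => m /neg bm; rewrite (vm m bm).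
rewrite splitF vC in tc; rewrite splitF vS in ts.
have n_in : (n != p) && (n != p').
  by apply/andP; split; apply/eqP => e; move: bn; rewrite e lt_gtF.
pose X r := S * cos (u p' + (b p')^-1 * r) - C * sin (u p' + (b p')^-1 * r).
pose Y r := C * sin (u p - (b p)^-1 * r) - S * cos (u p - (b p)^-1 * r).
pose W r := sin (u p' - u p + ((b p)^-1 + (b p')^-1) * r).
have pos r : 0 <= r <= s -> [/\ 0 < X r, 0 < Y r & 0 < W r].
  move=> /andP[r0 rs].
  have r1 : 0 <= (b p)^-1 * r <= (b p)^-1 * s.
    by rewrite mulr_ge0 ?ler_wpM2l ?invr_ge0 ?(ltW bp) ?(ltW bp').
  have r2 : 0 <= (b p')^-1 * r <= (b p')^-1 * s.
    by rewrite mulr_ge0 ?ler_wpM2l ?invr_ge0 ?(ltW bp) ?(ltW bp').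
  have dom (F : I -> R) : (forall m, b m < 0 -> 0 < F m) ->
      0 < \sum_(m | (m != p) && (m != p')) t m * F m.
    move=> F0; rewrite (bigD1 n)//= ltr_pwDl ?mulr_gt0 ?F0//.
    by apply: sumr_ge0 => m /andP[/neg bm _]; rewrite mulr_ge0 ?ltW ?F0.
  split.
  - have -> : X r = \sum_(m | (m != p) && (m != p'))
        t m * sin (u m - (u p' + (b p')^-1 * r)).
      rewrite /X /C /S !mulr_suml -sumrB; apply: eq_bigr => m _.
      by rewrite sinB; ring.
    apply: dom => m bm; have := near' m bm => -[]; move: r1 r2 vgt; rewrite vp vp'; clear => *; apply: sin_gt0_pi; lra.
  - have -> : Y r = \sum_(m | (m != p) && (m != p'))
        t m * sin (u p - (b p)^-1 * r - u m).
      rewrite /Y /C /S !mulr_suml -sumrB; apply: eq_bigr => m _.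
      by rewrite sinB; ring.
    apply: dom => m bm; have := near' m bm => -[]; move: r1 r2 vgt; rewrite vp vp'; clear => *; apply: sin_gt0_pi; lra.
  - rewrite /W mulrDl; have := near' n bn => -[].
    by move: r1 r2 wide pi0 vgt; rewrite vp vp'; clear => *; apply: sin_gt0_2pi; lra.
have gmono : b p * ln (X 0) + b p' * ln (Y 0) - (b p + b p') * ln (W 0) <=
    b p * ln (X s) + b p' * ln (Y s) - (b p + b p') * ln (W s).
  exact: (wedge_monotone bp bp' s0 pos).
have s00 : 0 <= (0 : R) <= s by rewrite lexx.
have s0s : 0 <= s <= s by rewrite lexx s0.
have [X0 Y0 W0] := pos 0 s00; have [Xs Ys Ws] := pos s s0s.
have WE r : W r = sin ((u p' + (b p')^-1 * r) - (u p - (b p)^-1 * r)).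
  by rewrite /W; congr sin; ring.
have CE : C = - (t p * cos (v p) + t p' * cos (v p')).
  by apply/eqP; rewrite -addr_eq0 addrC tc.
have SE : S = - (t p * sin (v p) + t p' * sin (v p')).
  by apply/eqP; rewrite -addr_eq0 addrC ts.
have tp : t p = X s / W s.
  apply/(canRL (mulfK _)); first by rewrite gt_eqF.
  rewrite WE /X -vp -vp' sinB CE SE; ring.
have tp' : t p' = Y s / W s.
  apply/(canRL (mulfK _)); first by rewrite gt_eqF.
  rewrite WE /Y -vp -vp' sinB CE SE; ring.
(* [tp] and [tp'] are the wedge formulas at time [s]; [z] uses them at time 0. *)
pose z i := if i == p then X 0 / W 0 else if i == p' then Y 0 / W 0 else t i.
have zp : z p = X 0 / W 0 by rewrite /z eqxx.
have zp' : z p' = Y 0 / W 0 by rewrite /z (negbTE p'p) eqxx.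
have zm m : (m != p) && (m != p') -> z m = t m.
  by rewrite /z => /andP[/negbTE-> /negbTE->].
have z0 i : 0 < z i by rewrite /z; case: eqP => _; [|case: eqP => _]; rewrite ?divr_gt0.
have zb : balanced u z.
  have W0n : W 0 != 0 by rewrite gt_eqF.
  split; rewrite splitF zp zp'.
  - rewrite (eq_bigr (fun m => t m * cos (u m))); last by move=> m /zm ->.
    rewrite -/C; have -> : X 0 / W 0 * cos (u p) + Y 0 / W 0 * cos (u p') =
      (X 0 * cos (u p) + Y 0 * cos (u p')) / W 0 by ring.
    have -> : X 0 * cos (u p) + Y 0 * cos (u p') = - C * W 0.
      by rewrite /X /Y WE !mulr0 addr0 subr0 sinB; ring.
    by rewrite mulfK// addNr.
  - rewrite (eq_bigr (fun m => t m * sin (u m))); last by move=> m /zm ->.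
    rewrite -/S; have -> : X 0 / W 0 * sin (u p) + Y 0 / W 0 * sin (u p') =
      (X 0 * sin (u p) + Y 0 * sin (u p')) / W 0 by ring.
    have -> : X 0 * sin (u p) + Y 0 * sin (u p') = - S * W 0.
      by rewrite /X /Y WE !mulr0 addr0 subr0 sinB; ring.
    by rewrite mulfK// addNr.
have zc : balance_value b z <= c.
  rewrite -tb /balance_value !splitF zp zp' tp tp'.
  rewrite (eq_bigr (fun m => b m * ln (t m))); last by move=> m /zm ->.
  rewrite lerD2r !ln_div ?posrE//; move: gmono; clear; lra.
have sur : surround u p' n p.
  have sw := @surround_window R I u p' n p; move: sw wide (near' n bn); clear => sw ? [? ? ? ?].
  by apply: sw; lra.
have n'in : n' \notin [:: p'; n; p].
  by rewrite !inE !negb_or [_ == n]eq_sym nn'; apply/andP; split; apply/eqP => e;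
    move: bn'; rewrite e lt_gtF.
have [z' [z'0 z'b z'c]] := balance_value_unbounded c sur n'in bn'.
exact: in_coamoeba_IVT z0 z'0 zb z'b zc z'c.
Qed.

End Wedge.

(** * Antipodal arguments of opposite signs *)

Section Edges.
Variables (R : realType).

Lemma continuous_sin_affine (a k x : R) : {for x, continuous (fun r : R => sin (a + k * r))}.
Proof.
apply: (@continuous_comp _ _ _ (fun r : R => a + k * r) (@sin R)).
  by apply: cvgD; [exact: cvg_cst|apply: cvgMr; exact: cvg_id].
exact: continuous_sin.
Qed.

Lemma continuous_cos_affine (a k x : R) : {for x, continuous (fun r : R => cos (a + k * r))}.
Proof.
apply: (@continuous_comp _ _ _ (fun r : R => a + k * r) (@cos R)).
  by apply: cvgD; [exact: cvg_cst|apply: cvgMr; exact: cvg_id].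
exact: continuous_cos.
Qed.

Lemma near0_ball (P : R -> Prop) : (\forall x \near (0 : R), P x) ->
  exists2 r : R, 0 < r & forall x, `|x| < r -> P x.
Proof.
move=> /nbhs_ballP[r r0 h]; exists r => // x xr.
by apply: h; rewrite /ball/= sub0r normrN.
Qed.

Lemma near0_gt0 (f : R -> R) : {for 0, continuous f} -> 0 < f 0 ->
  \forall x \near (0 : R), 0 < f x.
Proof. by move=> cf f0; exact: (@cvgr_gt _ _ _ _ f (f 0) cf 0). Qed.

Variable I : finType.
Implicit Types (b t u v w d : I -> R) (c x : R) (i j k p n : I).

Lemma big_split4 i j k l (F : I -> R) : uniq [:: i; j; k; l] ->
  \sum_m F m = F i + F j + F k + F l + \sum_(m | m \notin [:: i; j; k; l]) F m.
Proof.
move=> un; rewrite (bigID (mem [:: i; j; k; l]))/=; congr (_ + _).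
by rewrite -big_uniq//= !big_cons big_nil addr0 !addrA.
Qed.

(** [p'] and [n'] lie on opposite sides of the line through the antipodal pair, so [tp'] and [tn']
    can balance the components across that line; the weights of [p] and [n], whose difference is
    free, absorb the component [D] along it. *)
Lemma balanced_antipodal u p n p' n' : uniq [:: p; n; p'; n'] ->
  cos (u p - u n) = -1 -> sin (u p - u n) = 0 ->
  0 < sin (u p' - u n) -> sin (u n' - u n) < 0 ->
  exists2 t, forall i, 0 < t i & balanced u t.
Proof.
move=> un cpn spn sp' sn'.
pose C0 := \sum_(m | m \notin [:: p; n; p'; n']) cos (u m - u n).
pose S0 := \sum_(m | m \notin [:: p; n; p'; n']) sin (u m - u n).
pose tn' := (`|S0| + 1) / (- sin (u n' - u n)).
pose tp' := (`|S0| + 1 - S0) / sin (u p' - u n).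
pose D := C0 + tp' * cos (u p' - u n) + tn' * cos (u n' - u n).
pose t i := if i == p then 1 + `|D| + D else if i == n then 1 + `|D|
  else if i == p' then tp' else if i == n' then tn' else 1.
have S0n : 0 <= `|S0| by []. have Dn : 0 <= `|D| by [].
have S0' : S0 <= `|S0| by exact: ler_norm.
have D' : - D <= `|D| by rewrite -normrN ler_norm.
have tn'0 : 0 < tn' by rewrite divr_gt0 ?oppr_gt0//; move: S0n; clear; lra.
have tp'0 : 0 < tp' by rewrite divr_gt0//; move: S0'; clear; lra.
have t0 i : 0 < t i.
  rewrite /t; do 4?[case: ifP => _ //].
  by move: D'; clear; lra.
have := un; rewrite /= !inE !negb_or andbT => /and3P[/and3P[pn pp' pn'] /andP[np' nn'] p'n'].
have tp : t p = 1 + `|D| + D by rewrite /t eqxx.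
have tn : t n = 1 + `|D| by rewrite /t eq_sym (negbTE pn) eqxx.
have tp'E : t p' = tp'.
  by rewrite /t eq_sym (negbTE pp') eq_sym (negbTE np') eqxx.
have tn'E : t n' = tn'.
  by rewrite /t eq_sym (negbTE pn') eq_sym (negbTE nn') eq_sym (negbTE p'n') eqxx.
have tm m : m \notin [:: p; n; p'; n'] -> t m = 1.
  by rewrite !inE !negb_or /t => /and4P[/negbTE-> /negbTE-> /negbTE-> /negbTE->].
exists t => //.
suff bal : balanced (fun i => u i - u n) t.
  have := balancedB (- u n) bal; congr balanced; apply/funext => i.
  by rewrite opprK subrK.
split; rewrite (big_split4 _ un) tp tn tp'E tn'E ?cpn ?spn subrr ?cos0 ?sin0.
- rewrite (eq_bigr (fun m => cos (u m - u n))); last by move=> m /tm ->; rewrite mul1r.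
  by rewrite -/C0 /D; ring.
- rewrite (eq_bigr (fun m => sin (u m - u n))); last by move=> m /tm ->; rewrite mul1r.
  rewrite -/S0 /tp' /tn' invrN mulrN mulNr (divfK (lt0r_neq0 sp')) (divfK (ltr0_neq0 sn')).
  by ring.
Qed.

(** The vectors at [p] and [n] do not move and are independent. Corrections of their two weights,
    given by Cramer's rule, restore the balance; they are continuous and vanish at [s = 0]. *)
Lemma balanced_deform b u v t (p n : I) : (forall i, 0 < t i) -> balanced u t ->
  p != n -> v p = 0 -> v n = 0 -> sin (u p - u n) != 0 ->
  exists z : I -> R -> R,
  [/\ forall s, balanced (fun i => u i + v i * s) (z ^~ s),
      forall i, \forall s \near (0 : R), 0 < z i s &
      (balance_value b (z ^~ s) @[s --> (0 : R)] --> balance_value b t)].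
Proof.
move=> t0 [tc ts] pn vp vn spn.
pose rc (s : R) := \sum_i t i * cos (u i + v i * s).
pose rs (s : R) := \sum_i t i * sin (u i + v i * s).
have rc0 : rc 0 = 0 by rewrite -[RHS]tc; apply: eq_bigr => i _; rewrite mulr0 addr0.
have rs0 : rs 0 = 0 by rewrite -[RHS]ts; apply: eq_bigr => i _; rewrite mulr0 addr0.
have crc : {for 0, continuous rc}.
  apply: (@continuous_at_sum _ _ (fun i s => t i * cos (u i + v i * s))) => i.
  by apply: cvgMr; exact: continuous_cos_affine.
have crs : {for 0, continuous rs}.
  apply: (@continuous_at_sum _ _ (fun i s => t i * sin (u i + v i * s))) => i.
  by apply: cvgMr; exact: continuous_sin_affine.
pose z i s := t i + (if i == p then (sin (u n) * rc s - cos (u n) * rs s) / sin (u p - u n)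
  else if i == n then (cos (u p) * rs s - sin (u p) * rc s) / sin (u p - u n) else 0).
have z0 i : z i 0 = t i.
  by rewrite /z rc0 rs0 !mulr0 subrr !mul0r !if_same addr0.
have cz i : {for 0, continuous (z i)}.
  rewrite /z; apply: cvgD; first exact: cvg_cst.
  have [_|_] := eqVneq i p; [|have [_|_] := eqVneq i n; last exact: cvg_cst];
    by apply: cvgMl; apply: cvgB; apply: cvgMr; [exact: crc|exact: crs] ||
      (apply: cvgMl; apply: cvgB; apply: cvgMr; [exact: crs|exact: crc]).
exists z; split.
- move=> s; split.
  + rewrite /z; under eq_bigr do rewrite mulrDl.
    rewrite big_split/= -/(rc s) (bigD1 p)//= eqxx (bigD1 n) 1?eq_sym//=.
    rewrite (negbTE pn) eqxx big1 => [|i /andP[/negbTE-> /negbTE->]]; last by rewrite mul0r.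
    rewrite vp vn !mul0r !addr0; move: spn; rewrite sinB => spn; field.
    by rewrite spn.
  + rewrite /z; under eq_bigr do rewrite mulrDl.
    rewrite big_split/= -/(rs s) (bigD1 p)//= eqxx (bigD1 n) 1?eq_sym//=.
    rewrite (negbTE pn) eqxx big1 => [|i /andP[/negbTE-> /negbTE->]]; last by rewrite mul0r.
    rewrite vp vn !mul0r !addr0; move: spn; rewrite sinB => spn; field.
    by rewrite spn.
- by move=> i; apply: (@near0_gt0 (z i)); [exact: cz|rewrite z0].
- have <- : balance_value b (z ^~ 0) = balance_value b t.
    by congr balance_value; apply/funext => i.
  by apply: continuous_balance_value => // i; rewrite z0.
Qed.

(** An antipodal pair of opposite signs is a limit of coamoeba points. Turning [p] away from the
    antipode of [n] creates a surrounding triangle with a vector on one side of the line; [n'] moves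
    as well, to keep the displacement orthogonal to [b]. *)
Lemma in_coamoeba_edge_pos b c u p n p' n' (e : R) :
  0 < b p -> 0 < b p' -> b n < 0 -> b n' < 0 -> p != p' -> n != n' ->
  cos (u p - u n) = -1 -> sin (u p - u n) = 0 ->
  0 < sin (u p' - u n) -> sin (u n' - u n) != 0 -> 0 < e ->
  exists d, [/\ forall i, `|d i| < e, \sum_i b i * d i = 0 &
    in_coamoeba b c (fun i => u i + d i)].
Proof.
move=> bp bp' bn bn' pp' nn' cpn spn sp'n sn'n e0.
have pneq q m : 0 < b q -> b m < 0 -> q != m.
  by move=> bq bm; apply/eqP => E; move: bq; rewrite E ltNge ltW.
have npeq q m : 0 < b q -> b m < 0 -> m != q by move=> *; rewrite eq_sym pneq.
pose v i := if i == p then (b p)^-1 else if i == n' then - (b n')^-1 else 0.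
have vp : v p = (b p)^-1 by rewrite /v eqxx.
have vn' : v n' = - (b n')^-1 by rewrite /v (negbTE (npeq p n' bp bn')) eqxx.
have vo i : i != p -> i != n' -> v i = 0 by rewrite /v => /negbTE -> /negbTE ->.
have vp' : v p' = 0 by rewrite vo// 1?eq_sym// npeq.
have vn : v n = 0 by rewrite vo// npeq.
have vb s : \sum_i b i * (v i * s) = 0.
  rewrite (bigD1 p)//= (bigD1 n')/=; last exact: npeq.
  rewrite big1 => [|i /andP[ip in']]; last by rewrite vo// mul0r mulr0.
  rewrite vp vn' addr0 mulNr mulrN !mulrA (mulfV (lt0r_neq0 bp)).
  by rewrite (mulfV (ltr0_neq0 bn')) !mul1r subrr.
have k1 : 0 < (b p)^-1 by rewrite invr_gt0.
have k2 : 0 < - (b n')^-1 by rewrite oppr_gt0 invr_lt0.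
have spp' : sin (u p - u p') = sin (u p' - u n).
  have -> : u p - u p' = (u p - u n) - (u p' - u n) by ring.
  by rewrite sinB cpn spn; ring.
have snp : sin (u n' - u p) = - sin (u n' - u n).
  have -> : u n' - u p = (u n' - u n) - (u p - u n) by ring.
  by rewrite sinB cpn spn; ring.
have Hs : \forall s \near (0 : R), 0 < sin (u p + v p * s - u p').
  have E : (fun s => sin (u p + v p * s - u p')) = (fun s => sin (u p - u p' + v p * s)).
    by apply/funext => s; congr sin; ring.
  apply: (@near0_gt0 (fun s => sin (u p + v p * s - u p'))).
    by rewrite E; exact: continuous_sin_affine.
  by rewrite mulr0 addr0 spp'.
pose sg := Num.sg (sin (u n' - u n)).
have sg2 : sg * sin (u n' - u n) > 0 by rewrite -normrEsg normr_gt0.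
have Hn : \forall s \near (0 : R), 0 < sg * sin (u n' + v n' * s - u n).
  have E : (fun s => sg * sin (u n' + v n' * s - u n)) =
           (fun s => sg * sin (u n' - u n + v n' * s)).
    by apply/funext => s; congr (_ * sin _); ring.
  apply: (@near0_gt0 (fun s => sg * sin (u n' + v n' * s - u n))).
    by rewrite E; apply: cvgMr; exact: continuous_sin_affine.
  by rewrite mulr0 addr0.
have Hnp : \forall s \near (0 : R), 0 < sg * sin (u p + v p * s - (u n' + v n' * s)).
  have E : (fun s => sg * sin (u p + v p * s - (u n' + v n' * s))) =
           (fun s => sg * sin (u p - u n' + (v p - v n') * s)).
    by apply/funext => s; congr (_ * sin _); ring.
  apply: (@near0_gt0 (fun s => sg * sin (u p + v p * s - (u n' + v n' * s)))).
    by rewrite E; apply: cvgMr; exact: continuous_sin_affine.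
  by rewrite !mulr0 !addr0 -opprB sinN snp opprK.
have [r1 r10 h1] := near0_ball Hs.
have [r2 r20 h2] := near0_ball Hn.
have [r3 r30 h3] := near0_ball Hnp.
pose K := 1 + (b p)^-1 + - (b n')^-1.
have K1 : 1 < K by rewrite /K; move: k1 k2; clear; lra.
pose r := Num.min (Num.min r1 r2) (Num.min r3 (Num.min e pi / K)).
have r0 : 0 < r by rewrite !lt_min r10 r20 r30 divr_gt0// ?lt_min ?e0 ?pi_gt0//; move: K1; clear; lra.
have small s : `|s| < r -> [/\ forall i, `|v i * s| < e, `|v p * s| < pi,
   0 < sin (u p + v p * s - u p'), 0 < sg * sin (u n' + v n' * s - u n) &
   0 < sg * sin (u p + v p * s - (u n' + v n' * s))].
  rewrite !lt_min => /andP[/andP[s1 s2] /andP[s3]].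
  rewrite ltr_pdivlMr; last by move: K1; clear; lra.
  rewrite lt_min => /andP[se spi].
  have vK i : `|v i * s| <= `|s| * K.
    rewrite normrM mulrC ler_wpM2l// /v; case: eqP => _; [|case: eqP => _].
    - by rewrite gtr0_norm// /K; move: k1 k2; clear; lra.
    - by rewrite gtr0_norm// /K; move: k1 k2; clear; lra.
    - by rewrite normr0; move: K1; clear; lra.
  split; rewrite ?h1 ?h2 ?h3//.
    by move=> i; exact: le_lt_trans se.
  exact: le_lt_trans spi.
pose w s i := u i + v i * s.
have wp' s : w s p' = u p' by rewrite /w vp' mul0r addr0.
have wn s : w s n = u n by rewrite /w vn mul0r addr0.
have snp_s s : sin (w s n - w s p) = sin (v p * s).
  rewrite wn /w -opprB sinN.
  have -> : u p + v p * s - u n = (u p - u n) + v p * s by ring.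
  by rewrite sinD cpn spn; ring.
have fin s : `|s| < r -> in_coamoeba b c (w s) -> exists d,
   [/\ forall i, `|d i| < e, \sum_i b i * d i = 0 & in_coamoeba b c (fun i => u i + d i)].
  by move=> /small[sm _ _ _ _] cw; exists (fun i => v i * s).
have sur1 s : 0 < s -> `|s| < r -> surround (w s) n p' p.
  move=> s0 /small[_ spi h _ _]; split; rewrite ?wp' ?wn//.
  rewrite -(wn s) snp_s; apply: sin_gt0_pi; rewrite vp mulr_gt0//=.
  by rewrite -vp (le_lt_trans (ler_norm _)).
have r2' : `|r / 2| < r by rewrite gtr0_norm; move: r0; clear; lra.
have nr2' : `|- (r / 2)| < r by rewrite normrN.
have r20' : 0 < r / 2 by move: r0; clear; lra.
have n'1 : n' \notin [:: n; p'; p].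
  by rewrite !inE !negb_or eq_sym nn' !npeq.
move: sn'n; rewrite neq_lt => /orP[sn'|sn'].
(* With [n'] facing [p'] across the line, a balanced [t] exists at [s = 0]. It deforms with [s], and
   the sign of [s] is chosen so that the triangle which appears has its unbounded values on the side
   of [c]. *)
- have sgE : sg = -1 by rewrite /sg ltr0_sg.
  have un : uniq [:: p; n; p'; n'].
    by rewrite /= !inE !negb_or (pneq p n bp bn) pp' (pneq p n' bp bn')
      (npeq p' n bp' bn) nn' (pneq p' n' bp' bn').
  have [t t0 tb] := balanced_antipodal un cpn spn sp'n sn'.
  have p'n : p' != n by rewrite pneq.
  have [z [zb z0 zc]] := balanced_deform b t0 tb p'n vp' vn (lt0r_neq0 sp'n).
  have z0' : \forall s \near (0 : R), forall i, 0 < z i s.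
    exact: (@filter_forall _ I (fun i => [set s | 0 < z i s]) (nbhs (0 : R)) _ z0).
  have [r4 r40 h4] := near0_ball z0'.
  have [tc|tc|tc] := ltgtP (balance_value b t) c; last first.
  + apply: (fin 0); first by rewrite normr0.
    by exists t; split=> //; have := tb; congr balanced; apply/funext => i; rewrite /w mulr0 addr0.
  + have /near0_ball[r5 r50 h5] : \forall s \near (0 : R), c < balance_value b (z ^~ s).
      exact: (@cvgr_gt _ _ _ _ (fun s => balance_value b (z ^~ s)) _ zc).
    pose s := - (Num.min (r / 2) (Num.min (r4 / 2) (r5 / 2))).
    have s0 : s < 0 by rewrite oppr_lt0 !lt_min r20' !divr_gt0.
    have sE : `|s| = Num.min (r / 2) (Num.min (r4 / 2) (r5 / 2)).
      by rewrite ltr0_norm// opprK.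
    have sr : `|s| < r by rewrite sE gt_min; apply/orP; left; move: r0; clear; lra.
    have sr4 : `|s| < r4 by rewrite sE !gt_min; apply/orP; right; apply/orP; left; move: r40; clear; lra.
    have sr5 : `|s| < r5 by rewrite sE !gt_min; apply/orP; right; apply/orP; right; move: r50; clear; lra.
    apply: (fin s) => //.
    have sur : surround (w s) p n' n.
      have [_ spi _ hn hnp] := small s sr.
      split.
      * by move: hnp; rewrite sgE mulN1r -sinN opprB.
      * by move: hn; rewrite sgE mulN1r -sinN opprB wn.
      * rewrite -opprB sinN snp_s -sinN; apply: sin_gt0_pi.
        rewrite vp -mulrN mulr_gt0 ?oppr_gt0//=.
        by rewrite mulrN -vp (le_lt_trans (ler_norm _))// normrN.
    have p'3 : p' \notin [:: p; n'; n].
      by rewrite !inE !negb_or eq_sym pp' !pneq.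
    have bp'' : (fun l => - b l) p' < 0 by rewrite oppr_lt0.
    have [t' [t'0 t'b]] := balance_value_unbounded (b := fun l => - b l) (- c) sur p'3 bp''.
    rewrite balance_valueN lerN2 => t'c.
    exact: in_coamoeba_IVT t'0 (h4 s sr4) t'b (zb s) t'c (ltW (h5 s sr5)).
  + have /near0_ball[r5 r50 h5] : \forall s \near (0 : R), balance_value b (z ^~ s) < c.
      exact: (@cvgr_lt _ _ _ _ (fun s => balance_value b (z ^~ s)) _ zc).
    pose s := Num.min (r / 2) (Num.min (r4 / 2) (r5 / 2)).
    have s0 : 0 < s by rewrite !lt_min r20' !divr_gt0.
    have sE : `|s| = s by rewrite gtr0_norm.
    have sr : `|s| < r by rewrite sE gt_min; apply/orP; left; move: r0; clear; lra.
    have sr4 : `|s| < r4 by rewrite sE !gt_min; apply/orP; right; apply/orP; left; move: r40; clear; lra.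
    have sr5 : `|s| < r5 by rewrite sE !gt_min; apply/orP; right; apply/orP; right; move: r50; clear; lra.
    apply: (fin s) => //.
    have [t' [t'0 t'b t'c]] := balance_value_unbounded c (sur1 s s0 sr) n'1 bn'.
    exact: in_coamoeba_IVT (h4 s sr4) t'0 (zb s) t'b (ltW (h5 s sr5)) t'c.
(* With [n'] on the side of [p'], a small [s > 0] makes both [n], [p'], [p] and [n], [n'], [p]
   surround 0, and these omit an index of each sign. *)
- have sgE : sg = 1 by rewrite /sg gtr0_sg.
  apply: (fin (r / 2)) => //.
  have [_ spi h hn hnp] := small _ r2'.
  have sur := sur1 _ r20' r2'.
  have sur' : surround (w (r / 2)) n n' p.
    split; [by move: hn; rewrite sgE mul1r wn|by move: hnp; rewrite sgE mul1r|].
    by case: sur.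
  apply: (in_coamoeba_triangles c sur n'1 bn' sur' _ bp').
  by rewrite !inE !negb_or (pneq p' n bp' bn) (pneq p' n' bp' bn') eq_sym pp'.
Qed.

Lemma in_coamoeba_edge b c u p n p' n' (e : R) :
  0 < b p -> 0 < b p' -> b n < 0 -> b n' < 0 -> p != p' -> n != n' ->
  cos (u p - u n) = -1 -> sin (u p' - u n) != 0 -> sin (u n' - u n) != 0 -> 0 < e ->
  exists d, [/\ forall i, `|d i| < e, \sum_i b i * d i = 0 &
    in_coamoeba b c (fun i => u i + d i)].
Proof.
move=> bp bp' bn bn' pp' nn' cpn sp' sn' e0.
have spn : sin (u p - u n) = 0 by apply: cos1sin0; rewrite cpn normrN1.
move: sp'; rewrite neq_lt => /orP[sp'|sp']; last first.
  exact: (@in_coamoeba_edge_pos b c u p n p' n' e).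
(* Complex conjugation moves [p'] to the other side of the line. *)
have Ns i j : - u i - - u j = - (u i - u j) by rewrite opprK opprB addrC.
have [] := @in_coamoeba_edge_pos b c (fun i => - u i) p n p' n' e => //.
- by rewrite Ns cosN.
- by rewrite Ns sinN spn oppr0.
- by rewrite Ns sinN oppr_gt0.
- by rewrite Ns sinN oppr_eq0.
move=> d [de db cd]; exists (fun i => - d i); split.
- by move=> i; rewrite normrN.
- by under eq_bigr do rewrite mulrN; rewrite sumrN db oppr0.
- by apply/in_coamoebaN; move: cd; congr in_coamoeba; apply/funext => i; rewrite opprD opprK.
Qed.

End Edges.

(** * Arguments off the closed coamoeba *)

Section OffCoamoeba.
Variables (R : realType) (I : finType).
Implicit Types (b t u v w d : I -> R) (c x e : R) (i j k p n : I).

(* Up to a common shift, moving the point of the torus moves the arguments u in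
   all the directions d orthogonal to b, and only in those. *)
Definition off_coamoeba b c u := exists2 e : R, 0 < e & forall d,
  (forall i, `|d i| < e) -> \sum_i b i * d i = 0 -> ~ in_coamoeba b c (u \+ d).

Lemma off_coamoebaW b c u : off_coamoeba b c u -> ~ in_coamoeba b c u.
Proof.
move=> [e e0 h] cu; apply: (h (fun=> 0)) => [i||]; first by rewrite normr0.
  by rewrite big1// => i _; rewrite mulr0.
by move: cu; congr in_coamoeba; apply/funext => i; rewrite /= addr0.
Qed.

Lemma off_coamoeba_near b c u : off_coamoeba b c u -> exists2 e : R, 0 < e &
  forall d, (forall i, `|d i| < e) -> \sum_i b i * d i = 0 -> off_coamoeba b c (u \+ d).
Proof.
move=> [e e0 h]; exists (e / 2); first by rewrite divr_gt0.
move=> d de db; exists (e / 2); first by rewrite divr_gt0.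
move=> d' d'e d'b cd; apply: (h (d \+ d')).
- move=> i; rewrite /= (le_lt_trans (ler_normD _ _))//.
  by move: (de i) (d'e i); clear; lra.
- by under eq_bigr do rewrite /= mulrDr; rewrite big_split/= db d'b addr0.
- by move: cd; congr in_coamoeba; apply/funext => i; rewrite /= addrA.
Qed.

Lemma in_coamoeba_congr b c u v (m : I -> int) x :
  (forall i, v i = u i + x + (m i)%:~R * (2 * pi)) ->
  in_coamoeba b c u -> in_coamoeba b c v.
Proof.
move=> vE [t [t0 tb tc]]; exists t; split=> //.
have [tcs tsn] := balancedB (- x) tb.
split; [rewrite -[RHS]tcs|rewrite -[RHS]tsn]; apply: eq_bigr => i _;
  by rewrite vE opprK ?cos_shift ?sin_shift.
Qed.

Lemma off_coamoeba_congr b c u v (m : I -> int) x :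
  (forall i, v i = u i + x + (m i)%:~R * (2 * pi)) ->
  off_coamoeba b c u -> off_coamoeba b c v.
Proof.
move=> vE [e e0 h]; exists e => // d de db cv; apply: (h d de db).
apply: (in_coamoeba_congr (m := fun i => - m i) (x := - x) _ cv) => i.
by rewrite /= vE mulrNz; ring.
Qed.

Lemma off_coamoeba_opp b c u :
  off_coamoeba (fun i => - b i) (- c) u <-> off_coamoeba b c u.
Proof.
split=> -[e e0 h]; exists e => // d de db.
  move/in_coamoeba_opp; apply: h => //.
  by under eq_bigr do rewrite mulNr; rewrite sumrN db oppr0.
move/in_coamoeba_opp; apply: h => //.
by apply: oppr_inj; rewrite oppr0 -[RHS]db -sumrN; under [RHS]eq_bigr do rewrite mulNr.
Qed.

Lemma fin_lt_margin (J : finType) (f : J -> R) x : (forall j : J, f j < x) ->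
  exists2 e : R, 0 < e & forall j : J, f j < x - e.
Proof.
move=> fx; have [j0|nJ] := pickP (@predT J); last first.
  by exists 1 => // j; have := nJ j.
have [k _ kmax] := Order.TotalTheory.arg_maxP f (erefl (xpredT j0)).
exists ((x - f k) / 2); first by rewrite divr_gt0 ?subr_gt0.
move=> j; have := kmax j isT; have := fx k; rewrite /Order.ge/=; clear; lra.
Qed.

(** Zeros of the sine are isolated: continuity suffices if [sin a] is not 0, and otherwise the next
    zero is at distance [pi / |k|]. *)
Lemma sin_affine_neq0 (a k : R) : k != 0 ->
  exists2 r : R, 0 < r & forall s, 0 < s < r -> sin (a + k * s) != 0.
Proof.
move=> k0; have [sa0|sa0] := eqVneq (sin a) 0; last first.
  have [|r r0 h] := @near0_ball R (fun s => 0 < Num.sg (sin a) * sin (a + k * s)).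
    apply: (@near0_gt0 R (fun s => Num.sg (sin a) * sin (a + k * s))).
      by apply: cvgMr; exact: continuous_sin_affine.
    by rewrite mulr0 addr0 -normrEsg normr_gt0.
  exists r => // s /andP[s0 sr].
  have := h s; rewrite gtr0_norm// => /(_ sr).
  by apply: contraTneq => ->; rewrite mulr0 ltxx.
have ca : cos a != 0.
  by have := sin0cos1 sa0; apply: contra_eq_neq => ->; rewrite normr0 eq_sym oner_eq0.
exists (pi / `|k|); first by rewrite divr_gt0 ?pi_gt0// normr_gt0.
move=> s /andP[s0]; rewrite ltr_pdivlMr ?normr_gt0// => sk.
rewrite sinD sa0 mul0r add0r mulf_neq0//.
have h : 0 < sin (s * `|k|) by rewrite sin_gt0_pi// sk mulr_gt0 ?normr_gt0.
have [kp|kn] := leP 0 k; first by move: h; rewrite ger0_norm// mulrC => /lt0r_neq0.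
by move: h; rewrite ltr0_norm// mulrN sinN mulrC oppr_gt0 => /ltr0_neq0.
Qed.

(** An elementary displacement orthogonal to [b]. It changes only two arguments, so the others serve
    as references. *)
Definition two_step b (p n : I) (s : R) : I -> R :=
  fun i => if i == p then (b p)^-1 * s else if i == n then - (b n)^-1 * s else 0.

Lemma two_step_sum b p n s : b p != 0 -> b n != 0 -> p != n ->
  \sum_i b i * two_step b p n s i = 0.
Proof.
move=> bp bn pn; rewrite /two_step (bigD1 p)//= (bigD1 n) 1?eq_sym//= !eqxx.
rewrite [n == p]eq_sym (negbTE pn) big1 => [|i /andP[/negbTE-> /negbTE->]]; last by rewrite mulr0.
by rewrite addr0 mulNr mulrN !mulrA !mulfV// !mul1r subrr.
Qed.

Lemma two_step_small b p n e : 0 < e -> exists2 r : R, 0 < r & forall s, 0 < s < r ->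
  forall i, `|two_step b p n s i| < e.
Proof.
move=> e0; pose K := 1 + `|(b p)^-1| + `|(b n)^-1|.
have K0 : 0 < K by rewrite /K -addrA ltr_pwDl// addr_ge0.
exists (e / K); first by rewrite divr_gt0.
move=> s /andP[s0]; rewrite ltr_pdivlMr// => sK i.
apply: le_lt_trans sK.
have key x : `|x| <= K -> `|x * s| <= s * K.
  by move=> xK; rewrite normrM (gtr0_norm s0) mulrC ler_pM2l.
have h1 := normr_ge0 (b p)^-1; have h2 := normr_ge0 (b n)^-1.
rewrite /two_step; case: ifP => _; [|case: ifP => _].
- by apply: key; rewrite /K; move: h1 h2; clear; lra.
- by apply: key; rewrite normrN /K; move: h1 h2; clear; lra.
- by rewrite normr0 mulr_ge0 ?ltW.
Qed.

Lemma pos_exists3 r1 r2 r3 : 0 < r1 -> 0 < r2 -> 0 < r3 ->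
  exists s : R, [/\ 0 < s < r1, 0 < s < r2 & 0 < s < r3].
Proof.
move=> r10 r20 r30; exists (Num.min r1 (Num.min r2 r3) / 2).
have m0 : 0 < Num.min r1 (Num.min r2 r3) by rewrite !lt_min r10 r20.
have : Num.min r1 (Num.min r2 r3) <= r1 by rewrite ge_min lexx.
have : Num.min r1 (Num.min r2 r3) <= r2 by rewrite !ge_min lexx orbT.
have : Num.min r1 (Num.min r2 r3) <= r3 by rewrite !ge_min lexx !orbT.
by move: m0; clear => *; split; lra.
Qed.

Variables (b : I -> R) (p1 p2 n1 n2 : I).
Hypotheses (bp1 : 0 < b p1) (bp2 : 0 < b p2) (bn1 : b n1 < 0) (bn2 : b n2 < 0).
Hypotheses (p12 : p1 != p2) (n12 : n1 != n2).

Let pneq q m : 0 < b q -> b m < 0 -> q != m.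
Proof. by move=> bq bm; apply/eqP => E; move: bq; rewrite E ltNge ltW. Qed.

Let npeq q m : 0 < b q -> b m < 0 -> m != q.
Proof. by move=> *; rewrite eq_sym pneq. Qed.

(** A first nudge moves another positive and another negative index off the line of [p] and [n];
    then [in_coamoeba_edge] finds coamoeba points arbitrarily close, within the directions
    orthogonal to [b]. *)
Lemma off_coamoeba_not_antipodal c u p n : off_coamoeba b c u ->
  0 < b p -> b n < 0 -> cos (u p - u n) != -1.
Proof.
move=> off bp bn; apply/eqP => cpn.
have [p' pp' bp'] : exists2 p', p != p' & 0 < b p'.
  by have [->|pp1] := eqVneq p p1; [exists p2|exists p1].
have [n' nn' bn'] : exists2 n', n != n' & b n' < 0.
  by have [->|nn1] := eqVneq n n1; [exists n2|exists n1].
have [e e0 he] := off_coamoeba_near off.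
have [r1 r10 h1] := two_step_small b p' n' e0.
have k1 : (b p')^-1 != 0 by rewrite invr_eq0 gt_eqF.
have k2 : - (b n')^-1 != 0 by rewrite oppr_eq0 invr_eq0 lt_eqF.
have [r2 r20 h2] := sin_affine_neq0 (u p' - u n) k1.
have [r3 r30 h3] := sin_affine_neq0 (u n' - u n) k2.
have [s [s1 s2 s3]] := pos_exists3 r10 r20 r30.
have pn' : p' != n' by exact: pneq.
have db : \sum_i b i * two_step b p' n' s i = 0.
  by apply: two_step_sum; rewrite // ?(lt0r_neq0 bp') ?(ltr0_neq0 bn').
have [e' e'0 he'] := he _ (h1 s s1) db.
set d := two_step b p' n' s in db he'.
have dp' : d p' = (b p')^-1 * s by rewrite /d /two_step eqxx.
have dn' : d n' = - (b n')^-1 * s by rewrite /d /two_step (negbTE (npeq bp' bn')) eqxx.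
have dp : d p = 0 by rewrite /d /two_step (negbTE pp') (negbTE (pneq bp bn')).
have dn : d n = 0 by rewrite /d /two_step (negbTE (npeq bp' bn)) (negbTE nn').
have [|||d' [d'e d'b cd']] :=
    @in_coamoeba_edge R I b c (u \+ d) p n p' n' e' bp bp' bn bn' pp' nn' _ _ _ e'0.
- by rewrite /= dp dn !addr0.
- by rewrite /= dn dp' addr0 addrAC h2.
- by rewrite /= dn dn' addr0 addrAC h3.
exact: he' d'e d'b cd'.
Qed.

(** A winding lies in the coamoeba unless [p] and [p'], or [n] and [n'], are collinear. A small move
    of [p] and [n] removes such accidents and keeps the strict inequalities. *)
Lemma off_coamoeba_not_winding c u p n p' n' : off_coamoeba b c u ->
  0 < b p -> 0 < b p' -> b n < 0 -> b n' < 0 ->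
  `|u p - u n| < pi -> `|u n - u p'| < pi -> `|u p' - u n'| < pi ->
  ~ (pi < u p - u n' < 3 * pi).
Proof.
move=> off bp bp' bn bn' pn np' pn' w.
have pp' : p != p'.
  by apply/eqP => E; move: pn' w; rewrite -E ltr_norml; lra.
have nn' : n != n'.
  by apply/eqP => E; move: pn w; rewrite -E ltr_norml; lra.
have [e0 e00 he] := off_coamoeba_near off.
(* The five strict bounds to preserve, listed together to obtain a common margin [e1]. *)
pose f (j : 'I_5) := nth 0 [:: `|u p - u n|; `|u n - u p'|; `|u p' - u n'|;
   2 * pi - (u p - u n'); (u p - u n') - 2 * pi] j.
have fpi (j : 'I_5) : f j < pi.
  move: j; case; do 5?[case=> [|] //]; rewrite /f /= => *; move: w; lra.
have [e1 e10 he1] := fin_lt_margin fpi.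
pose e := Num.min e0 (e1 / 2).
have e_gt0 : 0 < e by rewrite lt_min e00 divr_gt0.
have [r1 r10 h1] := two_step_small b p n e_gt0.
have k1 : (b p)^-1 != 0 by rewrite invr_eq0 gt_eqF.
have k2 : - (b n)^-1 != 0 by rewrite oppr_eq0 invr_eq0 lt_eqF.
have [r2 r20 h2] := sin_affine_neq0 (u p - u p') k1.
have [r3 r30 h3] := sin_affine_neq0 (u n - u n') k2.
have [s [s1 s2 s3]] := pos_exists3 r10 r20 r30.
have de := h1 s s1.
have db : \sum_i b i * two_step b p n s i = 0.
  by apply: two_step_sum; rewrite // ?(lt0r_neq0 bp) ?(ltr0_neq0 bn) ?pneq.
have de0 i : `|two_step b p n s i| < e0.
  by rewrite (lt_le_trans (de i))// /e ge_min lexx.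
have off' := off_coamoebaW (he _ de0 db).
have de1 i : `|two_step b p n s i| < e1 / 2.
  by rewrite (lt_le_trans (de i))// /e ge_min lexx orbT.
set d := two_step b p n s in de1 off'.
have dp : d p = (b p)^-1 * s by rewrite /d /two_step eqxx.
have dn : d n = - (b n)^-1 * s by rewrite /d /two_step (negbTE (npeq bp bn)) eqxx.
have dp' : d p' = 0 by rewrite /d /two_step [_ == p]eq_sym (negbTE pp') (negbTE (pneq bp' bn)).
have dn' : d n' = 0 by rewrite /d /two_step (negbTE (npeq bp bn')) [_ == n]eq_sym (negbTE nn').
apply: off'; apply: (@in_coamoeba_winding _ _ b c (u \+ d) p n p' n') => //=.
- have := he1 (inord 0); have := de1 p; have := de1 n; rewrite /f inordK//=.
  by rewrite !ltr_norml; lra.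
- have := he1 (inord 1); have := de1 n; have := de1 p'; rewrite /f inordK//=.
  by rewrite !ltr_norml; lra.
- have := he1 (inord 2); have := de1 n'; have := de1 p'; rewrite /f inordK//=.
  by rewrite !ltr_norml; lra.
- have := he1 (inord 3); have := he1 (inord 4); have := de1 p; have := de1 n'.
  by rewrite /f !inordK//= !ltr_norml; lra.
- by rewrite dp dp' addr0 addrAC h2.
- by rewrite dn dn' addr0 addrAC h3.
Qed.

Lemma angle_window (x y : R) : exists k : int, - pi <= x + k%:~R * (2 * pi) - y < pi.
Proof.
have pi2 : 0 < 2 * pi :> R by rewrite mulr_gt0 ?pi_gt0.
exists (- Num.floor ((x - y + pi) / (2 * pi))).
have /andP[] := mem_rg1_floor ((x - y + pi) / (2 * pi)).
rewrite ler_pdivlMr// ltr_pdivrMr// mulrNz => h1 h2.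
by move: h1 h2; lra.
Qed.

(** The negative arguments are lifted around [u p1], then the positive ones around the lift of
    [u n1]. Along the chain [p], [n1], [p1], [n] any other difference is below [3 pi] in absolute
    value; a value strictly between [pi] and [3 pi] is a winding, and [pi] itself is an antipodal
    pair. *)
Lemma off_coamoeba_lift c u : off_coamoeba b c u ->
  exists v : I -> int, forall p n, 0 < b p -> b n < 0 ->
    `|u p + (v p)%:~R * (2 * pi) - (u n + (v n)%:~R * (2 * pi))| < pi.
Proof.
move=> off.
have strict (w : I -> int) p n : 0 < b p -> b n < 0 ->
    u p + (w p)%:~R * (2 * pi) - (u n + (w n)%:~R * (2 * pi)) != pi /\
    u p + (w p)%:~R * (2 * pi) - (u n + (w n)%:~R * (2 * pi)) != - pi.
  move=> bp bn.
  have ow : off_coamoeba b c (fun i => u i + (w i)%:~R * (2 * pi)).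
    by apply: (off_coamoeba_congr (m := w) (x := 0) _ off) => i; rewrite addr0.
  have := off_coamoeba_not_antipodal ow bp bn => h.
  by split; apply: contra_neq h => ->; rewrite ?cosN cospi.
have [m0 mE] := @choice _ _ (fun i (k : int) => - pi <= u i + k%:~R * (2 * pi) - u p1 < pi)
  (fun i => angle_window (u i) (u p1)).
pose y := u n1 + (m0 n1)%:~R * (2 * pi).
have [m1 m1E] := @choice _ _ (fun i (k : int) => - pi <= u i + k%:~R * (2 * pi) - y < pi)
  (fun i => angle_window (u i) y).
pose v i := if i == p1 then 0 else if 0 < b i then m1 i else m0 i.
pose w i := u i + (v i)%:~R * (2 * pi).
have vp1 : v p1 = 0 by rewrite /v eqxx.
have wp1 : w p1 = u p1 by rewrite /w vp1 mul0r addr0.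
have vn n : b n < 0 -> v n = m0 n.
  by move=> bn; rewrite /v (negbTE (npeq bp1 bn)) ltNge ltW.
have wn1 : w n1 = y by rewrite /w vn.
have near1 n : b n < 0 -> `|w p1 - w n| < pi.
  move=> bn; have [h1 h2] := strict v p1 n bp1 bn.
  rewrite -/(w p1) -/(w n) in h1 h2.
  have := mE n; rewrite -(vn n bn) -/(w n) -wp1; move: h1 h2.
  rewrite ltr_norml !neq_lt => /orP[] ? /orP[] ? /andP[]*; lra.
have near2 p : 0 < b p -> `|w p - w n1| < pi.
  move=> bp; have [->|pp1] := eqVneq p p1; first exact: near1.
  have [h1 h2] := strict v p n1 bp bn1; rewrite -/(w p) -/(w n1) in h1 h2.
  have := m1E p; have <- : v p = m1 p by rewrite /v (negbTE pp1) bp.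
  rewrite -/(w p) -wn1; move: h1 h2.
  rewrite ltr_norml !neq_lt => /orP[] ? /orP[] ? /andP[]*; lra.
exists v => p n bp bn; rewrite -/(w p) -/(w n).
have [h1 h2] := strict v p n bp bn; rewrite -/(w p) -/(w n) in h1 h2.
have offw : off_coamoeba b c w.
  by apply: (off_coamoeba_congr (m := v) (x := 0) _ off) => i; rewrite /w addr0.
(* Differences below [- pi] are windings of the conjugate configuration. *)
have offNw : off_coamoeba b c (fun i => - w i).
  have [e e0 he] := offw; exists e => // d de db /in_coamoebaN cd.
  apply: (he (fun i => - d i)).
  - by move=> i; rewrite normrN.
  - by under eq_bigr do rewrite mulrN; rewrite sumrN db oppr0.
  - by move: cd; congr in_coamoeba; apply/funext => i; rewrite /= opprD opprK.
have Nw i j : - w i - - w j = - (w i - w j) by rewrite opprK opprB addrC.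
have np1 : `|w n1 - w p1| < pi by rewrite distrC near1.
have k1 := off_coamoeba_not_winding offw bp bp1 bn1 bn (near2 p bp) np1 (near1 n bn).
have k2 : ~ (pi < - (w p - w n) < 3 * pi).
  rewrite -Nw; apply: (off_coamoeba_not_winding (n := n1) (p' := p1) offNw bp bp1 bn1 bn);
    by rewrite Nw normrN ?near1 ?near2// distrC near1.
have := near2 p bp; have := near1 n1 bn1; have := near1 n bn; move: h1 h2 k1 k2.
rewrite !ltr_norml !neq_lt => /orP[] h1 /orP[] h2 k1 k2 /andP[? ?] /andP[? ?] /andP[? ?].
- by exfalso; apply: k2; lra.
- by lra.
- by lra.
- by exfalso; apply: k1; lra.
Qed.

Hypothesis b0 : forall i, b i != 0.
Hypothesis bsum : \sum_i b i = 0.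

Let V := \sum_(i | 0 < b i) b i.

Lemma mass_gt0 : 0 < V.
Proof.
rewrite /V (bigD1 p1)//= ltr_pwDl//; apply: sumr_ge0 => i /andP[bi _]; exact: ltW.
Qed.

Lemma sum_pos_neg (F : I -> R) :
  \sum_i F i = \sum_(i | 0 < b i) F i + \sum_(i | b i < 0) F i.
Proof.
rewrite (bigID (fun i => 0 < b i))/=; congr (_ + _).
apply: eq_bigl => i; have := b0 i; rewrite neq_lt => /orP[bi|bi].
  by rewrite bi ltNge ltW.
by rewrite bi [RHS]ltNge ltW.
Qed.

Lemma neg_mass : \sum_(i | b i < 0) - b i = V.
Proof.
apply: oppr_inj; rewrite sumrN opprK; apply/eqP.
by rewrite -addr_eq0 addrC -sum_pos_neg bsum.
Qed.

(** The product coupling of the positive and negative masses, of total mass [V ^ 2], turns the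
    weighted sum into an average of differences between opposite signs, the only ones that are
    controlled. *)
Lemma coupling u : V * \sum_i b i * u i =
  \sum_(p | 0 < b p) \sum_(n | b n < 0) b p * (- b n) * (u p - u n).
Proof.
rewrite sum_pos_neg mulrDr -{1}neg_mass /V !mulr_suml.
have -> : \sum_(p | 0 < b p) \sum_(n | b n < 0) b p * (- b n) * (u p - u n) =
  \sum_(p | 0 < b p) \sum_(n | b n < 0) (- b n) * (b p * u p) +
  \sum_(p | 0 < b p) \sum_(n | b n < 0) b p * (b n * u n).
  rewrite -big_split/=; apply: eq_bigr => p _; rewrite -big_split/=.
  by apply: eq_bigr => n _; ring.
congr (_ + _).
- by rewrite exchange_big/=; apply: eq_bigr => n _; rewrite mulr_sumr.
- by apply: eq_bigr => p _; rewrite mulr_sumr.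
Qed.

Lemma linked_sum_lt u : (forall p n, 0 < b p -> b n < 0 -> `|u p - u n| < pi) ->
  `|\sum_i b i * u i| < pi * V.
Proof.
move=> upn; have V0 := mass_gt0.
suff : `|V * \sum_i b i * u i| < V * (pi * V).
  by rewrite normrM gtr0_norm// ltr_pM2l.
rewrite coupling.
have -> : V * (pi * V) = \sum_(p | 0 < b p) \sum_(n | b n < 0) b p * (- b n) * pi.
  transitivity (\sum_(p | 0 < b p) b p * (pi * V)); first by rewrite -mulr_suml.
  apply: eq_bigr => p bp; rewrite -neg_mass !mulr_sumr.
  by apply: eq_bigr => n _; ring.
apply: (le_lt_trans (ler_norm_sum _ _ _)).
rewrite (bigD1 p1)//= [X in _ < X](bigD1 p1)//=; apply: ltr_leD; last first.
  apply: ler_sum => p /andP[bp _]; apply: (le_trans (ler_norm_sum _ _ _)).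
  apply: ler_sum => n bn; rewrite normrM gtr0_norm ?mulr_gt0 ?oppr_gt0//.
  by rewrite ler_pM2l ?mulr_gt0 ?oppr_gt0// ltW// upn.
apply: (le_lt_trans (ler_norm_sum _ _ _)).
rewrite (bigD1 n1)//= [X in _ < X](bigD1 n1)//=; apply: ltr_leD; last first.
  apply: ler_sum => n /andP[bn _]; rewrite normrM gtr0_norm ?mulr_gt0 ?oppr_gt0//.
  by rewrite ler_pM2l ?mulr_gt0 ?oppr_gt0// ltW// upn.
rewrite normrM gtr0_norm ?mulr_gt0 ?oppr_gt0//.
by rewrite ltr_pM2l ?mulr_gt0 ?oppr_gt0// upn.
Qed.

Lemma off_coamoeba_lopsided c u : (forall i j, `|u i - u j| < pi) -> off_coamoeba b c u.
Proof.
move=> uij.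
have [e e0 he] := fin_lt_margin (fun x : I * I => uij x.1 x.2).
exists (e / 2); first by rewrite divr_gt0.
move=> d de _.
have dij i j : `|(u \+ d) i - (u \+ d) j| < pi.
  have := he (i, j); have := de i; have := de j; rewrite !ltr_norml/=; lra.
apply: (@not_in_coamoeba_halfplane R I b c (u \+ d) p1 n1) => // i j.
by rewrite (le_trans (ler_norm _))// ltW.
Qed.

(** For [|x| < pi V] this is a configuration of weighted sum [x] with all differences below [pi],
    the endpoint of paths that preserve the sum. *)
Definition center (x : R) : I -> R := fun i => if 0 < b i then x / V else 0.

Lemma center_sum x : \sum_i b i * center x i = x.
Proof.
rewrite sum_pos_neg/= [X in _ + X]big1 => [|i bi]; last first.
  by rewrite /center ltNge ltW// mulr0.
rewrite addr0 (eq_bigr (fun i => b i * (x / V))) => [|i bi]; last by rewrite /center bi.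
by rewrite -mulr_suml -/V mulrC divfK// gt_eqF// mass_gt0.
Qed.

Lemma center_lopsided x i j : `|x| < pi * V -> `|center x i - center x j| < pi.
Proof.
move=> xV; have V0 := mass_gt0.
have xV' : `|x / V| < pi by rewrite normrM normfV (gtr0_norm V0) ltr_pdivrMr.
rewrite /center; case: ifP => _; case: ifP => _;
  by rewrite ?subrr ?subr0 ?sub0r ?normrN ?normr0 ?pi_gt0.
Qed.

(** On the segment to [center x], differences that are at most [pi] are averaged with differences
    smaller than [pi], hence become smaller than [pi] as soon as [s > 0]. *)
Lemma off_coamoeba_path_narrow c u : off_coamoeba b c u ->
  (forall p n, 0 < b p -> b n < 0 -> `|u p - u n| < pi) ->
  (forall i j, u i - u j <= pi) ->
  exists d, [/\ \sum_i b i * d i = 0,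
    forall s, 0 <= s <= 1 -> off_coamoeba b c (fun i => u i + s * d i) &
    forall i j, `|(u i + d i) - (u j + d j)| < pi].
Proof.
move=> off upn uij; pose x := \sum_i b i * u i.
have xV : `|x| < pi * V by exact: linked_sum_lt.
exists (fun i => center x i - u i); split.
- by under eq_bigr do rewrite mulrBr; rewrite sumrB center_sum subrr.
- move=> s /andP[s0 s1]; have [->|sn0] := eqVneq s 0.
    by move: off; congr off_coamoeba; apply/funext => i; rewrite mul0r addr0.
  have {sn0}s0 : 0 < s by rewrite lt_neqAle eq_sym sn0.
  apply: off_coamoeba_lopsided => i j.
  have -> : u i + s * (center x i - u i) - (u j + s * (center x j - u j)) =
    (1 - s) * (u i - u j) + s * (center x i - center x j) by ring.
  have h1 : `|(1 - s) * (u i - u j)| <= (1 - s) * pi.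
    rewrite normrM ger0_norm ?subr_ge0// ler_wpM2l ?subr_ge0//.
    by rewrite ler_norml uij andbT lerNl opprB uij.
  have h2 : `|s * (center x i - center x j)| < s * pi.
    by rewrite normrM gtr0_norm// ltr_pM2l// center_lopsided.
  by rewrite (le_lt_trans (ler_normD _ _))//; move: h1 h2; lra.
- by move=> i j; rewrite !subrKC center_lopsided.
Qed.

(** By [in_coamoeba_wide], [p] and [p'] are the only positive indices. They are turned towards each
    other; by [in_coamoeba_narrow], meeting the coamoeba on the way would put the starting point, or
    one close to it, in the coamoeba. *)
Lemma off_coamoeba_translate c u p p' : off_coamoeba b c u -> 0 < b p -> 0 < b p' ->
  (forall p n, 0 < b p -> b n < 0 -> `|u p - u n| < pi) -> pi < u p - u p' ->
  exists d, [/\ \sum_i b i * d i = 0,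
    forall s, 0 <= s <= 1 -> off_coamoeba b c (fun i => u i + s * d i) &
    forall i j, `|(u i + d i) - (u j + d j)| < pi].
Proof.
move=> off bp bp' upn wide.
have pp' : p != p'.
  by apply/eqP => E; move: wide; rewrite E subrr ltNge pi_ge0.
have P q : 0 < b q -> q = p \/ q = p'.
  move=> bq; have [->|qp] := eqVneq q p; first by left.
  have [->|qp'] := eqVneq q p'; first by right.
  exfalso; apply: (off_coamoebaW off).
  by apply: (@in_coamoeba_wide R I b c u p p' q n1 n2) => //; exact: upn.
have near m : b m < 0 -> `|u p - u m| < pi /\ `|u p' - u m| < pi.
  by move=> bm; split; exact: upn.
pose K := (b p)^-1 + (b p')^-1.
have ip : 0 < (b p)^-1 by rewrite invr_gt0.
have ip' : 0 < (b p')^-1 by rewrite invr_gt0.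
have K0 : 0 < K by rewrite addr_gt0.
have pi0 := @pi_gt0 R.
(* At time [s1] the pair is [pi / 2] apart: less than [pi], and with room for perturbations below
   [pi / 4] to leave the gap nonnegative. *)
pose s1 := ((u p - u p') - pi / 2) / K.
have s1K : K * s1 = (u p - u p') - pi / 2 by rewrite mulrC divfK// gt_eqF.
have s10 : 0 < s1 by rewrite divr_gt0//; move: wide pi0; lra.
pose d i := if i == p then - ((b p)^-1 * s1) else if i == p' then (b p')^-1 * s1 else 0.
have dp : d p = - ((b p)^-1 * s1) by rewrite /d eqxx.
have dp' : d p' = (b p')^-1 * s1 by rewrite /d eq_sym (negbTE pp') eqxx.
have dm m : b m < 0 -> d m = 0.
  by move=> bm; rewrite /d (negbTE (npeq bp bm)) (negbTE (npeq bp' bm)).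
exists d; split.
- rewrite (bigD1 p)//= (bigD1 p') 1?eq_sym//= dp dp' big1 => [|i /andP[ip1 ip2]].
    by rewrite addr0 mulrN !mulrA !mulfV ?gt_eqF// addNr.
  by rewrite /d (negbTE ip1) (negbTE ip2) mulr0.
- move=> s /andP[s0 sle1].
  have [e e0 he] := off.
  have upn' (x : I * I) :
      (if (0 < b x.1) && (b x.2 < 0) then `|u x.1 - u x.2| else 0) < pi.
    by case: ifP => // /andP[? ?]; exact: upn.
  have [e1 e10 he1] := fin_lt_margin upn'.
  (* In this order: the start stays off the coamoeba, opposite signs stay closer than [pi], the pair
     is still wider than [pi] at the start, and its gap stays nonnegative at the end. *)
  pose r := Num.min e (Num.min (e1 / 2) (Num.min ((u p - u p' - pi) / 2) (pi / 4))).
  have r0 : 0 < r.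
    by rewrite !lt_min e0 !divr_gt0// subr_gt0.
  exists r => // d' d'r d'b cd.
  have d're i : `|d' i| < e by rewrite (lt_le_trans (d'r i))// /r ge_min lexx.
  have d're1 i : `|d' i| < e1 / 2.
    by rewrite (lt_le_trans (d'r i))// /r !ge_min lexx !orbT.
  have d'rw i : `|d' i| < (u p - u p' - pi) / 2.
    by rewrite (lt_le_trans (d'r i))// /r !ge_min lexx !orbT.
  have d'rpi i : `|d' i| < pi / 4.
    by rewrite (lt_le_trans (d'r i))// /r !ge_min lexx !orbT.
  apply: (he d' d're d'b).
  apply: (@in_coamoeba_narrow R I b c (u \+ d') ((fun i => u i + s * d i) \+ d')
    p p' n1 n2 (s * s1)) => //.
  + move=> m bm /=.
    have := he1 (p, m); rewrite /= bp bm/=; have := he1 (p', m); rewrite /= bp' bm/=.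
    have := d're1 m; have := d're1 p; have := d're1 p'.
    by rewrite !ltr_norml => *; split; lra.
  + by rewrite mulr_ge0// ltW.
  + by rewrite /= dp; ring.
  + by rewrite /= dp'; ring.
  + by move=> m bm; rewrite /= (dm m bm) mulr0 addr0.
  + by have := d'rw p; have := d'rw p'; rewrite /= !ltr_norml; lra.
  + have sK : s * (K * s1) <= K * s1 by rewrite ler_piMl// mulr_ge0 ?(ltW K0) ?(ltW s10).
    have -> : ((fun i => u i + s * d i) \+ d') p - ((fun i => u i + s * d i) \+ d') p' =
      (u p - u p') - s * (K * s1) + (d' p - d' p').
      by rewrite /= dp dp' /K; ring.
    have := d'rpi p; have := d'rpi p'; rewrite !ltr_norml; move: sK; rewrite s1K; lra.
- have e1 : u p + d p - (u p' + d p') = pi / 2.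
    have -> : u p + d p - (u p' + d p') = u p - u p' - K * s1 by rewrite dp dp' /K; ring.
    by rewrite s1K; ring.
  have q1 : 0 < (b p)^-1 * s1 by rewrite mulr_gt0.
  have q2 : 0 < (b p')^-1 * s1 by rewrite mulr_gt0.
  have hm m : b m < 0 -> [/\ u p - pi < u m + d m, u m + d m < u p' + pi,
       u p' < u m + d m & u m + d m < u p].
    move=> bm; have [] := near m bm; rewrite (dm m bm) addr0 !ltr_norml => *.
    by split; lra.
  have e2 : u p + d p < u p by rewrite dp; lra.
  have e3 : u p' < u p' + d p' by rewrite dp'; lra.
  have sgn i : 0 < b i \/ b i < 0 by have := b0 i; rewrite neq_lt => /orP[]; [right|left].
  have aux i j : (u i + d i) - (u j + d j) < pi.
    have [/P[]->|bi] := sgn i; have [/P[]->|bj] := sgn j.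
    + by rewrite subrr.
    + by rewrite e1; lra.
    + by have := hm j bj => -[]; lra.
    + by have := e1; lra.
    + by rewrite subrr.
    + by have := hm j bj => -[]; lra.
    + by have := hm i bi => -[]; lra.
    + by have := hm i bi => -[]; lra.
    + by have := hm i bi => -[? ? ? ?]; have := hm j bj => -[]; lra.
  by move=> i j; rewrite ltr_norml aux andbT ltrNl opprB aux.
Qed.

End OffCoamoeba.

(** Arguments more than [pi] apart belong to indices of the same sign; a negative pair becomes a
    positive one when [b] and [c] are negated. *)
Lemma off_coamoeba_path (R : realType) (I : finType) (b : I -> R) (p1 p2 n1 n2 : I)
    (c : R) (u : I -> R) :
  0 < b p1 -> 0 < b p2 -> b n1 < 0 -> b n2 < 0 -> p1 != p2 -> n1 != n2 ->
  (forall i, b i != 0) -> \sum_i b i = 0 -> off_coamoeba b c u ->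
  (forall p n, 0 < b p -> b n < 0 -> `|u p - u n| < pi) ->
  exists d, [/\ \sum_i b i * d i = 0,
    forall s, 0 <= s <= 1 -> off_coamoeba b c (fun i => u i + s * d i) &
    forall i j, `|(u i + d i) - (u j + d j)| < pi].
Proof.
move=> bp1 bp2 bn1 bn2 p12 n12 b0 bsum off upn.
have [uij|/existsNP[i /existsNP[j /negP]]] := pselect (forall i j, u i - u j <= pi).
  exact: (off_coamoeba_path_narrow (p1 := p1) (n1 := n1)).
rewrite -ltNge => wide.
have sgn k : 0 < b k \/ b k < 0 by have := b0 k; rewrite neq_lt => /orP[]; [right|left].
have notboth p n : 0 < b p -> b n < 0 -> ~ (pi < u p - u n) /\ ~ (pi < u n - u p).
  by move=> bp bn; have := upn p n bp bn; rewrite ltr_norml; split; lra.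
have [bi|bi] := sgn i; have [bj|bj] := sgn j.
- exact: (off_coamoeba_translate bn1 bn2 n12 b0 off bi bj upn wide).
- by case: (notboth i j bi bj).
- by case: (notboth j i bj bi).
- have Nb0 k : - b k != 0 by rewrite oppr_eq0.
  have [|||||||d [db doff dl]] := @off_coamoeba_translate R I (fun k => - b k) p1 p2
    _ _ p12 Nb0 (- c) u i j; rewrite ?oppr_gt0 ?oppr_lt0//.
  + exact/off_coamoeba_opp.
  + by move=> p n; rewrite oppr_gt0 oppr_lt0 distrC => *; exact: upn.
  exists d; split=> //.
    by apply: oppr_inj; rewrite oppr0 -[RHS]db -sumrN; under [RHS]eq_bigr do rewrite mulNr.
  by move=> s s01; apply/off_coamoeba_opp; exact: doff.
Qed.

(** * Volume of row vectors *)

Section RowMeasure.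
Variable R : realType.
Local Notation mu := (@lebesgue_measure R).

Lemma row_cons0 n (t : R) (x : 'rV[R]_n) : (row_mx t%:M x : 'rV[R]_(1 + n)) 0 0 = t.
Proof.
by rewrite mxE; case: splitP => [j _|//]; rewrite ord1 mxE mulr1n.
Qed.

Lemma row_cons_lift n (t : R) (x : 'rV[R]_n) i :
  (row_mx t%:M x : 'rV[R]_(1 + n)) 0 (lift ord0 i) = x 0 i.
Proof.
rewrite (_ : lift ord0 i = rshift 1 i); last exact/val_inj.
by rewrite row_mxEr.
Qed.

Lemma rsubmx_coord n (x : 'rV[R]_(1 + n)) i : rsubmx x 0 i = x 0 (lift ord0 i).
Proof. by rewrite mxE; congr (x _ _); exact/val_inj. Qed.

Lemma row_consK' n (x : 'rV[R]_(1 + n)) : row_mx (x 0 0)%:M (rsubmx x) = x.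
Proof.
apply/rowP => i; have [j ->|->] := unliftP 0 i.
  by rewrite row_cons_lift rsubmx_coord.
by rewrite row_cons0.
Qed.

Definition row_cylinders n : set (set 'rV[R]_n) :=
  fun A => exists (i : 'I_n) (B : set R), measurable B /\ A = (fun x : 'rV[R]_n => B (x 0 i)).

(** A copy of the row vectors with the product sigma-algebra; [volume] makes sense for every set,
    but is compared with a measure on these measurable sets. *)
Definition mrow n : Type := g_sigma_algebraType (@row_cylinders n).

HB.instance Definition _ n := Measurable.on (mrow n).

Lemma measurable_coord n (i : 'I_n) :
  measurable_fun [set: mrow n] (fun x : mrow n => (x : 'rV[R]_n) 0 i : R).
Proof.
by move=> _ B mB; rewrite setTI; apply: sub_sigma_algebra; exists i, B.
Qed.

Lemma measurable_rowP d (T : measurableType d) n (f : T -> mrow n) :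
  (forall i, measurable_fun [set: T] (fun x => (f x : 'rV[R]_n) 0 i : R)) ->
  measurable_fun [set: T] f.
Proof.
move=> mf.
refine (@measurability _ _ _ _ setT f (@row_cylinders n) erefl _).
move=> _ [_ [i [B [mB ->]]] <-].
exact: (mf i measurableT B mB).
Qed.

Definition row_cons n (p : R * mrow n) : mrow n.+1 :=
  row_mx (p.1%:M : 'M[R]_1) (p.2 : 'rV[R]_n) : 'rV[R]_(1 + n).

Definition row_uncons n (x : mrow n.+1) : R * mrow n :=
  ((x : 'rV[R]_(1 + n)) 0 0, rsubmx (x : 'rV[R]_(1 + n))).

Lemma row_consK n : cancel (@row_cons n) (@row_uncons n).
Proof. by move=> [t x]; rewrite /row_uncons /row_cons/= row_mxKr row_cons0. Qed.

Lemma measurable_row_cons n : measurable_fun [set: R * mrow n] (@row_cons n).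
Proof.
apply: measurable_rowP => i; rewrite /row_cons; have [j ->|->] := unliftP 0 i.
  under eq_fun do rewrite row_cons_lift.
  apply: (@measurableT_comp _ _ _ _ _ _ (fun x : mrow n => (x : 'rV[R]_n) 0 j : R)).
    exact: measurable_coord.
  exact: measurable_snd.
under eq_fun do rewrite row_cons0.
exact: measurable_fst.
Qed.

Lemma measurable_row_uncons n : measurable_fun [set: mrow n.+1] (@row_uncons n).
Proof.
apply/measurable_fun_pairP; split; first exact: measurable_coord.
apply: measurable_rowP => i; rewrite /row_uncons/=.
under eq_fun do rewrite rsubmx_coord.
exact: measurable_coord.
Qed.

Lemma volumeS n (S : set 'rV[R]_n.+1) :
  volume S = (\int[mu]_t volume [set x : 'rV[R]_n | S (row_mx t%:M x)])%E.
Proof. by []. Qed.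

Lemma measurable_preimageT d1 d2 (T1 : measurableType d1) (T2 : measurableType d2)
  (f : T1 -> T2) (A : set T2) :
  measurable_fun setT f -> measurable A -> measurable (f @^-1` A).
Proof. by move=> mf mA; rewrite -[X in measurable X]setTI; exact: mf. Qed.

Lemma measurable_row_slice n (S : set (mrow n.+1)) t : measurable S ->
  measurable ([set x | S (row_mx t%:M (x : 'rV[R]_n) : 'rV[R]_(1 + n))] : set (mrow n)).
Proof.
move=> mS; apply: (@measurable_preimageT _ _ (mrow n) (mrow n.+1)
  (fun x => row_cons (t, x))) => //.
apply: (@measurableT_comp _ _ _ _ _ _ (@row_cons n)); first exact: measurable_row_cons.
exact: pair1_measurable.
Qed.

(** The recursion of [volume] integrates over slices, as does the product of Lebesgue measure with
    the measure in dimension [n], transported by [row_cons]. Sigma-finiteness is carried along so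
    that the next product can be formed. *)
Lemma volume_measure n : exists nu : {sigma_finite_measure set (mrow n) -> \bar R},
  forall S : set (mrow n), measurable S -> volume (S : set 'rV[R]_n) = nu S.
Proof.
elim: n => [|n [nu IH]].
  exists (\d_(0 : mrow 0)) => S mS.
  by rewrite /= diracE.
pose pf := pushforward (mu \x nu)%E (@row_cons n).
pose pfm : {measure set (mrow n.+1) -> \bar R} :=
  measure_function_pushforward__canonical__measure_function_Measure (mu \x nu)%E (@measurable_row_cons n).
have pf_sfin : sigma_finite [set: mrow n.+1] pfm.
  have /sigma_finiteP[F' [TF' ndF' Foo']] := sigma_finiteT mu.
  have /sigma_finiteP[G [TG ndG Goo]] := sigma_finiteT nu.
  have mFG k : measurable (F' k `*` G k).
    by apply: measurableX; [case: (Foo' k)|case: (Goo k)].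
  exists (fun k => @row_uncons n @^-1` (F' k `*` G k)).
    rewrite -preimage_bigcup; apply/seteqP; split => // x _; rewrite /row_uncons/=.
    have [k _ Fk] : (\bigcup_k F' k) ((x : 'rV[R]_(1 + n)) 0 0) by rewrite -TF'.
    have [l _ Gl] : (\bigcup_k G k) (rsubmx (x : 'rV[R]_(1 + n))) by rewrite -TG.
    exists (maxn k l) => //; split => /=.
      by move: Fk; exact/subsetPset/ndF'/leq_maxl.
    by move: Gl; exact/subsetPset/ndG/leq_maxr.
  move=> k; split.
    rewrite -[X in measurable X]setTI; exact: (measurable_row_uncons measurableT (mFG k)).
  have [mF' F'oo] := Foo' k; have [mG Goo'] := Goo k.
  rewrite /pfm/= /pushforward -comp_preimage.
  rewrite (_ : _ \o _ = id) ?preimage_id; last by apply/funext => x; exact: row_consK.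
  by rewrite product_measure1E// lte_mul_pinfty// ge0_fin_numE.
pose pfs := @Measure_isSigmaFinite.Build _ _ _ pfm pf_sfin.
pose pfsm : {sigma_finite_measure set (mrow n.+1) -> \bar R} := HB.pack (pfm : set _ -> \bar R) pfm pfs.
exists pfsm => S mS.
rewrite volumeS /pfsm/= /pushforward /product_measure1/=.
apply: eq_integral => t _; rewrite /= IH; last exact: measurable_row_slice.
by congr (nu _); apply/seteqP; split => x; rewrite /xsection/= ?inE.
Qed.

Lemma volume_ge0 n (S : set 'rV[R]_n) : (0 <= volume S)%E.
Proof.
elim: n S => [|n IH] S; first by rewrite /= lee_fin.
by rewrite volumeS; apply: integral_ge0 => t _; exact: IH.
Qed.

Lemma measurable_volume_slice n (S : set (mrow n.+1)) : measurable S ->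
  measurable_fun [set: R] (fun t => volume [set x : 'rV[R]_n | S (row_mx t%:M x)]).
Proof.
move=> mS; have [nu nuE] := volume_measure n.
have mS' : measurable (@row_cons n @^-1` S).
  by apply: measurable_preimageT => //; exact: measurable_row_cons.
rewrite (_ : (fun t => _) = nu \o xsection (@row_cons n @^-1` S)).
  exact: measurable_fun_xsection.
apply/funext => t /=; rewrite nuE; last exact: measurable_row_slice.
by congr (nu _); apply/seteqP; split => x; rewrite /xsection/= ?inE.
Qed.

(** [|c|] times the pushforward agrees with Lebesgue measure on the intervals []a, b]], which
    determine it. For [c < 0] their preimages are closed on the left instead. *)
Lemma lebesgue_measure_affine (c d : R) (A : set R) : c != 0 -> measurable A ->
  pushforward mu (fun t : R => t * c + d : measurableTypeR R) A = (`|c|^-1%:E * mu A)%E.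
Proof.
move=> c0 mA.
have mphi : measurable_fun [set: measurableTypeR R]
    (fun t : measurableTypeR R => t * c + d : measurableTypeR R).
  by apply: measurable_funD => //; apply: measurable_funM.
pose pf := measure_function_pushforward__canonical__measure_function_Measure mu mphi.
have c0' : 0 <= `|c| by [].
pose m' := mscale (NngNum c0') pf.
suff : mu A = m' A.
  move=> ->; rewrite /m' /mscale/= muleA -EFinM mulVf ?normr_eq0// mul1e.
  by [].
apply: lebesgue_measure_unique => // _ [[a b] _ <-].
rewrite [RHS](_ : _ = `|c|%:E * mu [set t : R | (t * c + d)%R \in `]a, b]])%E; last by [].
rewrite lebesgue_measure_itv/= lte_fin.
have [cpos|cneg] := ltP 0 c.
  rewrite (_ : [set t : R | _] = `]((a - d) / c), ((b - d) / c)]%classic); last first.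
    apply/seteqP; split => x /=; rewrite !in_itv/= ltr_pdivrMr// ler_pdivlMr//;
      by rewrite ltrBlDr lerBrDr.
  rewrite lebesgue_measure_itv/= lte_fin ltr_pM2r ?invr_gt0// ltrD2r.
  case: ifP => _; rewrite ?mule0// -!EFinB -EFinM (gtr0_norm cpos); congr EFin.
  by field; rewrite gt_eqF.
have {cneg}cneg : c < 0 by rewrite lt_neqAle c0.
rewrite (_ : [set t : R | _] = `[((b - d) / c), ((a - d) / c)[%classic); last first.
  apply/seteqP; split => x /=; rewrite !in_itv/= ler_ndivrMr// ltr_ndivlMr//;
    by rewrite ltrBlDr lerBrDr andbC.
rewrite lebesgue_measure_itv/= lte_fin ltr_nM2r ?invr_lt0// ltrD2r.
case: ifP => _; rewrite ?mule0// -!EFinB -EFinM (ltr0_norm cneg); congr EFin.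
by field; rewrite lt_eqF.
Qed.

Lemma integral_affine (c d : R) (g : R -> \bar R) : c != 0 ->
  measurable_fun [set: R] g -> (forall t, (0 <= g t)%E) ->
  (\int[mu]_t g (t * c + d)%R = `|c|^-1%:E * \int[mu]_t g t)%E.
Proof.
move=> c0 mg g0.
have mphi : measurable_fun [set: measurableTypeR R]
    (fun t : measurableTypeR R => t * c + d : measurableTypeR R).
  by apply: measurable_funD => //; apply: measurable_funM.
have ic0 : 0 <= `|c|^-1 by rewrite invr_ge0.
have := @ge0_integral_pushforward _ _ _ _ R _ mphi mu setT g measurableT mg (fun y _ => g0 y).
rewrite preimage_setT => <-.
rewrite -(@ge0_integral_mscale _ _ _ mu setT measurableT (NngNum ic0) g mg (fun y _ => g0 y)).
apply: eq_measure_integral => A mA _.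
exact: (lebesgue_measure_affine d c0 mA).
Qed.

(** * Affine maps scale the volume by the determinant *)

Lemma measurable_affine_map n m (M : 'M[R]_(n, m)) (w : 'rV[R]_m) :
  measurable_fun [set: mrow n] (fun x : mrow n => ((x : 'rV[R]_n) *m M + w : mrow m)).
Proof.
apply: measurable_rowP => i.
under eq_fun do rewrite !mxE.
apply: measurable_funD => //; apply: measurable_sum => j.
by apply: measurable_funM => //; exact: measurable_coord.
Qed.

(** Invertibility makes the property stable under inverses, and all translations [w] are included
    because the slices of a linear map are affine. *)
Definition scales_volume n (M : 'M[R]_n) := M \in unitmx /\
  forall (w : 'rV[R]_n) (S : set (mrow n)), measurable S ->
    (volume [set x : 'rV[R]_n | S (x *m M + w)%R] = `|\det M|^-1%:E * volume (S : set 'rV[R]_n))%E.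

Lemma measurable_affine_preimage n m (M : 'M[R]_(n, m)) (w : 'rV[R]_m) (S : set (mrow m)) :
  measurable S -> measurable ([set x | S ((x : 'rV[R]_n) *m M + w)] : set (mrow n)).
Proof. by move=> mS; apply: (measurable_preimageT (measurable_affine_map M w)). Qed.

Lemma scales_volumeM n (M N : 'M[R]_n) :
  scales_volume M -> scales_volume N -> scales_volume (M *m N).
Proof.
move=> [uM hM] [uN hN]; split; first by rewrite unitmx_mul uM.
move=> w S mS.
have -> : [set x : 'rV[R]_n | S (x *m (M *m N) + w)] =
    [set x : 'rV[R]_n | [set y : 'rV[R]_n | S (y *m N + w)] (x *m M + 0)].
  by apply/seteqP; split => x /=; rewrite addr0 mulmxA.
rewrite hM; last exact: measurable_affine_preimage.
by rewrite hN// det_mulmx normrM invfM muleA -EFinM.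
Qed.

(** The slice at [t] of the preimage is the preimage by [M], translated by a multiple of [r], of the
    slice at [t * c + w 0 0]; an affine change of variable in [t] does the rest. *)
Lemma scales_volume_ublock n (c : R) (r : 'rV[R]_n) (M : 'M[R]_n) :
  c != 0 -> scales_volume M ->
  scales_volume (block_mx c%:M r 0 M : 'M[R]_(1 + n)).
Proof.
move=> c0 [uM hM]; have detE : \det (block_mx c%:M r 0 M : 'M[R]_(1 + n)) = c * \det M.
  by rewrite det_ublock det_scalar1.
have dM : \det M != 0 by rewrite -unitfE -unitmxE.
split; first by rewrite unitmxE detE unitfE mulf_neq0.
move=> w S mS; rewrite volumeS.
pose g t := volume [set x : 'rV[R]_n | S (row_mx t%:M x)].
have mg : measurable_fun [set: R] g by exact: measurable_volume_slice.
transitivity (\int[mu]_t (`|\det M|^-1%:E * g (t * c + w 0 0)%R))%E.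
  apply: eq_integral => t _; rewrite /g -(hM (t *: r + rsubmx (w : 'rV_(1 + n)))); last first.
    exact: measurable_row_slice.
  congr volume; apply/seteqP.
  have E (x : 'rV[R]_n) : row_mx t%:M x *m block_mx c%:M r 0 M + (w : 'rV_(1 + n)) =
      row_mx (t * c + w 0 0)%:M (x *m M + (t *: r + rsubmx (w : 'rV_(1 + n)))).
    rewrite mul_row_block mulmx0 addr0 -scalar_mxM mul_scalar_mx.
    rewrite -[in LHS](row_consK' (w : 'rV_(1 + n))) add_row_mx; congr row_mx.
      by apply/matrixP => i j; rewrite !mxE !ord1 mulrnDl.
    by rewrite addrA [X in X + _]addrC.
  by split => x /=; rewrite E.
rewrite ge0_integralZl//; last 2 first.
- apply: (@measurableT_comp _ _ _ _ _ _ g) => //.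
  by apply: measurable_funD => //; apply: measurable_funM.
- by move=> t _; exact: volume_ge0.
rewrite integral_affine//; last by move=> t; exact: volume_ge0.
by rewrite muleA -EFinM -invfM mulrC -normrM detE.
Qed.

Lemma scales_volume0 (M : 'M[R]_0) : scales_volume M.
Proof.
split; first by rewrite unitmxE det_mx00 unitr1.
move=> w S mS; rewrite det_mx00 normr1 invr1 mul1e.
by congr volume; apply/seteqP; split => x /=; rewrite [_ + _]thinmx0 [x]thinmx0.
Qed.

Definition swap2 n (x : 'rV[R]_(1 + (1 + n))) : 'rV[R]_(1 + (1 + n)) :=
  row_mx (lsubmx (rsubmx x)) (row_mx (lsubmx x) (rsubmx (rsubmx x))).

(** Swapping the first two coordinates exchanges the two outer integrals, by Tonelli. *)
Lemma volume_swap2 n (S : set (mrow (1 + (1 + n)))) : measurable S ->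
  volume [set x | S (swap2 x)] = volume (S : set 'rV[R]_(1 + (1 + n))).
Proof.
move=> mS; rewrite volumeS [RHS]volumeS.
have [nu nuE] := volume_measure n.
pose h (p : R * R) := volume [set y : 'rV[R]_n | S (row_mx p.1%:M (row_mx p.2%:M y) : 'rV[R]_(1 + (1 + n)))].
have mcons : measurable_fun [set: (R * R) * mrow n]
    (fun q => row_cons (q.1.1, row_cons (q.1.2, q.2)) : mrow (1 + (1 + n))).
  apply: (@measurableT_comp _ _ _ _ _ _ (@row_cons (1 + n))); first exact: measurable_row_cons.
  apply/measurable_fun_pairP; split => /=.
    exact: (measurableT_comp measurable_fst measurable_fst).
  apply: (@measurableT_comp _ _ _ _ _ _ (@row_cons n)); first exact: measurable_row_cons.
  apply/measurable_fun_pairP; split => /=; last exact: measurable_snd.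
  exact: (measurableT_comp measurable_snd measurable_fst).
have mh : measurable_fun [set: R * R] h.
  pose A := (fun q : (R * R) * mrow n => row_cons (q.1.1, row_cons (q.1.2, q.2)) : mrow (1 + (1 + n))) @^-1` S.
  have mA : measurable A by exact: measurable_preimageT.
  rewrite (_ : h = nu \o xsection A); first exact: measurable_fun_xsection.
  apply/funext => p /=; rewrite /h nuE.
    by congr (nu _); apply/seteqP; split => x; rewrite /xsection/= ?inE.
  apply: (@measurable_row_slice n (fun y : mrow (1 + n) => S (row_mx p.1%:M (y : 'rV_(1 + n)))) p.2).
  exact: (@measurable_row_slice (1 + n) S p.1).
transitivity (\int[mu]_t \int[mu]_s h (s, t))%E.
  apply: eq_integral => t _; rewrite volumeS; apply: eq_integral => s _.
  congr volume; apply/seteqP.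
  by split => x /=; rewrite /swap2 !(row_mxKl, row_mxKr).
transitivity (\int[mu]_t \int[mu]_s h (t, s))%E.
  exact/esym/(@fubini_tonelli _ _ _ _ R mu mu h mh (fun p => volume_ge0 _)).
by apply: eq_integral => t _; rewrite volumeS.
Qed.

Definition swap2_mx n : 'M[R]_(1 + (1 + n)) :=
  block_mx 0 (row_mx 1%:M 0) (col_mx 1%:M 0) (block_mx 0 0 0 1%:M).

Lemma mul_swap2_mx n (x : 'rV[R]_(1 + (1 + n))) : x *m swap2_mx n = swap2 x.
Proof.
rewrite -[x in LHS]hsubmxK -[rsubmx x in LHS]hsubmxK /swap2_mx !mul_row_block.
rewrite mul_row_col mul_mx_row !(mulmx0, mulmx1, add0r, addr0).
by rewrite add_row_mx addr0 add0r.
Qed.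

Lemma swap2_mxK n : swap2_mx n *m swap2_mx n = 1%:M.
Proof.
apply/row_matrixP => i; rewrite !rowE mulmxA mulmx1 !mul_swap2_mx /swap2.
by rewrite !(row_mxKl, row_mxKr) !hsubmxK.
Qed.

Lemma swap2_mx_col n (c : R) (r : R) :
  swap2_mx n *m col_mx c%:M (col_mx r%:M (0 : 'cV_n)) = col_mx r%:M (col_mx c%:M 0).
Proof.
rewrite /swap2_mx mul_block_col mul_row_col mul_col_mx mul_block_col.
by rewrite !(mul0mx, mul1mx, mulmx0, add0r, addr0) add_col_mx !addr0.
Qed.

Lemma scales_volume1 n : scales_volume (1%:M : 'M[R]_n).
Proof.
elim: n => [|n IH]; first exact: scales_volume0.
by rewrite -[n.+1]/(1 + n)%N scalar_mx_block; apply: scales_volume_ublock.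
Qed.

Lemma volume_translate n (w : 'rV[R]_n) (S : set (mrow n)) : measurable S ->
  volume [set x : 'rV[R]_n | S (x + w)] = volume (S : set 'rV[R]_n).
Proof.
move=> mS; have [_ h] := scales_volume1 n; have := h w S mS.
rewrite det1 normr1 invr1 mul1e => <-.
by congr volume; apply/seteqP; split => x /=; rewrite mulmx1.
Qed.

Lemma measurable_translate n (w : 'rV[R]_n) (S : set (mrow n)) : measurable S ->
  measurable ([set x | S ((x : 'rV[R]_n) + w)] : set (mrow n)).
Proof.
move=> mS; have := measurable_affine_preimage 1%:M w mS.
by under eq_set do rewrite mulmx1.
Qed.

Lemma scales_volumeV n (M : 'M[R]_n) : scales_volume M -> scales_volume (invmx M).
Proof.
move=> [uM h]; split; first by rewrite unitmx_inv.
move=> w S mS; have mS' := measurable_affine_preimage (invmx M) w mS.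
rewrite -(volume_translate w mS) det_inv normfV invrK.
have -> : [set x : 'rV[R]_n | S (x + w)] =
    [set x : 'rV[R]_n | [set y : 'rV[R]_n | S (y *m invmx M + w)] (x *m M + 0)].
  by apply/seteqP; split => x /=; rewrite addr0 mulmxK.
rewrite h// muleA -EFinM mulfV ?mul1e//.
by rewrite normr_eq0 -unitfE -unitmxE.
Qed.

(** The swap is an involution, so its determinant has absolute value 1. *)
Lemma scales_volume_swap2 n : scales_volume (swap2_mx n).
Proof.
have [u _] := mulmx1_unit (swap2_mxK n); split => // w S mS.
have -> : `|\det (swap2_mx n)| = 1.
  have /eqP : `|\det (swap2_mx n)| ^+ 2 = 1.
    by rewrite expr2 -normrM -det_mulmx swap2_mxK det1 normr1.
  by rewrite sqrp_eq1// => /eqP.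
rewrite invr1 mul1e -(volume_translate w mS).
rewrite -(volume_swap2 (measurable_translate w mS)).
by congr volume; apply/seteqP; split => x /=; rewrite mul_swap2_mx.
Qed.

Lemma scales_volume_dlsubmx0 n (M : 'M[R]_(1 + n)) :
  (forall N : 'M[R]_n, N \in unitmx -> scales_volume N) ->
  M \in unitmx -> dlsubmx M = 0 -> scales_volume M.
Proof.
move=> IH uM dl0; have ME : M = block_mx (M 0 0)%:M (ursubmx M) 0 (drsubmx M).
  rewrite -[LHS]submxK dl0; congr block_mx; apply/matrixP => i j.
  by rewrite !ord1 !mxE; congr (M _ _); exact/val_inj.
move: (M 0 0) (ursubmx M) (drsubmx M) ME uM => c ur d ->.
rewrite unitmxE unitfE det_ublock det_scalar1 mulf_eq0 negb_or => /andP[c0 d0].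
apply: scales_volume_ublock => //.
by apply: IH; rewrite unitmxE unitfE.
Qed.

(** Elimination in the first column: if its lower part vanishes, the matrix is block triangular;
    otherwise a product [g] of matrices known to scale the volume reduces to this case. *)
Lemma scales_volume_unit n (M : 'M[R]_n) : M \in unitmx -> scales_volume M.
Proof.
elim: n M => [|n IH] M uM; first exact: scales_volume0.
have [dl0|dl0] := eqVneq (dlsubmx (M : 'M[R]_(1 + n))) 0.
  exact: scales_volume_dlsubmx0.
case: n => [|n] in M uM IH dl0 *; first by move: dl0; rewrite [dlsubmx _]flatmx0 eqxx.
pose M' : 'M[R]_(1 + (1 + n)) := M.
(* [H] sends the lower part [w] of the first column to [r] times a basis vector, [U] cancels the top
   entry [a] by means of [r], and the swap brings [r] to the top. *)
pose w := dlsubmx M'; pose H := invmx (col_ebase w).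
have uH : H \in unitmx by rewrite unitmx_inv col_ebase_unit.
have rw : \rank w = 1%N.
  by apply/eqP; rewrite eqn_leq rank_leq_col lt0n mxrank_eq0.
pose r := (H *m w) 0 0.
have HwE : H *m w = col_mx r%:M (0 : 'cV_n).
  have E : H *m w = pid_mx 1 *m row_ebase w.
    by rewrite /H -[X in _ *m X](mulmx_ebase w) rw -mulmxA mulKmx ?col_ebase_unit.
  apply/colP => i; have [j ->|->] := unliftP 0 i.
    rewrite (_ : lift 0 j = rshift 1 j); last exact/val_inj.
    rewrite col_mxEd E [LHS]mxE [RHS]mxE big1// => k _.
    by rewrite !mxE ord1 andbF mul0r.
  rewrite [RHS](_ : _ = col_mx r%:M (0 : 'cV_n) (lshift n 0) 0).
    by rewrite col_mxEu [RHS]mxE mulr1n.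
  by congr (col_mx _ _ _ _); exact/val_inj.
have r0 : r != 0.
  apply: contra_neq dl0 => r0; rewrite -/M' -/w -[LHS](mulKmx uH) HwE r0.
  by rewrite raddf0 col_mx0 mulmx0.
pose a := ulsubmx M' 0 0.
pose U : 'M[R]_(1 + (1 + n)) := block_mx 1%:M (row_mx (- (a / r))%:M 0) 0 1%:M.
pose G : 'M[R]_(1 + (1 + n)) := block_mx 1%:M 0 0 H.
have sU : scales_volume U.
  by apply: scales_volume_ublock; [exact: oner_neq0|exact: scales_volume1].
have sG : scales_volume G.
  by apply: scales_volume_ublock; [exact: oner_neq0|exact: IH].
have sg := scales_volumeM (scales_volumeM (scales_volume_swap2 n) sU) sG.
set g := swap2_mx n *m U *m G in sg.
have [ug _] := sg.
have col0 : g *m lsubmx M' = col_mx r%:M (0 : 'cV_(1 + n)).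
  have -> : lsubmx M' = col_mx a%:M w.
    rewrite -[LHS]vsubmxK; congr col_mx; apply/matrixP => i j.
      by rewrite !ord1 [RHS]mxE eqxx mulr1n /a !mxE.
    by rewrite /w !mxE.
  rewrite /g -!mulmxA /G mul_block_col !mul1mx !mul0mx addr0 add0r HwE.
  rewrite /U mul_block_col !mul1mx mul0mx add0r mul_row_col mul0mx addr0.
  rewrite -scalar_mxM mulNr divfK// -raddfD/= subrr.
  by rewrite swap2_mx_col raddf0 col_mx0.
have dl0' : dlsubmx (g *m M') = 0.
  have -> : dlsubmx (g *m M') = dsubmx (g *m lsubmx M').
    have <- : lsubmx (g *m M') = g *m lsubmx M'.
      by rewrite -{1}(hsubmxK M') mul_mx_row row_mxKl.
    by apply/matrixP => i j; rewrite !mxE.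
  by rewrite col0 col_mxKd.
rewrite -[M](mulKmx ug); apply: scales_volumeM; first exact: scales_volumeV.
by apply: scales_volume_dlsubmx0 => //; rewrite unitmx_mul ug.
Qed.

(** * Volumes of simplices and null sets *)

Definition corner n (r : R) : set 'rV[R]_n :=
  [set x | (forall i, 0 <= x 0 i) /\ \sum_i x 0 i <= r].

Lemma measurable_corner n r : measurable (@corner n r : set (mrow n)).
Proof.
have -> : corner r = [set x : mrow n | (\sum_i (x : 'rV[R]_n) 0 i)%R \in `]-oo, r]] `&`
    \bigcap_(i in [set: 'I_n]) [set x : mrow n | (x : 'rV[R]_n) 0 i \in `[0%R, +oo[].
  apply/seteqP; split => [x [x0 xr]|x [/= xr x0]].
    by split=> /= [|i _ /=]; rewrite in_itv/= ?andbT.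
  split=> [i|]; last by move: xr; rewrite in_itv/=.
  by have := x0 i I; rewrite /= in_itv/= andbT.
apply: measurableI.
  apply: (@measurable_preimageT _ _ (mrow n) R (fun x => \sum_i (x : 'rV[R]_n) 0 i)
    [set` `]-oo, r]]) => //.
  by apply: measurable_sum => i; exact: measurable_coord.
apply: fin_bigcap_measurable => // i _.
by apply: (@measurable_preimageT _ _ (mrow n) R _ [set` `[0, +oo[]) => //; exact: measurable_coord.
Qed.

Lemma integral_corner_power n (r : R) : 0 <= r ->
  (\int[mu]_(t in `[0%R, r]) ((r - t) ^+ n / n`!%:R)%:E = (r ^+ n.+1 / n.+1`!%:R)%:E)%E.
Proof.
rewrite le_eqVlt => /orP[/eqP <-|r0].
  by rewrite set_itv1 integral_set1 exprS !mul0r.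
have n1 : (n.+1)%:R != 0 :> R by rewrite pnatr_eq0.
have n0 : n`!%:R != 0 :> R by rewrite pnatr_eq0 -lt0n fact_gt0.
pose F (t : R) := - ((r - t) ^+ n.+1 / n.+1`!%:R).
have dF (t : R) : is_derive t (1 : R) F ((r - t) ^+ n / n`!%:R).
  have d1 : is_derive t (1 : R) (fun x : R => r - x) (-1).
    have h := is_deriveB (is_derive_cst r t (1 : R)) (is_derive_id t (1 : R)).
    by apply: (is_derive_eq h); rewrite sub0r.
  have d2 : is_derive t (1 : R) ((- (n.+1`!%:R)^-1) \*: (fun x : R => r - x) ^+ n.+1)
      ((- (n.+1`!%:R)^-1) *: ((n.+1%:R * (r - t) ^+ n) *: (-1))).
    by apply: is_deriveZ; exact: is_deriveX.
  have -> : F = (- (n.+1`!%:R)^-1) \*: (fun x : R => r - x) ^+ n.+1.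
    by apply/funext => x; rewrite /F exprfctE -mulrN mulrC.
  apply: (is_derive_eq d2); rewrite /GRing.scale/= factS natrM.
  by move: n1 n0; move: (n.+1%:R : R) (n`!%:R : R) => p q p0 q0; field; rewrite p0 q0.
have cF : continuous F by move=> t; apply: differentiable_continuous; apply/derivable1_diffP; case: (dF t).
rewrite (@continuous_FTC2 _ (fun t => (r - t) ^+ n / n`!%:R) F)//.
- by rewrite -EFinB /F subrr expr0n/= mul0r oppr0 sub0r opprK addr0.
- apply: continuous_subspaceT => t.
  apply: cvgMl.
  apply: (@continuous_comp _ _ _ (fun t : R => r - t) (fun x => x ^+ n)).
    by apply: cvgB; [exact: cvg_cst|exact: cvg_id].
  exact: exprn_continuous.
- split.
  + by move=> t _; case: (dF t).
  + exact: cvg_at_right_filter (cF _).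
  + exact: cvg_at_left_filter (cF _).
- by move=> t _; rewrite derive1E (@derive_val _ _ _ _ _ _ _ (dF t)).
Qed.

(** For [t] between 0 and [r] the slice at [t] is the corner of size [r - t]; the other slices are
    empty. *)
Lemma volume_corner n r : 0 <= r -> volume (@corner n r) = (r ^+ n / n`!%:R)%:E.
Proof.
elim: n r => [|n IH] r r0.
  rewrite /= expr0 fact0 divr1 indicE mem_set//.
  by split=> [[]//|]; rewrite big_ord0.
rewrite volumeS.
have E t : volume [set x : 'rV[R]_n | corner r (row_mx t%:M x : 'rV[R]_(1 + n))] =
    ((fun t => ((r - t) ^+ n / n`!%:R)%:E) \_ `[0, r]) t.
  have cornerE (x : 'rV[R]_n) : corner r (row_mx t%:M x : 'rV[R]_(1 + n)) <->
      0 <= t /\ corner (r - t) x.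
    split=> [[x0 xr]|[t0 [x0 xr]]].
      split; first by have := x0 0; rewrite row_cons0.
      split=> [i|]; first by have := x0 (lift ord0 i); rewrite row_cons_lift.
      move: xr; rewrite big_ord_recl row_cons0 lerBrDl.
      by under eq_bigr do rewrite row_cons_lift.
    split=> [i|].
      by have [j ->|->] := unliftP 0 i; rewrite ?row_cons_lift ?row_cons0.
    rewrite big_ord_recl row_cons0 -lerBrDl.
    by under eq_bigr do rewrite row_cons_lift.
  rewrite patchE; case: ifPn => [|].
    rewrite inE/= in_itv/= => /andP[t0 tr].
    rewrite -IH ?subr_ge0//; congr volume; apply/seteqP; split => x /=.
      by move/cornerE => [].
    by move=> ?; apply/cornerE.
  rewrite notin_setE/= in_itv/= => tn.
  have -> : [set x : 'rV[R]_n | corner r (row_mx t%:M x : 'rV[R]_(1 + n))] = set0.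
    apply/seteqP; split => // x /= /cornerE[t0 [x0 xr]]; apply: tn.
    rewrite t0 -subr_ge0 (le_trans _ xr)//; exact: sumr_ge0.
  by have [nu nuE] := volume_measure n; rewrite (nuE set0)// measure0.
under eq_integral do rewrite E.
by rewrite -integral_mkcond integral_corner_power.
Qed.

Definition barycentric_hull n N (p : 'I_N -> 'rV[R]_n) : set 'rV[R]_n :=
  [set x | exists l : 'I_N -> R,
    [/\ forall i, 0 <= l i, \sum_i l i = 1 & x = \sum_i l i *: p i]].

Definition edge_mx n (p : 'I_n.+1 -> 'rV[R]_n) : 'M[R]_n :=
  \matrix_(i < n) (p (lift ord0 i) - p ord0).

Lemma sum_barycentric n (p : 'I_n.+1 -> 'rV[R]_n) (l : 'I_n.+1 -> R) : \sum_i l i = 1 ->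
  \sum_i l i *: p i = p ord0 + \row_i l (lift ord0 i) *m edge_mx p.
Proof.
move=> l1; rewrite big_ord_recl mulmx_sum_row.
have -> : l ord0 = 1 - \sum_(i < n) l (lift ord0 i) by rewrite -l1 big_ord_recl addrK.
rewrite scalerBl scale1r -addrA; congr (_ + _).
rewrite scaler_suml addrC -sumrB; apply: eq_bigr => i _.
by rewrite rowK mxE scalerBr.
Qed.

(** The coordinates of a point with respect to the edges from [p ord0] are its barycentric
    coordinates other than that of [p ord0]. *)
Lemma simplexE n (p : 'I_n.+1 -> 'rV[R]_n) : edge_mx p \in unitmx ->
  barycentric_hull p = [set x | corner 1 (x *m invmx (edge_mx p) - p ord0 *m invmx (edge_mx p))].
Proof.
move=> uE; apply/seteqP; split => [x [l [l0 l1 ->]]|x [x0 x1]] /=.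
  rewrite -mulmxBl sum_barycentric// addrC addKr mulmxK//; split=> [i|].
    by rewrite mxE.
  under eq_bigr do rewrite mxE.
  by rewrite -l1 big_ord_recl lerDr.
set y := _ - _ in x0 x1.
pose l i := if unlift ord0 i is Some j then y 0 j else 1 - \sum_j y 0 j.
have ll j : l (lift ord0 j) = y 0 j by rewrite /l liftK.
have l0' : l ord0 = 1 - \sum_j y 0 j by rewrite /l unlift_none.
have l1 : \sum_i l i = 1.
  by rewrite big_ord_recl l0'; under [X in _ + X]eq_bigr do rewrite ll; rewrite subrK.
exists l; split=> //.
  by move=> i; have [j ->|->] := unliftP ord0 i; rewrite ?ll// l0' subr_ge0.
rewrite sum_barycentric//.
have -> : \row_i l (lift ord0 i) = y by apply/rowP => i; rewrite mxE ll.
by rewrite /y mulmxBl !mulmxKV// addrC subrK.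
Qed.

Lemma measurable_simplex n (p : 'I_n.+1 -> 'rV[R]_n) : edge_mx p \in unitmx ->
  measurable (barycentric_hull p : set (mrow n)).
Proof.
move=> uE; rewrite simplexE//; apply: measurable_affine_preimage.
exact: measurable_corner.
Qed.

Lemma volume_simplex n (p : 'I_n.+1 -> 'rV[R]_n) : edge_mx p \in unitmx ->
  volume (barycentric_hull p) = (`|\det (edge_mx p)| / n`!%:R)%:E.
Proof.
move=> uE; rewrite simplexE//.
have [_ h] : scales_volume (invmx (edge_mx p)) by apply: scales_volume_unit; rewrite unitmx_inv.
rewrite h; last exact: measurable_corner.
by rewrite volume_corner// expr1n det_inv normfV invrK div1r -EFinM.
Qed.

Lemma hyperplane_coord n (v : 'cV[R]_n.+1) t (x : 'rV[R]_n) :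
  ((row_mx t%:M x : 'rV[R]_(1 + n)) *m v) 0 0 =
  t * v ord0 0 + (x *m (\col_i v (lift ord0 i) 0)) 0 0.
Proof.
rewrite !mxE big_ord_recl row_cons0; congr (_ + _).
by apply: eq_bigr => i _; rewrite row_cons_lift mxE.
Qed.

Lemma measurable_hyperplane n (v : 'cV[R]_n) c :
  measurable ([set x : mrow n | ((x : 'rV[R]_n) *m v) 0 0 = c]).
Proof.
apply: (@measurable_preimageT _ _ (mrow n) R _ [set c]) => //.
under eq_fun do rewrite mxE.
apply: measurable_sum => i; apply: measurable_funM; last exact: measurable_cst.
exact: measurable_coord.
Qed.

(** Either every slice is a hyperplane one dimension lower, or [v] sees the first coordinate only
    and all slices but one are empty. *)
Lemma volume_hyperplane n (v : 'cV[R]_n) c : v != 0 ->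
  volume [set x : 'rV[R]_n | (x *m v) 0 0 = c] = 0%E.
Proof.
elim: n v c => [|n IH] v c v0; first by rewrite [v]flatmx0 eqxx in v0.
pose v' : 'cV[R]_n := \col_i v (lift ord0 i) 0.
have E t : [set x : 'rV[R]_n | ((row_mx t%:M x : 'rV[R]_(1 + n)) *m v) 0 0 = c] =
    [set x | (x *m v') 0 0 = c - t * v ord0 0].
  apply/seteqP; split=> x /=; rewrite hyperplane_coord => h; first by rewrite -h addrC addKr.
  by rewrite /v' in h; rewrite h subrKC.
rewrite volumeS; have [v'0|v'0] := eqVneq v' 0; last first.
  by under eq_integral do rewrite E IH//; rewrite integral0.
have vn0 : v ord0 0 != 0.
  apply: contra_neq v0 => v00; apply/colP => i; rewrite mxE.
  have [j ->|-> //] := unliftP ord0 i.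
  by move/colP: v'0 => /(_ j); rewrite !mxE.
have E' t : volume [set x : 'rV[R]_n | ((row_mx t%:M x : 'rV[R]_(1 + n)) *m v) 0 0 = c] =
    ((fun t => volume [set x : 'rV[R]_n | ((row_mx t%:M x : 'rV[R]_(1 + n)) *m v) 0 0 = c])
     \_ [set c / v ord0 0]) t.
  rewrite patchE; case: ifPn => //; rewrite notin_setE/= => tc.
  rewrite E v'0.
  have -> : [set x : 'rV[R]_n | (x *m (0 : 'cV[R]_n)) 0 0 = c - t * v ord0 0] = set0.
    apply/seteqP; split=> // x /=; rewrite mulmx0 mxE => /esym/eqP; rewrite subr_eq0 => /eqP h.
    by apply: tc; rewrite h mulfK.
  by have [nu nuE] := volume_measure n; rewrite (nuE set0)// measure0.
under eq_integral do rewrite E'.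
by rewrite -integral_mkcond integral_set1.
Qed.

Lemma measure_bigsetU_null d (T : measurableType d) (nu : {measure set T -> \bar R})
    (I : eqType) (s : seq I) (S : I -> set T) : uniq s ->
  (forall i, i \in s -> measurable (S i)) ->
  (forall i j, i \in s -> j \in s -> i != j -> nu (S i `&` S j) = 0%E) ->
  nu (\big[setU/set0]_(i <- s) S i) = (\sum_(i <- s) nu (S i))%E.
Proof.
elim: s => [|i s IH]; first by rewrite !big_nil measure0.
rewrite /= => /andP[ins us] mS S0.
have mU : measurable (\big[setU/set0]_(j <- s) S j).
  by rewrite big_seq; apply: bigsetU_measurable => j js; apply: mS; rewrite in_cons js orbT.
have mi : measurable (S i) by apply: mS; rewrite mem_head.
rewrite !big_cons -IH//; last 2 first.
- by move=> j js; apply: mS; rewrite in_cons js orbT.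
- by move=> j k js ks; apply: S0; rewrite in_cons ?js ?ks orbT.
have null : nu (S i `&` \big[setU/set0]_(j <- s) S j) = 0%E.
  suff H r : {subset r <= s} -> nu (S i `&` \big[setU/set0]_(j <- r) S j) = 0%E by exact: H.
  elim: r => [|j r IHr] rs; first by rewrite big_nil setI0 measure0.
  have sr : {subset j :: r <= i :: s} by move=> k kr; rewrite in_cons rs ?orbT.
  have nr : {in j :: r, forall k, i != k}.
    by move=> k kr; apply: contraNneq ins => ->; exact: rs.
  rewrite big_cons setIUr; apply/eqP; rewrite eq_le measure_ge0 andbT.
  have jr : j \in j :: r by rewrite mem_head.
  apply: (@le_trans _ _ (nu (S i `&` S j) + nu (S i `&` \big[setU/set0]_(k <- r) S k))%E).
    apply: measureU2; apply: measurableI => //; first by apply: mS; exact: sr.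
    rewrite big_seq; apply: bigsetU_measurable => k kr.
    by apply: mS; apply: sr; rewrite in_cons kr orbT.
  have -> : nu (S i `&` S j) = 0%E.
    by apply: S0; [exact: mem_head|exact: sr|exact: nr].
  by rewrite add0e IHr// => k kr; apply: rs; rewrite in_cons kr orbT.
have -> : S i `|` \big[setU/set0]_(j <- s) S j =
    S i `|` (\big[setU/set0]_(j <- s) S j `\` S i) by rewrite setDE setUIr setUv setIT.
rewrite measureU//; last 2 first.
- exact: measurableD.
- by rewrite setDE setICA setICr setI0.
have -> : nu (\big[setU/set0]_(j <- s) S j) = nu (\big[setU/set0]_(j <- s) S j `\` S i).
  by rewrite [LHS](measureDI nu mU mi) setIC [X in (_ + X)%E]null adde0.
by [].
Qed.

Lemma sum_affine n (p : 'I_n.+1 -> 'rV[R]_n) (l : 'I_n.+1 -> R) :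
  \sum_i l i *: p i = (\sum_i l i) *: p ord0 + \row_i l (lift ord0 i) *m edge_mx p.
Proof.
rewrite big_ord_recl mulmx_sum_row [in RHS]big_ord_recl scalerDl -addrA; congr (_ + _).
rewrite scaler_suml -big_split/=; apply: eq_bigr => i _.
by rewrite rowK mxE scalerBr addrC subrK.
Qed.

Lemma affine_free n (p : 'I_n.+1 -> 'rV[R]_n) (l : 'I_n.+1 -> R) : edge_mx p \in unitmx ->
  \sum_i l i = 0 -> \sum_i l i *: p i = 0 -> forall i, l i = 0.
Proof.
move=> uE l0; rewrite sum_affine l0 scale0r add0r => /(congr1 (mulmxr (invmx (edge_mx p)))).
rewrite /= mulmxK// mul0mx => /rowP r0.
have lift0 i : l (lift ord0 i) = 0 by have := r0 i; rewrite !mxE.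
move=> i; have [j ->|->] := unliftP ord0 i => //.
by move: l0; rewrite big_ord_recl big1 ?addr0.
Qed.

(** On the facet the barycentric coordinate [j] vanishes. For [j] other than [ord0] it is one of the
    edge coordinates; for [ord0] it is 1 minus their sum, whence the all-ones vector and the extra 1
    in the constant. *)
Lemma simplex_facet_hyperplane n (p : 'I_n.+1 -> 'rV[R]_n) (j : 'I_n.+1) : edge_mx p \in unitmx ->
  (0 < n)%N -> exists v : 'cV[R]_n, exists2 c : R, v != 0 &
    forall l : 'I_n.+1 -> R, \sum_i l i = 1 -> l j = 0 -> ((\sum_i l i *: p i) *m v) 0 0 = c.
Proof.
move=> uE n0; pose w : 'cV[R]_n := if unlift ord0 j is Some i then delta_mx i 0 else const_mx 1.
exists (invmx (edge_mx p) *m w).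
exists ((p ord0 *m (invmx (edge_mx p) *m w)) 0 0 + (unlift ord0 j == None)%:R).
  have w0 : w != 0.
    have [i _|_] := unliftP ord0 j; rewrite /w; case: unlift => [k|].
    - by apply/eqP => /colP/(_ k)/eqP; rewrite !mxE !eqxx oner_eq0.
    - by apply/eqP => /colP/(_ i)/eqP; rewrite !mxE oner_eq0.
    - by apply/eqP => /colP/(_ k)/eqP; rewrite !mxE !eqxx oner_eq0.
    - by apply/eqP => /colP/(_ (Ordinal n0))/eqP; rewrite !mxE oner_eq0.
  by apply: contra_neq w0 => h; rewrite -[w](mulKVmx uE) h mulmx0.
move=> l l1 lj; rewrite sum_affine l1 scale1r mulmxDl mxE; congr (_ + _).
rewrite mulmxA mulmxK// mxE /w; move: lj.
case: (unliftP ord0 j) => [i ->|->]; rewrite ?liftK ?unlift_none => lj.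
  rewrite big1// => k _; rewrite !mxE; have [->|] := eqVneq k i; first by rewrite lj mul0r.
  by rewrite mulr0.
under eq_bigr => k _ do rewrite mxE [const_mx _ _ _]mxE mulr1.
by rewrite eqxx mulr1n -l1 big_ord_recl lj add0r.
Qed.

Lemma barycentric_hull_lift n N (p : 'I_N.+1 -> 'rV[R]_n) k :
  barycentric_hull (p \o lift k) =
  [set x | exists l : 'I_N.+1 -> R,
    [/\ forall i, 0 <= l i, \sum_i l i = 1, x = \sum_i l i *: p i & l k = 0]].
Proof.
apply/seteqP; split => x [l [l0 l1 ->]].
  pose l' i := if unlift k i is Some j then l j else 0.
  have l'k : l' k = 0 by rewrite /l' unlift_none.
  have l'j j : l' (lift k j) = l j by rewrite /l' liftK.
  exists l'; split => //.
  - by move=> i; rewrite /l'; case: unlift.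
  - by rewrite (bigD1_ord k)//= l'k add0r -l1; apply: eq_bigr => j _; rewrite l'j.
  - by rewrite (bigD1_ord k)//= l'k scale0r add0r; apply: eq_bigr => j _; rewrite l'j.
move=> lk; exists (l \o lift k); split => //.
- by move=> i; exact: l0.
- by rewrite -l1 (bigD1_ord k)//= lk add0r.
- by rewrite (bigD1_ord k)//= lk scale0r add0r.
Qed.

(* Moving x along the affine relation b until the first coefficient with
   b k > 0 vanishes. *)
Lemma barycentric_hull_triangulation n N (p : 'I_N.+1 -> 'rV[R]_n) (b : 'I_N.+1 -> R) k0 :
  0 < b k0 -> \sum_i b i = 0 -> \sum_i b i *: p i = 0 ->
  barycentric_hull p =
  \big[setU/set0]_(k <- enum [pred k | 0 < b k]) barycentric_hull (p \o lift k).
Proof.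
move=> bk0 b0 bp0; rewrite -bigcup_seq; apply/seteqP; split => x.
  move=> [l [l0 l1 ->]].
  have [k bk kmin] := Order.TotalTheory.arg_minP (fun k => l k / b k) (bk0 : [pred k | 0 < b k] k0).
  pose s := l k / b k.
  have s0 : 0 <= s by rewrite divr_ge0// ltW.
  exists k; first by rewrite /= mem_enum.
  rewrite barycentric_hull_lift; exists (fun i => l i - s * b i); split.
  - move=> i; rewrite subr_ge0; have [bi|bi] := ltP 0 (b i).
      by rewrite -ler_pdivlMr//; exact: kmin.
    by apply: le_trans (l0 i); rewrite mulr_ge0_le0.
  - by rewrite sumrB l1 -mulr_sumr b0 mulr0 subr0.
  - under [RHS]eq_bigr do rewrite scalerBl -scalerA.
    by rewrite sumrB -scaler_sumr bp0 scaler0 subr0.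
  - by rewrite /s divfK ?subrr// gt_eqF.
by move=> [k _]; rewrite barycentric_hull_lift => -[l [l0 l1 xl _]]; exists l.
Qed.

(** * Volume of the convex hull of a circuit *)

Section Circuit.
Variables (n : nat) (p : 'I_n.+2 -> 'rV[R]_n) (b : 'I_n.+2 -> R).
Hypotheses (b0 : \sum_i b i = 0) (bp0 : \sum_i b i *: p i = 0).
Hypothesis unit_face : forall k, 0 < b k -> edge_mx (p \o lift k) \in unitmx.

(** Subtracting the multiple of [b] that cancels the coefficient at [k] leaves an affine relation on
    the face without [p k], whose points are affinely independent. *)
Lemma affine_relation_unique k (l : 'I_n.+2 -> R) : 0 < b k ->
  \sum_i l i = 0 -> \sum_i l i *: p i = 0 -> forall i, l i = l k / b k * b i.
Proof.
move=> bk l0 lp0; pose s := l k / b k.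
have sk : l k - s * b k = 0 by rewrite /s divfK ?subrr// gt_eqF.
have h := @affine_free n (p \o lift k) (fun j => l (lift k j) - s * b (lift k j)) (unit_face bk).
have {}h : forall j, l (lift k j) - s * b (lift k j) = 0.
  apply: h.
    have : \sum_i (l i - s * b i) = 0 by rewrite sumrB l0 -mulr_sumr b0 mulr0 subr0.
    by rewrite (bigD1_ord k)//= sk add0r.
  have : \sum_i (l i - s * b i) *: p i = 0.
    under eq_bigr do rewrite scalerBl -scalerA.
    by rewrite sumrB lp0 -scaler_sumr bp0 scaler0 subr0.
  by rewrite (bigD1_ord k)//= sk scale0r add0r.
move=> i; apply/eqP; rewrite -subr_eq0; apply/eqP.
by have [j ->|->] := unliftP k i.
Qed.

(** A common point has two barycentric descriptions that differ by a multiple of [b]. The zero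
    coefficient at [k] fixes the sign of this multiple, which then makes the coefficient at [k']
    vanish in both: the overlap lies in the hyperplane of a facet. *)
Lemma volume_face_overlap k k' : 0 < b k -> 0 < b k' -> k != k' ->
  volume (barycentric_hull (p \o lift k) `&` barycentric_hull (p \o lift k')) = 0%E.
Proof.
move=> bk bk' kk'.
(* For [n = 0] there are only two points, and their coefficients cannot both be positive. *)
have n_gt0 : (0 < n)%N.
  case: (posnP n) => // n0; exfalso.
  have : 0 < \sum_i b i; last by rewrite b0 ltxx.
  rewrite (bigD1 k)//= ltr_pwDl// sumr_ge0// => i _; suff [->|->] : i = k \/ i = k' by rewrite ltW.
  have := ltn_ord i; have := ltn_ord k; have := ltn_ord k'.
  move=> lk' lk li; have {}kk' : (k : nat) != k' by [].
  by have [ik|ik] := eqVneq (i : nat) k; [left|right]; apply: val_inj => //=; lia.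
have [j k'j] : exists j, k' = lift k j.
  by have [j ->|e] := unliftP k k'; [exists j|rewrite e eqxx in kk'].
have [v [c v0 vc]] := simplex_facet_hyperplane j (unit_face bk) n_gt0.
have [nu nuE] := volume_measure n.
have mI : measurable (barycentric_hull (p \o lift k) `&` barycentric_hull (p \o lift k') : set (mrow n)).
  by apply: measurableI; apply: measurable_simplex; exact: unit_face.
have mH := measurable_hyperplane v c.
apply/eqP; rewrite eq_le volume_ge0 andbT -(volume_hyperplane c v0).
rewrite (nuE _ mI) (nuE _ mH) le_measure ?inE//.
move=> x []; rewrite !barycentric_hull_lift => -[l [l0 l1 xl lk]] [l' [l'0 l'1 xl' l'k']] /=.
have := @affine_relation_unique k (fun i => l i - l' i) bk.
rewrite sumrB l1 l'1 subrr; under eq_bigr do rewrite scalerBl.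
rewrite sumrB -xl -xl' subrr lk sub0r => /(_ erefl erefl k').
rewrite l'k' subr0 => lk'.
have {}lk' : l k' = 0.
  apply/eqP; rewrite eq_le l0 andbT lk' mulr_le0_ge0// ?(ltW bk')//.
  by rewrite mulr_le0_ge0// ?oppr_le0// invr_ge0 ltW.
have := vc (l \o lift k); rewrite xl (bigD1_ord k)//= lk scale0r add0r; apply.
  by rewrite -l1 [in RHS](bigD1_ord k)//= lk add0r.
by rewrite -k'j.
Qed.

Lemma volume_circuit_hull k0 : 0 < b k0 ->
  (forall k, 0 < b k -> `|\det (edge_mx (p \o lift k))| = b k) ->
  (n`!%:R%:E * volume (barycentric_hull p))%E = (\sum_(k | 0 < b k) b k)%:E.
Proof.
move=> bk0 bdet; rewrite (barycentric_hull_triangulation bk0 b0 bp0).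
have [nu nuE] := volume_measure n.
have mF k : k \in enum [pred k | 0 < b k] -> measurable (barycentric_hull (p \o lift k) : set (mrow n)).
  by rewrite mem_enum => bk; apply: measurable_simplex; exact: unit_face.
rewrite nuE; last by rewrite big_seq; apply: bigsetU_measurable => k ks; exact: mF.
rewrite measure_bigsetU_null//; last 2 first.
- exact: enum_uniq.
- move=> i j ins js ij; apply: (eq_trans (esym (nuE _ _))).
    by apply: measurableI; exact: mF.
  by move: ins js; rewrite !mem_enum => bi bj; exact: volume_face_overlap.
rewrite big_seq (eq_bigr (fun k => (b k / n`!%:R)%:E)); last first.
  move=> k ks; apply: (eq_trans (esym (nuE _ (mF _ ks)))).
  move: ks; rewrite mem_enum => bk.
  by rewrite volume_simplex ?bdet//; exact: unit_face.
rewrite -big_seq sumEFin -EFinM -mulr_suml mulrCA mulfV ?mulr1 ?pnatr_eq0 -?lt0n ?fact_gt0//.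
by rewrite big_enum.
Qed.

End Circuit.

End RowMeasure.

(** * The affine relation of a circuit *)

(** Multiplication on the left computes the sum of the coefficients together with the combination of
    the points, so affine relations are the left kernel. *)
Definition homogeneous_mx (S : nzRingType) n N (p : 'I_N -> 'rV[S]_n) : 'M[S]_(N, 1 + n) :=
  \matrix_(k < N) row_mx 1%:M (p k).

Lemma mul_homogeneous_mx (S : nzRingType) n N (p : 'I_N -> 'rV[S]_n) (t : 'rV[S]_N) :
  t *m homogeneous_mx p = row_mx (\sum_k t 0 k)%:M (\sum_k t 0 k *: p k).
Proof.
rewrite mulmx_sum_row; under eq_bigr do rewrite rowK scale_row_mx.
rewrite raddf_sum; elim/big_rec3: _ => [|k x y s _ ->]; first by rewrite row_mx0.
by rewrite add_row_mx scale_scalar_mx mulr1.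
Qed.

Lemma homogeneous_mx_mul (S : nzRingType) n N (p : 'I_N -> 'rV[S]_n)
    (x : S) (y : 'cV[S]_n) k :
  (homogeneous_mx p *m col_mx x%:M y) k 0 = x + (p k *m y) 0 0.
Proof.
have -> (A : 'cV[S]_N) : A k 0 = row k A 0 0 :> S by rewrite mxE.
by rewrite row_mul rowK mul_row_col mul1mx mxE mxE mulr1n.
Qed.

Lemma map_homogeneous_mx (S S' : nzRingType) (g : {rmorphism S -> S'}) n N (p : 'I_N -> 'rV[S]_n) :
  map_mx g (homogeneous_mx p) = homogeneous_mx (fun k => map_mx g (p k)).
Proof.
apply/row_matrixP => k; rewrite -map_row !rowK map_row_mx.
by rewrite map_scalar_mx rmorph1.
Qed.

(** Subtracting the first row from the others makes the matrix block triangular. *)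
Lemma det_homogeneous_mx (R : realType) n (p : 'I_n.+1 -> 'rV[R]_n) :
  \det (homogeneous_mx p : 'M[R]_(1 + n)) = \det (edge_mx p).
Proof.
have -> : homogeneous_mx p = block_mx 1%:M 0 (const_mx 1) 1%:M *m
    block_mx 1%:M (p ord0) 0 (edge_mx p) :> 'M[R]_(1 + n).
  rewrite mulmx_block !(mul1mx, mulmx1, mul0mx, mulmx0, addr0).
  apply/row_matrixP => k; rewrite rowK; have [j ->|->] := unliftP ord0 k.
    rewrite (_ : lift ord0 j = rshift 1 j); last exact/val_inj.
    rewrite /block_mx rowKd row_row_mx; congr row_mx.
      by apply/rowP => i; rewrite !mxE !ord1 mulr1n.
    apply/rowP => i; rewrite !mxE big_ord1 !mxE mul1r.
    by rewrite (_ : rshift 1 j = lift ord0 j) ?subrKC//; exact/val_inj.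
  have -> (A : 'M[R]_(1 + n)) : row ord0 A = row (lshift n 0) A by congr row; exact/val_inj.
  rewrite /block_mx rowKu row_row_mx; congr row_mx.
    by apply/rowP => i; rewrite !mxE !ord1.
  by apply/rowP => i; rewrite [RHS]mxE.
by rewrite det_mulmx det_lblock det_ublock !det1 !mul1r.
Qed.

(** The signed maximal minors, which represent the linear form sending [w] to the determinant of [w]
    followed by [M]; this form vanishes on the columns of [M]. *)
Definition cofactor_row (S : comNzRingType) m (M : 'M[S]_(m.+1, m)) : 'rV[S]_m.+1 :=
  \row_k ((-1) ^+ k * \det (row' k M)).

Lemma det_row_mx_cofactor (S : comNzRingType) m (M : 'M[S]_(m.+1, m)) (w : 'cV[S]_m.+1) :
  \det (row_mx w M : 'M[S]_(1 + m)) = (cofactor_row M *m w) 0 0.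
Proof.
rewrite (expand_det_col _ ord0) mxE; apply: eq_bigr => k _.
rewrite [RHS]mulrC; congr (_ * _).
  by rewrite mxE; case: splitP => // j _; rewrite ord1.
rewrite mxE /cofactor addn0; congr (_ * \det _).
apply/matrixP => i j; rewrite [RHS]mxE mxE [LHS]mxE.
by rewrite -[RHS](row_mxEr w); congr (row_mx w M _ _); exact/val_inj.
Qed.

Lemma mul_cofactor_row (S : comNzRingType) m (M : 'M[S]_(m.+1, m)) :
  cofactor_row M *m M = 0.
Proof.
apply/rowP => j; rewrite [RHS]mxE.
have -> : (cofactor_row M *m M) 0 j = (cofactor_row M *m col j M) 0 0.
  by rewrite colE mulmxA -colE [RHS]mxE.
rewrite -det_row_mx_cofactor -det_tr tr_row_mx.
apply: (@determinant_alternate _ _ _ (lshift m 0) (rshift 1 j)); first by rewrite eq_lrshift.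
by move=> k; rewrite col_mxEu col_mxEd !mxE.
Qed.

(** [Q] projects onto the kernel of [N]. If all minors vanish, each column [x] of [Q] satisfies a
    rational dependency with the columns of [M]. Applying [N] kills [x] and isolates the
    coefficients of [M], which are thus 0, so [x = 0] and [Q = 0]. But the trace of [Q] is
    [(m + 1) - m]. *)
Lemma cofactor_row_neq0 m (M : 'M[int]_(m.+1, m)) (N : 'M[int]_(m, m.+1)) :
  N *m M = 1%:M -> cofactor_row M != 0.
Proof.
move=> NM; apply/eqP => b0; pose Q := 1%:M - M *m N.
have NQ : N *m Q = 0 by rewrite mulmxBr mulmx1 mulmxA NM mul1mx subrr.
have /eqP Q0 : Q == 0.
  apply/eqP/matrixP => i0 j; rewrite [RHS]mxE.
  suff x0 : col j Q = 0 by move/colP/(_ i0): x0; rewrite !mxE.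
  set x := col j Q.
  have Nx : N *m x = 0 by rewrite /x colE mulmxA NQ mul0mx.
  have : \det (row_mx x M : 'M[int]_(1 + m)) = 0.
    by rewrite det_row_mx_cofactor b0 mul0mx mxE.
  move/(congr1 (intr : int -> rat)); rewrite rmorph0 -det_map_mx -det_tr => /eqP/det0P[y y0].
  move/(congr1 trmx); rewrite trmx_mul trmxK trmx0 map_row_mx -[y]hsubmxK tr_row_mx mul_row_col.
  set s := (lsubmx y)^T; set z := (rsubmx y)^T => e.
  have z0 : z = 0.
    move/(congr1 (mulmx (map_mx intr N))): (e).
    rewrite mulmxDr !mulmxA -!map_mxM Nx NM map_mx0 map_mx1 mul0mx add0r mul1mx mulmx0.
    by [].
  have xs : map_mx intr x *m s = 0 by move: e; rewrite z0 mulmx0 addr0.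
  have s0 : s 0 0 != 0.
    apply: contra_neq y0 => s00; rewrite -[y]hsubmxK -[lsubmx y]trmxK -[rsubmx y]trmxK -/s -/z z0.
    by rewrite [s]mx11_scalar s00 raddf0 !trmx0 row_mx0.
  move/eqP: xs; rewrite [s]mx11_scalar mul_mx_scalar scalemx_eq0 (negbTE s0) => /eqP/colP xs.
  apply/colP => i; have := xs i; rewrite [LHS]mxE [RHS]mxE => /eqP.
  by rewrite intr_eq0 [RHS]mxE => /eqP.
have : \tr Q = 1.
  by rewrite raddfB/= mxtrace_mulC NM !mxtrace1 -natrB// subSnn.
by rewrite Q0 mxtrace0 => /esym/eqP; rewrite oner_eq0.
Qed.

(** The product of the matrix with rows [b], [N] and the matrix with columns [x], [M] is block
    triangular of determinant [b x], which is also the determinant of the second factor. So the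
    first factor has determinant 1, and expanding it along [b] gives [v]. *)
Lemma cofactor_row_primitive m (M : 'M[int]_(m.+1, m)) (N : 'M[int]_(m, m.+1)) :
  N *m M = 1%:M -> exists v : 'cV[int]_m.+1, cofactor_row M *m v = 1%:M.
Proof.
move=> NM; pose b := cofactor_row M; have bM : b *m M = 0 := mul_cofactor_row M.
have /rV0Pn[k bk] := cofactor_row_neq0 NM.
pose x : 'cV[int]_m.+1 := delta_mx k 0.
have bx : (b *m x) 0 0 = b 0 k by rewrite -colE mxE.
have detE : \det (col_mx b N : 'M[int]_(1 + m)) = 1.
  apply: (mulIf bk); rewrite mul1r -{1}bx -det_row_mx_cofactor -det_mulmx.
  rewrite mul_col_row bM NM det_lblock det1 mulr1 [b *m x]mx11_scalar det_scalar1.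
  exact: bx.
exists (\col_j cofactor (col_mx b N : 'M[int]_(1 + m)) ord0 j).
apply/rowP => i; rewrite !ord1 [RHS]mxE/= mulr1n -detE (expand_det_row _ ord0) mxE.
apply: eq_bigr => j _; congr (_ * _); last by rewrite mxE.
by rewrite -[LHS](col_mxEu _ N); congr (col_mx b N _ _); exact/val_inj.
Qed.

(* The columns of v and M form a basis of Z^m+1, with dual basis b and N'. *)
Lemma cofactor_row_splitting m (M : 'M[int]_(m.+1, m)) (N : 'M[int]_(m, m.+1)) :
  N *m M = 1%:M -> exists (v : 'cV[int]_m.+1) (N' : 'M[int]_(m, m.+1)),
    cofactor_row M *m v = 1%:M /\ v *m cofactor_row M + M *m N' = 1%:M.
Proof.
move=> NM; have [v bv] := cofactor_row_primitive NM.
pose b := cofactor_row M; have bM : b *m M = 0 := mul_cofactor_row M.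
pose N' := N - N *m v *m b.
have BC : col_mx b N' *m row_mx v M = 1%:M :> 'M[int]_(1 + m).
  rewrite mul_col_row bM bv !mulmxBl NM -!mulmxA bM bv mulmx1 !mulmx0 subrr subr0.
  by rewrite -scalar_mx_block.
by exists v, N'; split=> //; rewrite -mul_row_col; exact: mulmx1C BC.
Qed.

(** Generating the lattice by differences amounts to the rows of the homogeneous matrix spanning
    [Z^(1+n)]; the rows of [N] express its standard basis. *)
Lemma homogeneous_mx_left_inverse n (a : 'I_n.+2 -> 'rV[int]_n) :
  affinely_generates a -> exists N : 'M[int]_(n.+1, n.+2), N *m homogeneous_mx a = 1%:M.
Proof.
move=> gen.
have dir (w : 'rV[int]_n) : exists t : 'rV[int]_n.+2, t *m homogeneous_mx a = row_mx 0%:M w.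
  have [c wE] := gen w; exists (\row_k c k - (\sum_k c k) *: delta_mx 0 ord0).
  rewrite mulmxBl -scalemxAl -rowE rowK mul_homogeneous_mx scale_row_mx opp_row_mx add_row_mx.
  congr row_mx.
    rewrite scale_scalar_mx mulr1 -raddfB/=; congr (_%:M); rewrite -sumrB big1// => k _.
    by rewrite mxE subrr.
  rewrite wE scaler_suml -sumrB; apply: eq_bigr => k _.
  by rewrite mxE scalerBr.
have pt (x : int) (w : 'rV[int]_n) : exists t : 'rV[int]_n.+2, t *m homogeneous_mx a = row_mx x%:M w.
  have [t tE] := dir (w - x *: a ord0); exists (t + x *: delta_mx 0 ord0).
  rewrite mulmxDl tE -scalemxAl -rowE rowK scale_row_mx add_row_mx subrK.
  by rewrite scale_scalar_mx mulr1 -raddfD/= add0r.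
have ch (i : 'I_n.+1) : {t : 'rV[int]_n.+2 |
    t *m homogeneous_mx a = row i (1%:M : 'M[int]_(1 + n))}.
  apply: cid; set e := row i _; have [t tE] := pt (lsubmx e 0 0) (rsubmx e).
  by exists t; rewrite tE -mx11_scalar hsubmxK.
exists (\matrix_(i < n.+1) sval (ch i)); apply/row_matrixP => i.
by rewrite row_mul rowK; exact: svalP (ch i).
Qed.

(** Up to sign the coefficient at [k] is the normalized volume of the face without [a k], which
    links the relation to [Vol]. *)
Definition circuit_relation n (a : 'I_n.+2 -> 'rV[int]_n) (k : 'I_n.+2) : int :=
  cofactor_row (homogeneous_mx a : 'M[int]_((1 + n).+1, 1 + n)) 0 k.

Section CircuitRelation.
Variables (n : nat) (a : 'I_n.+2 -> 'rV[int]_n).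
Let b := circuit_relation a.

Lemma circuit_relationE :
  cofactor_row (homogeneous_mx a : 'M[int]_((1 + n).+1, 1 + n)) = \row_k b k.
Proof. by apply/rowP => k; rewrite [RHS]mxE. Qed.

Lemma sum_circuit_relation : \sum_k b k = 0 /\ \sum_k b k *: a k = 0.
Proof.
have := mul_cofactor_row (homogeneous_mx a : 'M[int]_((1 + n).+1, 1 + n)).
rewrite circuit_relationE mul_homogeneous_mx -[X in _ = X]row_mx0 => /eq_row_mx[].
under eq_bigr do rewrite mxE; under [X in _ -> X = _ -> _]eq_bigr do rewrite mxE.
by move=> /matrixP/(_ 0 0); rewrite !mxE mulr1n.
Qed.

Lemma det_face_circuit_relation (R : realType) (k : 'I_n.+2) :
  `|\det (edge_mx (fun i : 'I_n.+1 => map_mx intr (a (lift k i)) : 'rV[R]_n))| = `|(b k)%:~R|.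
Proof.
rewrite -det_homogeneous_mx -(map_homogeneous_mx intr) det_map_mx.
rewrite /b /circuit_relation mxE rmorphM/= normrM rmorphXn/= normrX rmorphN1 normrN1 expr1n mul1r.
congr `|(\det _)%:~R|; apply/row_matrixP => i; rewrite rowK.
by apply/rowP => j; rewrite !mxE.
Qed.

Hypothesis gen : affinely_generates a.

Lemma circuit_relation_splitting : exists (v : 'cV[int]_n.+2) (N : 'M[int]_(1 + n, n.+2)),
  (\row_k b k) *m v = 1%:M /\ v *m (\row_k b k) + homogeneous_mx a *m N = 1%:M.
Proof.
have [N NM] := homogeneous_mx_left_inverse gen.
have [v [N' [bv bN]]] := cofactor_row_splitting NM.
by exists v, N'; rewrite -circuit_relationE.
Qed.

Lemma circuit_relation_unit : exists v : 'I_n.+2 -> int, \sum_k b k * v k = 1.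
Proof.
have [v [N [bv _]]] := circuit_relation_splitting.
exists (fun k => v k 0); move/matrixP/(_ 0 0): bv; rewrite !mxE mulr1n => <-.
by apply: eq_bigr => k _; rewrite mxE.
Qed.

(** [X] and [Y] depend neither on the ring nor on [u]: integer [u] get integer coordinates, and
    small real [u] get small ones. *)
Lemma circuit_relation_coordinates :
  exists (X : 'I_n.+2 -> int) (Y : 'I_n -> 'I_n.+2 -> int),
  forall (S : comNzRingType) (u : 'I_n.+2 -> S), \sum_k (b k)%:~R * u k = 0 -> forall k,
    u k = \sum_j (X j)%:~R * u j + \sum_i (a k 0 i)%:~R * (\sum_j (Y i j)%:~R * u j).
Proof.
have [v [N [_ split1]]] := circuit_relation_splitting.
exists (N (lshift n 0)), (fun i => N (rshift 1 i)) => S u bu k.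
pose U : 'cV[S]_n.+2 := \col_k u k.
have bU : map_mx intr (\row_k b k) *m U = 0.
  apply/matrixP => i j; rewrite !mxE -[RHS]bu; apply: eq_bigr => l _.
  by rewrite !mxE.
pose W : 'cV[S]_(1 + n) := map_mx intr N *m U.
have UE : U = homogeneous_mx (fun k => map_mx intr (a k)) *m W.
  move/(congr1 (fun A => map_mx intr A *m U)): split1.
  rewrite /= map_mxD mulmxDl !map_mxM map_mx1 mul1mx -mulmxA bU mulmx0 add0r => {1}<-.
  by rewrite (map_homogeneous_mx intr) mulmxA.
have WE i : W i 0 = \sum_j (N i j)%:~R * u j.
  by rewrite mxE; apply: eq_bigr => j _; rewrite !mxE.
have -> : u k = U k 0 by rewrite mxE.
rewrite [in LHS]UE -[W](@vsubmxK _ 1 n) [usubmx W]mx11_scalar homogeneous_mx_mul.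
rewrite mxE WE; congr (_ + _); rewrite mxE; apply: eq_bigr => i _.
by rewrite !mxE -WE mxE.
Qed.

Lemma circuit_relation_orthogonal (S : comNzRingType) (u : 'I_n.+2 -> S) :
  \sum_k (b k)%:~R * u k = 0 ->
  exists (x : S) (y : 'rV[S]_n), forall k, u k = x + \sum_i (a k 0 i)%:~R * y 0 i.
Proof.
move=> bu; have [X [Y uE]] := circuit_relation_coordinates.
exists (\sum_j (X j)%:~R * u j), (\row_i \sum_j (Y i j)%:~R * u j) => k.
rewrite [LHS](uE _ _ bu); congr (_ + _).
by apply: eq_bigr => i _; rewrite mxE.
Qed.

(** Multiplying the splitting of the identity by [t] on the left kills the part through the
    homogeneous matrix and leaves a multiple of [b]. *)
Lemma circuit_relation_unique (S : comNzRingType) (t : 'I_n.+2 -> S) :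
  \sum_k t k = 0 -> (forall i, \sum_k t k * (a k 0 i)%:~R = 0) ->
  exists x : S, forall k, t k = x * (b k)%:~R.
Proof.
move=> t0 ta; have [v [N [_ split1]]] := circuit_relation_splitting.
pose T : 'rV[S]_n.+2 := \row_k t k.
have TM : T *m homogeneous_mx (fun k => map_mx intr (a k)) = 0.
  rewrite mul_homogeneous_mx -row_mx0; congr row_mx.
    by under eq_bigr do rewrite mxE; rewrite t0 raddf0.
  apply/rowP => i; rewrite summxE [RHS]mxE -[RHS](ta i); apply: eq_bigr => k _.
  by rewrite !mxE.
exists ((T *m map_mx intr v) 0 0) => k.
have -> : t k = T 0 k by rewrite mxE.
move/(congr1 (fun A => T *m map_mx intr A)): split1.
rewrite /= map_mxD mulmxDr !map_mxM map_mx1 mulmx1 (map_homogeneous_mx intr) !mulmxA TM mul0mx addr0.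
move=> /rowP/(_ k) <-; rewrite mxE big_ord1 !mxE.
by [].
Qed.

End CircuitRelation.

Lemma convex_hull_range (R : realType) n N (p : 'I_N -> 'rV[R]_n) :
  convex_hull (range p) = barycentric_hull p.
Proof.
apply/seteqP; split=> x; last first.
  by move=> [l [l0 l1 ->]]; exists N, p, l; split => // i; exists i.
move=> [m [q [t [qp t0 t1 ->]]]].
have ch i : {k : 'I_N | p k = q i} by apply: cid; have [k _ <-] := qp i; exists k.
pose g i := sval (ch i); have pg i : p (g i) = q i := svalP (ch i).
exists (fun k => \sum_(i | g i == k) t i); split.
- by move=> k; exact: sumr_ge0.
- by rewrite -t1 [RHS](partition_big g xpredT).
- rewrite (partition_big g xpredT)//=; apply: eq_bigr => k _; rewrite scaler_suml.
  by apply: eq_bigr => i /eqP <-; rewrite pg.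
Qed.

Lemma barycentric_hull_vertex (R : realType) n N (p : 'I_N -> 'rV[R]_n) k :
  barycentric_hull p (p k).
Proof.
exists (fun i => (i == k)%:R); split=> [i|/=|].
- by rewrite ler0n.
- by rewrite (bigD1 k)//= eqxx big1 ?addr0// => i /negbTE ->.
- rewrite (bigD1 k)//= eqxx scale1r big1 ?addr0// => i /negbTE ->.
  by rewrite scale0r.
Qed.

(* Otherwise p k is a convex combination of the other points. *)
Lemma vertices_two_positive (R : realType) n N (p : 'I_N -> 'rV[R]_n) (b : 'I_N -> R) k :
  injective p -> (forall i, vertices (barycentric_hull p) (p i)) ->
  (forall i, b i != 0) -> \sum_i b i = 0 -> \sum_i b i *: p i = 0 ->
  0 < b k -> exists2 k', k' != k & 0 < b k'.
Proof.
move=> pI vp b0 sb sbp bk; apply: contrapT => /forall2NP h.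
have bneg i : i != k -> b i < 0.
  by move=> ik; case: (h i) => // /negP; rewrite -leNgt le_eqVlt (negbTE (b0 i)).
have sum_k : b k = - \sum_(i | i != k) b i.
  by move: sb; rewrite (bigD1 k)//= => /eqP; rewrite addr_eq0 => /eqP.
have [j jk|none] := pickP [pred i | i != k]; last first.
  by move: bk; rewrite sum_k big_pred0 ?oppr0 ?ltxx.
have {}jk : j != k := jk.
have bj := bneg j jk.
pose r := b k + b j.
have rE : r = \sum_(i | (i != k) && (i != j)) - b i.
  by rewrite /r sum_k (bigD1 j)//= opprD addrAC addNr add0r sumrN.
have sum_p : b k *: p k = (- b j) *: p j + \sum_(i | (i != k) && (i != j)) (- b i) *: p i.
  move: sbp; rewrite (bigD1 k)//= (bigD1 j)//= => /eqP; rewrite addr_eq0 => /eqP ->.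
  rewrite opprD scaleNr -sumrN; congr (_ + _).
  by apply: eq_bigr => i _; rewrite scaleNr.
have r0 : 0 <= r.
  by rewrite rE sumr_ge0// => i /andP[ik _]; rewrite oppr_ge0 ltW// bneg.
have pkj : p k = p j -> False by move/pI => e; rewrite e eqxx in jk.
(* If [r = 0], only [k] and [j] carry nonzero coefficients, and [p k = p j]. Otherwise [y] is the
   weighted mean of the remaining points, and [p k] lies strictly between [p j] and [y]. *)
have [req|rn0] := eqVneq r 0.
  have rest i : (i != k) && (i != j) -> (- b i) = 0.
    move: (req); rewrite rE => /eqP; rewrite psumr_eq0; last first.
      by move=> i' /andP[ik _]; rewrite oppr_ge0 ltW// bneg.
    by move=> /allP/(_ i (mem_index_enum i))/implyP h' /h'/eqP.
  apply: pkj; apply: (scalerI (lt0r_neq0 bk)); rewrite sum_p big1 ?addr0.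
    by move/eqP: req; rewrite addr_eq0 => /eqP ->.
  by move=> i /rest ->; rewrite scale0r.
have rpos : 0 < r by rewrite lt_def rn0.
pose y := \sum_(i | (i != k) && (i != j)) (- b i / r) *: p i.
pose t := - b j / b k.
have t01 : 0 < t < 1.
  by rewrite divr_gt0 ?oppr_gt0//= ltr_pdivrMr// mul1r -subr_gt0 opprK.
have t1 : 1 - t = r / b k by rewrite /t /r; field; rewrite gt_eqF.
have yK : barycentric_hull p y.
  exists (fun i => if (i != k) && (i != j) then - b i / r else 0); split.
  - move=> i; case: ifP => // /andP[ik _].
    by rewrite divr_ge0 ?oppr_ge0// ltW// bneg.
  - by rewrite -big_mkcond/= -mulr_suml -rE divff.
  - rewrite /y big_mkcond/=; apply: eq_bigr => i _.
    by case: ifP => //; rewrite scale0r.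
have pkE : p k = t *: p j + (1 - t) *: y.
  apply: (scalerI (lt0r_neq0 bk)); rewrite sum_p scalerDr !scalerA t1; congr (_ + _).
    by rewrite /t mulrC divfK ?gt_eqF.
  rewrite mulrC divfK ?gt_eqF// /y scaler_sumr; apply: eq_bigr => i _.
  by rewrite scalerA mulrC divfK.
have [_ ext] := vp k.
have e := ext _ _ _ (barycentric_hull_vertex p j) yK t01 pkE.
by apply: pkj; rewrite pkE -e -scalerDl subrKC scale1r.
Qed.

(** * Polar coordinates and singular points *)

Lemma cos_eq1 (R : realType) (x : R) : cos x = 1 -> exists k : int, x = k%:~R * (2 * pi).
Proof.
have [k /andP[k1 k2]] := angle_window x 0; rewrite subr0 in k1 k2.
rewrite -(cos_shift x k) => c1; exists (- k); rewrite mulrNz.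
suff : x + k%:~R * (2 * pi) = 0 by move=> h; lra.
move: k1 k2 c1; move: (x + _) => y k1 k2 c1; have pi0 := @pi_gt0 R.
have [y0|y0] := leP 0 y.
  by apply: cos_inj; rewrite ?in_itv/= ?cos0//; lra.
apply: oppr_inj; rewrite oppr0.
by apply: cos_inj; rewrite ?in_itv/= ?cos0 ?cosN//; lra.
Qed.

Section Polar.
Variable R : realType.
Local Notation C := R[i].
Implicit Types (s t r : R) (z w : C).

Definition cis t : C := cos t +i* sin t.

Lemma cisD s t : cis (s + t) = cis s * cis t.
Proof. by rewrite /cis cosD sinD; apply/eqP; rewrite eq_complex/= addrC eqxx/= addrC eqxx. Qed.

Lemma cis0 : cis 0 = 1.
Proof. by rewrite /cis cos0 sin0. Qed.

Lemma cisNK t : cis (- t) * cis t = 1.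
Proof. by rewrite -cisD addNr cis0. Qed.

Lemma cis_neq0 t : cis t != 0.
Proof. by apply/eqP => h; have := cisNK t; rewrite h mulr0 => /esym/eqP; rewrite oner_eq0. Qed.

Lemma cisN t : cis (- t) = (cis t)^-1.
Proof. by apply: (mulIf (cis_neq0 t)); rewrite cisNK mulVf// cis_neq0. Qed.

Lemma norm_cis t : `|cis t| = 1.
Proof. by rewrite normc_def/= cos2Dsin2 sqrtr1. Qed.

Lemma cisX t (m : int) : cis t ^ m = cis (m%:~R * t).
Proof.
have H (k : nat) : cis t ^+ k = cis (k%:R * t).
  elim: k => [|k IH]; first by rewrite expr0 mul0r cis0.
  by rewrite exprS IH -cisD mulrS mulrDl mul1r.
case: m => k; first exact: H.
by rewrite NegzE -exprnN H mulrNz mulNr cisN.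
Qed.

Lemma cis_sum (I : finType) (t : I -> R) : cis (\sum_i t i) = \prod_i cis (t i).
Proof. by elim/big_rec2: _ => [|i y x _ <-]; rewrite ?cis0 ?cisD. Qed.

Lemma cis_inj s t : cis s = cis t <-> exists k : int, s = t + k%:~R * (2 * pi).
Proof.
split=> [[c e]|[k ->]]; last by rewrite /cis cos_shift sin_shift.
have [k h] : exists k : int, s - t = k%:~R * (2 * pi).
  by apply: cos_eq1; rewrite cosB c e -!expr2 cos2Dsin2.
by exists k; rewrite -h subrKC.
Qed.

Lemma polar z : exists t, z = `|z| * cis t.
Proof.
have [->|z0] := eqVneq z 0; first by exists 0; rewrite normr0 mul0r.
pose w := z / `|z|; have w1 : `|w| = 1 by rewrite normrM normfV normr_id divff ?normr_eq0.
suff [t wt] : exists t, w = cis t.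
  by exists t; rewrite -wt /w mulrC divfK// normr_eq0.
move: w1; case: w => x y; rewrite normc_def/= => -[]/eqP.
rewrite -sqrtr1 eqr_sqrt ?addr_ge0 ?sqr_ge0 ?ler01// => /eqP xy1.
have x1 : -1 <= x <= 1.
    rewrite -ler_norml -[_ <= _](@ler_pXn2r _ 2)// ?nnegrE// expr1n real_normK ?num_real//.
    by rewrite -xy1 lerDl sqr_ge0.
have y2 : y ^+ 2 = 1 - x ^+ 2 by rewrite -xy1 addrC addKr.
have [y0|y0] := leP 0 y.
  exists (acos x); rewrite /cis acosK ?in_itv//= sin_acos// -y2 sqrtr_sqr ger0_norm//.
exists (- acos x); rewrite /cis cosN sinN acosK ?in_itv//= sin_acos// -y2 sqrtr_sqr.
by rewrite ltr0_norm// opprK.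
Qed.

Lemma angle_of_eq s t : angle_of s = angle_of t <-> cis s = cis t.
Proof.
have pi2 : (2 * pi : R) != 0 by rewrite mulf_neq0 ?pnatr_eq0// gt_eqF// pi_gt0.
split=> [/eqmodP|/cis_inj[k ->]].
  move=> /intrP[k h]; apply/cis_inj; exists k; rewrite -h.
  by rewrite divfK// subrKC.
by apply/eqmodP; rewrite /= /angle_eqv addrC addKr mulfK// intr_int.
Qed.

Lemma arg_polar r t : 0 < r -> arg (r%:C * cis t) = angle_of t.
Proof.
move=> r0; have rC0 : r%:C != 0 by rewrite (inj_eq (@complexI R)) gt_eqF.
have nE : `|r%:C * cis t| = r%:C by rewrite normrM norm_cis mulr1 normc_def/= expr0n addr0 sqrtr_sqr gtr0_norm.
rewrite /arg; apply/angle_of_eq.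
have /= := @getPex _ [set s : R | r%:C * cis t = `|r%:C * cis t| * (cos s +i* sin s)].
by rewrite nE => /(_ (ex_intro _ t erefl))/(mulfI rC0).
Qed.

Lemma norm_pos z : z != 0 -> exists2 r, 0 < r & `|z| = r%:C.
Proof.
move=> z0; have := normr_gt0 z; rewrite z0 normc_def ltcR => h.
by eexists; first exact: h.
Qed.

Lemma argP z t : z != 0 -> (arg z = angle_of t <-> exists2 r, 0 < r & z = r%:C * cis t).
Proof.
move=> z0; split=> [|[r r0 ->]]; last exact: arg_polar.
have [r r0 rE] := norm_pos z0; have [s zs] := polar z.
rewrite zs rE arg_polar// => /angle_of_eq ->.
by exists r.
Qed.

Lemma lmonomial_polar n (e : 'rV[int]_n) (z : 'rV[C]_n) (r t : 'I_n -> R) :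
  (forall i, z 0 i = (r i)%:C * cis (t i)) -> (forall i, 0 < r i) ->
  lmonomial e z = (expR (\sum_i (e 0 i)%:~R * ln (r i)))%:C * cis (\sum_i (e 0 i)%:~R * t i).
Proof.
move=> zE r0.
have H (m : int) s : 0 < s -> (s%:C ^ m : C) = (expR (m%:~R * ln s))%:C.
  move=> s0; have Hn (k : nat) : (s%:C ^+ k : C) = (expR (k%:R * ln s))%:C.
    by rewrite -rmorphXn/= mulr_natl -lnXn// lnK// posrE exprn_gt0.
  case: m => k; first exact: Hn.
  by rewrite NegzE -exprnN Hn mulrNz mulNr expRN -fmorphV.
rewrite cis_sum expR_sum rmorph_prod -big_split/=.
by apply: eq_bigr => i _; rewrite zE expfzMl cisX H.
Qed.

Lemma lmonomial_neq0 n (e : 'rV[int]_n) (z : 'rV[C]_n) : nonvanishing z -> lmonomial e z != 0.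
Proof. by move=> z0; apply/prodf_neq0 => i _; rewrite expfz_neq0. Qed.

End Polar.

Section Singular.
Variables (R : realType) (n : nat) (a : 'I_n.+2 -> 'rV[int]_n).
Local Notation C := R[i].

Lemma lmonomialB (N : nat) (e : 'rV[int]_N) (z : 'rV[C]_N) i : nonvanishing z ->
  lmonomial (e - delta_mx 0 i) z = lmonomial e z / z 0 i.
Proof.
move=> z0; rewrite /lmonomial.
have -> : (z 0 i)^-1 = \prod_j (z 0 j) ^ (- (delta_mx 0 i : 'rV[int]_N) 0 j).
  rewrite (bigD1 i)//= mxE !eqxx big1 ?mulr1// => j /negbTE ji.
  by rewrite mxE ji andbF oppr0 expr0z.
by rewrite -big_split/=; apply: eq_bigr => j _; rewrite mxE expfzDr// mxE.
Qed.

(** Multiplied by [z_i], the i-th derivative is the sum of the terms weighted by the i-th exponents.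
    A singular point is therefore one where the terms form an affine relation of the exponents, and
    these relations are the multiples of [circuit_relation]. *)
Lemma singular_circuit_relation (f : 'rV[C]_n.+2) : affinely_generates a ->
  singular a f <-> exists z : 'rV[C]_n, nonvanishing z /\
    exists x : C, forall k, f 0 k * lmonomial (a k) z = x * (circuit_relation a k)%:~R.
Proof.
move=> gen.
have deriv z i : nonvanishing z ->
    lderiv a f i z = (\sum_k f 0 k * lmonomial (a k) z * (a k 0 i)%:~R) / z 0 i.
  move=> z0; rewrite /lderiv /leval mulr_suml; apply: eq_bigr => k _.
  by rewrite mxE lmonomialB//; ring.
split=> [[z [z0 fz dz]]|[z [z0 [x fx]]]]; exists z; split=> //.
- apply: (circuit_relation_unique gen fz) => i.
  have /eqP := dz i; by rewrite deriv// mulf_eq0 invr_eq0 (negbTE (z0 i)) orbF => /eqP.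
- have [b0 _] := sum_circuit_relation a.
  rewrite /leval; under eq_bigr do rewrite fx.
  by rewrite -mulr_sumr -rmorph_sum b0 rmorph0 mulr0.
- move=> i; rewrite deriv//; under eq_bigr do rewrite fx -mulrA -rmorphM.
  have [_ /rowP/(_ i)] := sum_circuit_relation a; rewrite summxE mxE => b0.
  rewrite -mulr_sumr -rmorph_sum.
  have -> : \sum_k circuit_relation a k * a k 0 i = 0.
    by rewrite -[RHS]b0; apply: eq_bigr => k _; rewrite mxE.
  by rewrite rmorph0 mulr0 mul0r.
Qed.

Lemma irreducible_mpolyX N (i : 'I_N) : irreducible_element (mpolyX C (mnm1 i) : mpoly N C).
Proof.
split.
  apply/negP => u; suff : (0 : C) \is a GRing.unit by rewrite unitr0.
  by rewrite -(mevalXU (fun _ => 0 : C) i); exact: rmorph_unit u.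
move=> q r qr.
have X0 : mpolyX C (mnm1 i) != 0.
  by apply/eqP => /(congr1 (meval (fun _ => 1 : C)))/eqP; rewrite mevalXU meval0 oner_eq0.
have q0 : q != 0 by apply: contra_neq X0 => q0; rewrite qr q0 mul0r.
have r0 : r != 0 by apply: contra_neq X0 => r0; rewrite qr r0 mulr0.
have := msizeM q0 r0; rewrite -qr msizeX mdeg1 => sz.
have q1 : (0 < msize q)%N by rewrite lt0n msize_poly_eq0.
have r1 : (0 < msize r)%N by rewrite lt0n msize_poly_eq0.
have unit (p : mpoly N C) : p != 0 -> (msize p <= 1)%N -> p \is a GRing.unit.
  move=> p0 /msize1_polyC pE; rewrite pE; apply: rmorph_unit; rewrite unitfE.
  by apply: contra_neq p0 => p0; rewrite pE p0 mpolyC0.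
have [h|h] : (msize q <= 1)%N \/ (msize r <= 1)%N by lia.
- by left; exact: unit.
- by right; exact: unit.
Qed.

(** If the coefficient at [k] were 0, the term [k] would vanish at a singular point, so no
    nonvanishing [f] would be singular. Every variable would then satisfy the defining property, but
    two distinct variables are not multiples of one polynomial. *)
Lemma circuit_relation_neq0 (Delta : mpoly n.+2 C) : affinely_generates a ->
  is_discriminant a Delta -> forall k, circuit_relation a k != 0.
Proof.
move=> gen [_ uniq] k; apply/eqP => bk.
have nonsing (f : 'rV[C]_n.+2) : nonvanishing f -> ~ singular a f.
  move=> f0 /(singular_circuit_relation _ gen)[z [z0 [x /(_ k)/eqP]]].
  by rewrite bk mulr0 mulf_eq0 (negbTE (f0 k)) (negbTE (lmonomial_neq0 _ z0)).
have irr i : irreducible_singular_equation a (mpolyX C (mnm1 i) : mpoly n.+2 C).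
  split; first exact: irreducible_mpolyX.
  move=> f f0; rewrite mevalXU; split=> [h|/(nonsing _ f0)//].
  by have := f0 i; rewrite h eqxx.
pose e (i : 'I_n.+2) : 'I_n.+2 -> C := fun j => (i == j)%:R.
have [c cE] := uniq _ (irr ord0); have [d dE] := uniq _ (irr (lift ord0 ord0)).
have := congr1 (meval (e (lift ord0 ord0))) dE; rewrite mevalXU mevalZ /e eqxx => de.
have := congr1 (meval (e (lift ord0 ord0))) cE; rewrite mevalXU mevalZ /e => /esym/eqP.
rewrite [lift _ _ == _]eq_sym (negbTE (neq_lift _ _)) mulf_eq0 => /orP[/eqP c0|/eqP h]; last first.
  by move/eqP: de; rewrite h mulr0 oner_eq0.
move: cE; rewrite c0 scale0r => /(congr1 (meval (e ord0)))/eqP.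
by rewrite mevalXU meval0 /e eqxx oner_eq0.
Qed.

End Singular.

(** * Components of the complement of the closed coamoeba *)

Lemma continuous_matrix (X T : topologicalType) m n (f : X -> 'M[T]_(m, n)) x :
  (forall i j, {for x, continuous (fun y => f y i j)}) -> {for x, continuous f}.
Proof.
move=> cf A [P fP PA].
suff : \forall y \near x, forall i j, P i j (f y i j) by apply: filterS => y h; exact: PA.
apply: filter_forall => i; apply: filter_forall => j.
exact: cf (fP i j).
Qed.

Lemma continuous_coord (T : topologicalType) m n i j : continuous (fun M : 'M[T]_(m, n) => M i j).
Proof.
move=> M A MA; exists (fun i' j' => if (i' == i) && (j' == j) then A else setT).
  by move=> i' j'; case: ifPn => [/andP[/eqP-> /eqP->]//|_]; exact: filterT.
by move=> N /(_ i j); rewrite !eqxx.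
Qed.

Lemma row_cube_nbhs (R : realType) n (t : 'rV[R]_n) (e : R) : 0 < e ->
  nbhs t [set s : 'rV[R]_n | forall i, `|s 0 i - t 0 i| < e].
Proof.
move=> e0; exists (fun i j => ball (t i j) e); first by move=> i j; exact: nbhsx_ballx.
by move=> s st i; have := st 0 i; rewrite /ball/= distrC.
Qed.

Lemma nbhs_row_cube (R : realType) n (t : 'rV[R]_n) A : nbhs t A ->
  exists2 e : R, 0 < e & forall s : 'rV[R]_n, (forall i, `|s 0 i - t 0 i| < e) -> A s.
Proof.
move=> [P tP PA].
have : \forall e \near (0 : R)^'+, forall i j, ball (t i j) e `<=` P i j.
  apply: filter_forall => i; apply: filter_forall => j.
  have /nbhs_ballP[e e0 eP] := tP i j.
  near=> d => u ud; apply: eP; apply: le_ball ud.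
  by near: d; exact: nbhs_right_le.
move=> h; have [e [e0 eP]] := @filter_ex _ (0 : R)^'+ _ _ (filterI (nbhs_right_gt (0 : R)) h).
exists e => // s st; apply: PA => i j; apply: eP.
by rewrite !ord1 /ball/= distrC.
Unshelve. all: by end_near. Qed.

(** * The torus as a quotient of the row vectors *)

Section Torus.
Variables (R : realType) (n : nat).
Implicit Types (s t : 'rV[R]_n).

Definition torus_of t : 'rV[angle R]_n := map_mx (@angle_of R) t.

Lemma torus_of_surjective (x : 'rV[angle R]_n) : exists t, torus_of t = x.
Proof.
exists (map_mx (fun u : angle R => repr u) x); apply/rowP => i; rewrite !mxE.
exact: reprK.
Qed.

Lemma torus_of_eq s t : torus_of s = torus_of t <->
  exists w : 'rV[int]_n, forall i, s 0 i = t 0 i + (w 0 i)%:~R * (2 * pi).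
Proof.
split=> [/rowP st|[w st]]; last first.
  by apply/rowP => i; rewrite !mxE; apply/angle_of_eq/cis_inj; exists (w 0 i).
have ch i : {k : int | s 0 i = t 0 i + k%:~R * (2 * pi)}.
  by apply: cid; apply/cis_inj/angle_of_eq; have := st i; rewrite !mxE.
by exists (\row_i sval (ch i)) => i; rewrite mxE; exact: svalP (ch i).
Qed.

Lemma torus_of_continuous : continuous torus_of.
Proof.
move=> t; apply: continuous_matrix => i j.
have -> : (fun u : 'rV[R]_n => torus_of u i j) = (fun u => angle_of (u i j)).
  by apply/funext => u; rewrite mxE.
apply: (@continuous_comp _ _ _ (fun u : 'rV[R]_n => u i j) (@angle_of R)).
  exact: continuous_coord.
exact: pi_continuous.
Qed.

(** The preimage of the image is the union of the translates of [A] by multiples of [2 pi]. *)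
Lemma angle_of_open (A : set R) : open A -> open (@angle_of R @` A).
Proof.
move=> oA; rewrite /open/= /quotient_open.
have -> : \pi_(angle R)%qT @^-1` (@angle_of R @` A) =
    \bigcup_(k in [set: int]) [set t : R | A (t - k%:~R * (2 * pi))].
  apply/seteqP; split=> t.
    move=> [u Au ut]; have /angle_of_eq/cis_inj[k uk] : angle_of u = angle_of t := ut.
    by exists (- k) => //=; rewrite mulrNz mulNr opprK -uk.
  move=> [k _ Ak]; exists (t - k%:~R * (2 * pi)) => //.
  by apply/angle_of_eq/cis_inj; exists (- k); rewrite mulrNz mulNr.
apply: bigcup_open => k _; apply: open_comp oA => u _.
by apply: cvgB; [exact: cvg_id|exact: cvg_cst].
Qed.

Lemma torus_of_open (A : set 'rV[R]_n) : open A -> open (torus_of @` A).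
Proof.
move=> oA; rewrite openE => _ [t At <-].
have [P tP PA] : nbhs t A by exact: open_nbhs_nbhs.
exists (fun i j => @angle_of R @` (P i j)°).
  move=> i j; apply: open_nbhs_nbhs; split.
    by apply: angle_of_open; exact: open_interior.
  by exists (t i j); [exact: nbhs_singleton (nbhs_interior (tP i j))|rewrite mxE].
move=> x xP.
have ch i : {u : R | P 0 i u & angle_of u = x 0 i}.
  apply: cid2; have [u /interior_subset Pu ux] := xP 0 i; by exists u.
exists (\row_i s2val (ch i)).
  by apply: PA => i j; rewrite !ord1 mxE; exact: s2valP (ch j).
by apply/rowP => i; rewrite !mxE; exact: s2valP' (ch i).
Qed.

End Torus.

(** * Arguments of the terms, and the sheets over the complement *)

Section CoamoebaArguments.
Variables (R : realType) (n : nat) (a : 'I_n.+2 -> 'rV[int]_n) (f : 'rV[R[i]]_n.+2).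
Variables (rho alpha : 'I_n.+2 -> R).
Hypothesis rho_gt0 : forall k, 0 < rho k.
Hypothesis fE : forall k, f 0 k = (rho k)%:C * cis (alpha k).
Hypothesis gen : affinely_generates a.

Definition real_relation (k : 'I_n.+2) : R := (circuit_relation a k)%:~R.
Local Notation b := real_relation.

Definition dotz (k : 'I_n.+2) (t : 'rV[R]_n) : R := \sum_i (a k 0 i)%:~R * t 0 i.

Definition term_arg (t : 'rV[R]_n) (k : 'I_n.+2) : R := alpha k + dotz k t.
Local Notation phi := term_arg.

Definition log_modulus : R := \sum_k b k * ln (rho k).
Local Notation c := log_modulus.

Lemma dotzD k s t : dotz k (s + t) = dotz k s + dotz k t.
Proof. by rewrite /dotz -big_split/=; apply: eq_bigr => i _; rewrite mxE mulrDr. Qed.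

Lemma dotzZ k x t : dotz k (x *: t) = x * dotz k t.
Proof. by rewrite /dotz mulr_sumr; apply: eq_bigr => i _; rewrite mxE mulrCA. Qed.

Lemma sum_real_relation : \sum_k b k = 0.
Proof. by have [b0 _] := sum_circuit_relation a; rewrite -rmorph_sum b0 rmorph0. Qed.

Lemma sum_relation_dotz t : \sum_k b k * dotz k t = 0.
Proof.
under eq_bigr do rewrite mulr_sumr; rewrite exchange_big big1//= => i _.
have [_ /rowP/(_ i)] := sum_circuit_relation a; rewrite summxE mxE => ba.
under eq_bigr do rewrite mulrA -rmorphM; rewrite -mulr_suml -rmorph_sum.
have -> : \sum_k circuit_relation a k * a k 0 i = 0.
  by rewrite -[RHS]ba; apply: eq_bigr => k _; rewrite mxE.
by rewrite rmorph0 mul0r.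
Qed.

Lemma sum_relation_term_arg t : \sum_k b k * phi t k = \sum_k b k * alpha k.
Proof.
under eq_bigr do rewrite mulrDr; rewrite big_split/= sum_relation_dotz.
by rewrite addr0.
Qed.

Lemma sum_cis0 (I : finType) (t u : I -> R) :
  \sum_i (t i)%:C * cis (u i) = 0 <-> balanced u t.
Proof.
have -> : \sum_i (t i)%:C * cis (u i) = (\sum_i t i * cos (u i)) +i* (\sum_i t i * sin (u i)).
  elim/big_rec3: _ => [//|i y1 y2 y3 _ ->].
  by apply/eqP; rewrite /cis eq_complex/= !mul0r subr0 addr0 !eqxx.
split=> [/eqP|[-> ->]//].
by rewrite eq_complex/= => /andP[/eqP ? /eqP ?].
Qed.

Lemma leval_polar (z : 'rV[R[i]]_n) (r t : 'rV[R]_n) :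
  (forall i, z 0 i = (r 0 i)%:C * cis (t 0 i)) -> (forall i, 0 < r 0 i) ->
  leval a f z = \sum_k (rho k * expR (\sum_i (a k 0 i)%:~R * ln (r 0 i)))%:C * cis (phi t k).
Proof.
move=> zE r0; rewrite /leval; apply: eq_bigr => k _.
rewrite fE (lmonomial_polar (a k) zE r0) cisD rmorphM/=.
by rewrite mulrACA.
Qed.

(** Given a solution [m], the numbers [ln (m k) - ln (rho k)] are orthogonal to [b], hence of the
    form [x] plus the pairing of [a k] with [y]. The moduli [e^y] then give the terms the moduli
    [m], up to the common factor [e^(-x)]. *)
Lemma coamoeba_in_coamoeba t :
  coamoeba (leval a f) (torus_of t) <-> in_coamoeba b c (phi t).
Proof.
split=> [[z [z0 fz zt]]|[m [m0 bal mc]]].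
  have ch i : {r : R | 0 < r & z 0 i = r%:C * cis (t 0 i)}.
    apply: cid2; apply/argP; first exact: z0.
    by move/rowP/(_ i): zt; rewrite !mxE.
  pose r : 'rV[R]_n := \row_i s2val (ch i).
  have r0 i : 0 < r 0 i by rewrite mxE; exact: s2valP (ch i).
  have zE i : z 0 i = (r 0 i)%:C * cis (t 0 i) by rewrite mxE; exact: s2valP' (ch i).
  exists (fun k => rho k * expR (\sum_i (a k 0 i)%:~R * ln (r 0 i))); split.
  - by move=> k; rewrite mulr_gt0 ?expR_gt0.
  - by apply/sum_cis0; rewrite -(leval_polar zE r0).
  - rewrite /balance_value.
    under eq_bigr => k _ do rewrite lnM ?posrE ?expR_gt0// expRK mulrDr.
    rewrite big_split/= -[RHS]addr0; congr (_ + _).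
    have := sum_relation_dotz (\row_i ln (r 0 i)); rewrite /dotz => h.
    rewrite -[RHS]h; apply: eq_bigr => k _; congr (_ * _).
    by apply: eq_bigr => i _; rewrite mxE.
have [x [y my]] : exists (x : R) (y : 'rV[R]_n),
    forall k, ln (m k) - ln (rho k) = x + \sum_i (a k 0 i)%:~R * y 0 i.
  apply: (circuit_relation_orthogonal gen).
  transitivity (balance_value b m - c); last by rewrite mc subrr.
  by rewrite -sumrB; apply: eq_bigr => k _; rewrite mulrBr.
pose r : 'rV[R]_n := \row_i expR (y 0 i).
pose z : 'rV[R[i]]_n := \row_i ((r 0 i)%:C * cis (t 0 i)).
have r0 i : 0 < r 0 i by rewrite mxE expR_gt0.
have zE i : z 0 i = (r 0 i)%:C * cis (t 0 i) by rewrite mxE.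
exists z; last by apply/rowP => i; rewrite [LHS]mxE zE arg_polar// mxE.
split.
  move=> i; rewrite zE mulf_neq0 ?cis_neq0//.
  by rewrite (inj_eq (@complexI R)) gt_eqF.
rewrite (leval_polar zE r0) (eq_bigr (fun k => (expR (- x))%:C * ((m k)%:C * cis (phi t k)))).
  by rewrite -mulr_sumr (sum_cis0 m (phi t)).2// mulr0.
move=> k _; rewrite mulrA -rmorphM; congr (_%:C * _).
have -> : \sum_i (a k 0 i)%:~R * ln (r 0 i) = ln (m k) - ln (rho k) - x.
  by rewrite my addrC addKr; apply: eq_bigr => i _; rewrite mxE expRK.
rewrite !expRD expRN lnK ?posrE// lnK ?posrE//.
by rewrite mulrCA !mulrA mulfVK ?gt_eqF// mulrC.
Qed.

Lemma small_linear (I J : finType) (A : I -> J -> R) (e : R) : 0 < e ->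
  exists2 d : R, 0 < d & forall y : J -> R, (forall j, `|y j| < d) ->
    forall i, `|\sum_j A i j * y j| < e.
Proof.
move=> e0; pose K := 1 + \sum_i \sum_j `|A i j|.
have K0 : 0 < K by rewrite ltr_pwDl// sumr_ge0// => i _; rewrite sumr_ge0.
exists (e / K); first by rewrite divr_gt0.
move=> y yd i; apply: (@le_lt_trans _ _ (\sum_j `|A i j| * (e / K))).
  apply: (le_trans (ler_norm_sum _ _ _)); apply: ler_sum => j _.
  by rewrite normrM ler_wpM2l// ltW.
rewrite -mulr_suml mulrCA gtr_pMr// ltr_pdivrMr// mul1r.
apply: (@le_lt_trans _ _ (\sum_i \sum_j `|A i j|)); last by rewrite ltrDr.
by rewrite [leRHS](bigD1 i)//= lerDl sumr_ge0// => k _; rewrite sumr_ge0.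
Qed.

Lemma in_coamoeba_term_arg t y x d : (forall k, d k = x + dotz k y) ->
  in_coamoeba b c (phi t \+ d) <-> in_coamoeba b c (phi (t + y)).
Proof.
move=> dE; split.
- apply: (@in_coamoeba_congr _ _ _ _ _ _ (fun=> 0) (- x)) => k.
  by rewrite /= dE /term_arg dotzD mul0r; ring.
- apply: (@in_coamoeba_congr _ _ _ _ _ _ (fun=> 0) x) => k.
  by rewrite /= dE /term_arg dotzD mul0r; ring.
Qed.

(** [torus_of] is continuous and open, so closeness in the torus can be tested by small moves of
    [t]; up to a common shift these are the small displacements of the arguments orthogonal to
    [b]. *)
Lemma complement_closure_coamoeba t :
  (~` closure (coamoeba (leval a f))) (torus_of t) <-> off_coamoeba b c (phi t).
Proof.
split=> [h|[e e0 h]].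
  have : nbhs t (@torus_of R n @^-1` (~` closure (coamoeba (leval a f)))).
    apply: torus_of_continuous; apply: open_nbhs_nbhs; split=> //.
    by apply: closed_openC; exact: closed_closure.
  move=> /nbhs_row_cube[e e0 eC].
  have [X [Y dE]] := circuit_relation_coordinates gen.
  have [r r0 rY] := small_linear (fun i j => (Y i j)%:~R : R) e0.
  exists r => // d dr bd cd; pose y : 'rV[R]_n := \row_i \sum_j (Y i j)%:~R * d j.
  have : in_coamoeba b c (phi (t + y)).
    have dy k : d k = \sum_j (X j)%:~R * d j + dotz k y.
      rewrite [LHS](dE _ _ bd k); congr (_ + _); apply: eq_bigr => i _.
      by rewrite mxE.
    exact: (in_coamoeba_term_arg t dy).1 cd.
  move/coamoeba_in_coamoeba/subset_closure; apply: eC => i.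
  by rewrite mxE addrAC subrr add0r mxE; exact: rY.
move=> /= cl; have [r r0 ra] := small_linear (fun k i => (a k 0 i)%:~R : R) e0.
have nb : nbhs (torus_of t) (@torus_of R n @` [set s : 'rV[R]_n | forall i, `|s 0 i - t 0 i| < r]°).
  apply: open_nbhs_nbhs; split; first by apply: torus_of_open; exact: open_interior.
  by exists t => //; apply: nbhs_singleton; apply: nbhs_interior; exact: row_cube_nbhs.
have [x [Cx [s /interior_subset sr sx]]] := cl _ nb.
apply: (h (fun k => dotz k (s - t))) => [k||].
- by apply: (ra (fun i => (s - t) 0 i)) => i; rewrite !mxE; exact: sr.
- exact: sum_relation_dotz.
- have d0 k : dotz k (s - t) = 0 + dotz k (s - t) by rewrite add0r.
  apply/(in_coamoeba_term_arg t d0).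
  by rewrite subrKC; apply/coamoeba_in_coamoeba; rewrite sx.
Qed.

Hypothesis b0 : forall k, b k != 0.
Variable v : 'I_n.+2 -> int.
Hypothesis bv : \sum_k circuit_relation a k * v k = 1.

Definition linked (w : 'I_n.+2 -> R) := forall p m, 0 < b p -> b m < 0 -> `|w p - w m| < pi.

Definition lopsided (w : 'I_n.+2 -> R) := forall i j, `|w i - w j| < pi.

(* The arguments of the terms, lifted so that their sum weighted by b is
   m turns away from that of alpha. *)
Definition sheet_arg (m : int) t k := phi t k + (m * v k)%:~R * (2 * pi).

Definition relation_arg := \sum_k b k * alpha k.

Definition positive_mass := \sum_(k | 0 < b k) b k.

Lemma sum_sheet_arg m t : \sum_k b k * sheet_arg m t k = relation_arg + m%:~R * (2 * pi).
Proof.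
under eq_bigr do rewrite mulrDr; rewrite big_split/= sum_relation_term_arg; congr (_ + _).
rewrite -[m in RHS]mulr1 -bv mulr_sumr rmorph_sum mulr_suml; apply: eq_bigr => k _.
by rewrite /real_relation !rmorphM/=; ring.
Qed.

Lemma sheet_argD m t y k : sheet_arg m (t + y) k = sheet_arg m t k + dotz k y.
Proof. by rewrite /sheet_arg /term_arg dotzD; ring. Qed.

Lemma off_sheet_arg m t : off_coamoeba b c (phi t) <-> off_coamoeba b c (sheet_arg m t).
Proof.
split.
- apply: (@off_coamoeba_congr _ _ _ _ _ _ (fun k => m * v k) 0) => k.
  by rewrite addr0.
- apply: (@off_coamoeba_congr _ _ _ _ _ _ (fun k => - (m * v k)) 0) => k.
  by rewrite addr0 /sheet_arg rmorphN/= mulNr addrK.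
Qed.

Lemma real_relation_orthogonal d : \sum_k b k * d k = 0 ->
  exists (x : R) (y : 'rV[R]_n), forall k, d k = x + dotz k y.
Proof. by move=> bd; exact: (circuit_relation_orthogonal gen bd). Qed.

(** At a singular point the arguments of the terms are, up to a common shift, those of the [b k]: 0
    or [pi]. Pairing with [b] kills the shift and leaves [- pi] times the positive mass. *)
Lemma discriminant_coamoeba (Delta : mpoly n.+2 R[i]) : is_discriminant a Delta ->
  coamoeba (fun g => meval (g 0) Delta) (Arg f) <->
  exists m : int, relation_arg + pi * positive_mass = m%:~R * (2 * pi).
Proof.
move=> [[_ sing] _].
have f0 k : f 0 k != 0.
  by rewrite fE mulf_neq0 ?cis_neq0// (inj_eq (@complexI R)) gt_eqF.
have cis_pi : cis (pi : R) = -1.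
  by apply/eqP; rewrite /cis cospi sinpi eq_complex/= oppr0 !eqxx.
have cisE k (x : R) : cis (x + (if b k < 0 then pi else 0)) * (`|b k|)%:C = cis x * (b k)%:C.
  case: ltP => bk; last by rewrite addr0 ger0_norm.
  by rewrite ltr0_norm// cisD cis_pi rmorphN/= mulrN1 mulrNN.
have sum_flip : \sum_k b k * (if b k < 0 then pi else 0) = - (pi * positive_mass).
  rewrite /positive_mass -(neg_mass b0 sum_real_relation) mulr_sumr -sumrN [RHS]big_mkcond/=.
  by apply: eq_bigr => k _; case: ifP => _; ring.
split=> [[g [g0 /(sing _ g0)/(singular_circuit_relation _ gen)[z [z0 [x gx]]]] argg]|[m mE]].
  have gE k : exists2 r : R, 0 < r & g 0 k = r%:C * cis (alpha k).
    apply/argP; first exact: g0.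
    by move/rowP/(_ k): argg; rewrite !mxE fE arg_polar.
  have zE i : {rt : R * R | 0 < rt.1 & z 0 i = (rt.1)%:C * cis rt.2}.
    apply: cid2; have [r r0 zr] := norm_pos (z0 i); have [t zt] := polar (z 0 i).
    by exists (r, t) => //=; rewrite zt zr.
  pose rz i := (s2val (zE i)).1; pose tz : 'rV[R]_n := \row_i (s2val (zE i)).2.
  have rz0 i : 0 < rz i := s2valP (zE i).
  have zP i : z 0 i = (rz i)%:C * cis (tz 0 i) by rewrite mxE; exact: s2valP' (zE i).
  have x0 : x != 0.
    apply: contraTneq (mulf_neq0 (g0 ord0) (lmonomial_neq0 (a ord0) z0)) => x0.
    by rewrite gx x0 mul0r eqxx.
  have [rx rx0 xr] := norm_pos x0; have [xi xE] := polar x.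
  have argk k : exists q : int,
      phi tz k = xi + (if b k < 0 then pi else 0) + q%:~R * (2 * pi).
    apply/cis_inj; have [r r0 gk] := gE k; have := gx k.
    rewrite gk (lmonomial_polar (a k) zP rz0) xE xr mulrACA -cisD -rmorphM => e.
    have {}e : (r * expR (\sum_i (a k 0 i)%:~R * ln (rz i)))%:C * cis (phi tz k) =
        (rx * `|b k|)%:C * cis (xi + (if b k < 0 then pi else 0)).
      transitivity (rx%:C * cis xi * (circuit_relation a k)%:~R); first exact: e.
      have -> : (rx * `|b k|)%:C = rx%:C * (`|b k|)%:C by rewrite rmorphM.
      rewrite -[RHS]mulrA [X in _ = _ * X]mulrC cisE mulrA; congr (_ * _).
      by rewrite /real_relation rmorph_int.
    have pos1 : 0 < r * expR (\sum_i (a k 0 i)%:~R * ln (rz i)) by rewrite mulr_gt0 ?expR_gt0.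
    have pos2 : 0 < rx * `|b k| by rewrite mulr_gt0 ?normr_gt0.
    by apply/angle_of_eq; rewrite -(arg_polar _ pos1) e arg_polar.
  have [q qE] := choice argk.
  exists (\sum_k circuit_relation a k * q k).
  rewrite /relation_arg -(sum_relation_term_arg tz).
  rewrite (eq_bigr (fun k => b k * xi + b k * (if b k < 0 then pi else 0) +
      (circuit_relation a k * q k)%:~R * (2 * pi))); last first.
    by move=> k _; rewrite qE rmorphM/= /real_relation; ring.
  rewrite !big_split/= sum_flip -mulr_suml sum_real_relation mul0r add0r addrAC addNr add0r.
  by rewrite -mulr_suml -rmorph_sum.
(* Conversely, the congruence makes these numbers orthogonal to [b], where [m v] absorbs the
   multiple of [2 pi]; so a point of arguments [- y] corrects the arguments of all terms. The moduli
   are free: [|b k|] for [g] and 1 for the point. *)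
have [x [y xy]] : exists (x : R) (y : 'rV[R]_n), forall k,
    alpha k - (if b k < 0 then pi else 0) - (m * v k)%:~R * (2 * pi) = x + dotz k y.
  apply: real_relation_orthogonal.
  under eq_bigr do rewrite !mulrBr; rewrite !sumrB sum_flip opprK -/relation_arg mE.
  apply/eqP; rewrite subr_eq0; apply/eqP.
  rewrite -[m in LHS]mulr1 -bv mulr_sumr rmorph_sum mulr_suml; apply: eq_bigr => k _.
  by rewrite /real_relation !rmorphM/=; ring.
pose g : 'rV[R[i]]_n.+2 := \row_k ((`|b k|)%:C * cis (alpha k)).
have bk0 k : 0 < `|b k| by rewrite normr_gt0.
have g0 : nonvanishing g.
  by move=> k; rewrite mxE mulf_neq0 ?cis_neq0// (inj_eq (@complexI R)) gt_eqF.
exists g; last by apply/rowP => k; rewrite !mxE fE !arg_polar.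
split=> //; apply/(sing _ g0)/(singular_circuit_relation _ gen).
pose z : 'rV[R[i]]_n := \row_i (1%:C * cis ((- y) 0 i)).
have zE i : z 0 i = 1%:C * cis ((- y) 0 i) by rewrite mxE.
exists z; split; first by move=> i; rewrite zE mul1r cis_neq0.
exists (cis x) => k; rewrite (lmonomial_polar (a k) zE (fun=> ltr01)).
rewrite big1 ?expR0 ?mul1r => [|i _]; last by rewrite ln1 mulr0.
rewrite mxE -mulrA -cisD.
have -> : alpha k + \sum_i (a k 0 i)%:~R * (- y) 0 i =
    x + (if b k < 0 then pi else 0) + (m * v k)%:~R * (2 * pi).
  have -> : \sum_i (a k 0 i)%:~R * (- y) 0 i = - dotz k y.
    by rewrite -sumrN; apply: eq_bigr => i _; rewrite mxE mulrN.
  have -> : dotz k y = alpha k - (if b k < 0 then pi else 0) - (m * v k)%:~R * (2 * pi) - x.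
    by rewrite xy addrC addKr.
  by ring.
rewrite mulrC; have -> : cis (x + (if b k < 0 then pi else 0) + (m * v k)%:~R * (2 * pi)) =
    cis (x + (if b k < 0 then pi else 0)) by apply/cis_inj; exists (m * v k).
by rewrite cisE; congr (_ * _); rewrite /real_relation rmorph_int.
Qed.

Variables (p1 p2 n1 n2 : 'I_n.+2).
Hypotheses (bp1 : 0 < b p1) (bp2 : 0 < b p2) (bn1 : b n1 < 0) (bn2 : b n2 < 0).
Hypotheses (p12 : p1 != p2) (n12 : n1 != n2).

Let S := ~` closure (coamoeba (leval a f)).
Local Notation T := (@torus_of R n).

(** The integer lifts [q] determine [m] by pairing with [b]. Then [q - m v] is orthogonal to [b], so
    it is the effect of an integral translation [w] of [t], up to a common integer. *)
Lemma sheet_cover t : off_coamoeba b c (phi t) -> exists (m : int) (t' : 'rV[R]_n),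
  [/\ T t' = T t, linked (sheet_arg m t') & `|relation_arg + m%:~R * (2 * pi)| < pi * positive_mass].
Proof.
move=> off; have [q qE] := off_coamoeba_lift bp1 bp2 bn1 bn2 p12 n12 off.
pose m := \sum_k circuit_relation a k * q k.
have [x [w xw]] : exists (x : int) (w : 'rV[int]_n),
    forall k, q k - m * v k = x + \sum_i (a k 0 i)%:~R * w 0 i.
  apply: (circuit_relation_orthogonal gen).
  under eq_bigr do rewrite intz mulrBr mulrCA; rewrite sumrB -mulr_sumr bv mulr1.
  by rewrite /m subrr.
pose t' : 'rV[R]_n := \row_i (t 0 i + (w 0 i)%:~R * (2 * pi)).
have tE k : sheet_arg m t' k = phi t k + (q k)%:~R * (2 * pi) - x%:~R * (2 * pi).
  have -> : q k = x + \sum_i (a k 0 i)%:~R * w 0 i + m * v k by rewrite -xw subrK.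
  rewrite /sheet_arg; have -> : phi t' k = phi t k + (\sum_i (a k 0 i)%:~R * w 0 i)%:~R * (2 * pi).
    rewrite /term_arg -addrA; congr (_ + _).
    rewrite rmorph_sum mulr_suml -big_split/=; apply: eq_bigr => i _.
    by rewrite mxE mulrDr rmorphM/= intz mulrA.
  by rewrite !rmorphD/=; ring.
have lt' : linked (sheet_arg m t').
  move=> p l bp bl; rewrite !tE; have := qE p l bp bl.
  by congr (`|_| < _); ring.
exists m, t'; split => //.
  by apply/torus_of_eq; exists w => i; rewrite mxE.
by rewrite -(sum_sheet_arg m t'); exact: linked_sum_lt bp1 bn1 b0 sum_real_relation _ lt'.
Qed.

(** [center] and the sheet have the same weighted sum, so a translation of [t] carries one to the
    other up to a common shift. *)
Lemma sheet_center (m : int) : `|relation_arg + m%:~R * (2 * pi)| < pi * positive_mass ->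
  exists t, lopsided (sheet_arg m t).
Proof.
set x := relation_arg + _ => xV.
have [y [t ty]] : exists (y : R) (t : 'rV[R]_n),
    forall k, center b x k - sheet_arg m 0 k = y + dotz k t.
  apply: real_relation_orthogonal; under eq_bigr do rewrite mulrBr.
  by rewrite sumrB (center_sum bp1 b0) sum_sheet_arg subrr.
exists t => i j.
have E k : sheet_arg m t k = center b x k - y.
  by rewrite -[t]add0r sheet_argD -[center b x k](subrK (sheet_arg m 0 k)) ty; ring.
rewrite !E opprB addrA subrK.
exact: (center_lopsided bp1).
Qed.

Lemma lopsided_linked w : lopsided w -> linked w.
Proof. by move=> h p m _ _. Qed.

Lemma lopsided_off m t : lopsided (sheet_arg m t) -> off_coamoeba b c (phi t).
Proof. by move=> h; apply/(off_sheet_arg m); exact: (off_coamoeba_lopsided bp1 bn1). Qed.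

Lemma segment_component t y :
  (forall s, 0 <= s <= 1 -> off_coamoeba b c (phi (t + s *: y))) ->
  connected_component S (T t) (T (t + y)).
Proof.
move=> off; pose g (s : R) := T (t + s *: y).
have -> : T t = g 0 by rewrite /g scale0r addr0.
have -> : T (t + y) = g 1 by rewrite /g scale1r.
apply: (@connected_component_max _ S (g @` `[0, 1])).
- by exists 0 => //=; rewrite in_itv/= lexx ler01.
- by move=> _ [s s01 <-]; apply/complement_closure_coamoeba/off; rewrite /= in_itv/= in s01.
- apply: connected_continuous_connected; first exact: segment_connected.
  apply: continuous_subspaceT => s; apply: (@continuous_comp _ _ _ (fun s : R => t + s *: y) T).
    apply: continuous_matrix => i j.
    have -> : (fun s : R => (t + s *: y) i j) = (fun s => t i j + s * y i j).
      by apply/funext => r; rewrite !mxE.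
    by apply: cvgD; [exact: cvg_cst|apply: cvgMl; exact: cvg_id].
  exact: torus_of_continuous.
- by exists 1 => //=; rewrite in_itv/= lexx ler01.
Qed.

Lemma lopsided_component m s t : lopsided (sheet_arg m s) -> lopsided (sheet_arg m t) ->
  connected_component S (T s) (T t).
Proof.
move=> ls lt; rewrite -[t](subrKC s); apply: segment_component => r /andP[r0 r1].
apply: (@lopsided_off m) => i j; rewrite !sheet_argD !dotzZ.
have E k : dotz k (t - s) = sheet_arg m t k - sheet_arg m s k.
  by rewrite -[t in RHS](subrKC s) sheet_argD addrAC subrr add0r.
have -> : sheet_arg m s i + r * dotz i (t - s) - (sheet_arg m s j + r * dotz j (t - s)) =
    (1 - r) * (sheet_arg m s i - sheet_arg m s j) + r * (sheet_arg m t i - sheet_arg m t j).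
  by rewrite !E; ring.
apply: (le_lt_trans (ler_normD _ _)); rewrite !normrM (ger0_norm r0) ger0_norm ?subr_ge0//.
have [->|rn0] := eqVneq r 0; first by rewrite subr0 mul1r mul0r addr0 ls.
have -> : pi = (1 - r) * pi + r * pi :> R by rewrite -mulrDl subrK mul1r.
apply: ler_ltD; first by rewrite ler_wpM2l ?subr_ge0// ltW.
by rewrite ltr_pM2l; [exact: lt|rewrite lt_def rn0].
Qed.

Lemma sheet_to_lopsided m t : off_coamoeba b c (phi t) -> linked (sheet_arg m t) ->
  exists2 s, lopsided (sheet_arg m s) & connected_component S (T t) (T s).
Proof.
move=> /(off_sheet_arg m) off lt.
have [d [bd offd lop]] := off_coamoeba_path bp1 bp2 bn1 bn2 p12 n12 b0 sum_real_relation off lt.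
have [x [y dE]] := real_relation_orthogonal bd.
exists (t + y).
  move=> i j; have := lop i j; rewrite !dE !sheet_argD.
  by congr (`|_| < _); ring.
apply: segment_component => s s01; apply/(off_sheet_arg m).
apply: (@off_coamoeba_congr _ _ _ _ _ _ (fun=> 0) (- (s * x)) _ (offd s s01)) => k.
by rewrite dE sheet_argD dotzZ; ring.
Qed.

(** Two lifts of one point differ by [q k] turns. Differences between opposite signs are below [pi]
    in both lifts, so [q] agrees on indices of opposite signs and is constant; its pairing with [b],
    which equals [m - m'], is then 0. *)
Lemma linked_sheet_unique m m' s t : linked (sheet_arg m s) -> linked (sheet_arg m' t) ->
  T s = T t -> m = m'.
Proof.
move=> ls lt /torus_of_eq[w st].
pose q k : int := \sum_i a k 0 i * w 0 i + (m - m') * v k.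
have qE k : sheet_arg m s k = sheet_arg m' t k + (q k)%:~R * (2 * pi).
  have -> : sheet_arg m s k = phi t k + (\sum_i a k 0 i * w 0 i)%:~R * (2 * pi) + (m * v k)%:~R * (2 * pi).
    rewrite /sheet_arg /term_arg -!addrA; congr (_ + _); rewrite addrA; congr (_ + _).
    rewrite rmorph_sum mulr_suml -big_split/=; apply: eq_bigr => i _.
    by rewrite st mulrDr rmorphM/= mulrA.
  by rewrite /sheet_arg /q !(rmorphD, rmorphM, rmorphB)/=; ring.
have pi0 := @pi_gt0 R.
have qpn p l : 0 < b p -> b l < 0 -> q p = q l.
  move=> bp bl; have := ls p l bp bl; have := lt p l bp bl; rewrite !qE.
  set x := sheet_arg m' t p - sheet_arg m' t l => xpi.
  have -> : sheet_arg m' t p + (q p)%:~R * (2 * pi) - (sheet_arg m' t l + (q l)%:~R * (2 * pi)) =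
      x + (q p - q l)%:~R * (2 * pi) by rewrite /x rmorphB/=; ring.
  move=> xqpi; apply/eqP; rewrite -subr_eq0 -normr_le0 -ltzD1 add0r -(ltr_int R) intr_norm.
  have : `|(q p - q l)%:~R * (2 * pi)| < 1 * (2 * pi) :> R.
    have -> : (q p - q l)%:~R * (2 * pi) = (x + (q p - q l)%:~R * (2 * pi)) - x :> R by ring.
    apply: (le_lt_trans (ler_normB _ _) (lt_le_trans (ltrD xqpi xpi) _)).
    by rewrite mul1r mulr_natl mulr2n.
  by rewrite normrM [`|2 * pi|]gtr0_norm ?mulr_gt0// ltr_pM2r ?mulr_gt0.
have sgn k : 0 < b k \/ b k < 0 by have := b0 k; rewrite neq_lt => /orP[]; [right|left].
have qc k : q k = q p1.
  have [bk|bk] := sgn k; last by rewrite (qpn p1 k).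
  by rewrite (qpn k n1)// (qpn p1 n1).
have : \sum_k circuit_relation a k * q k = 0.
  under eq_bigr do rewrite qc; rewrite -mulr_suml.
  by have [-> _] := sum_circuit_relation a; rewrite mul0r.
rewrite /q; under eq_bigr do rewrite mulrDr [_ * ((m - m') * _)]mulrCA.
rewrite big_split/= -mulr_sumr bv mulr1.
have -> : \sum_k circuit_relation a k * (\sum_i a k 0 i * w 0 i) = 0.
  under eq_bigr do rewrite mulr_sumr; rewrite exchange_big big1//= => i _.
  have [_ /rowP/(_ i)] := sum_circuit_relation a; rewrite summxE mxE => ba.
  under eq_bigr do rewrite mulrA; rewrite -mulr_suml.
  have -> : \sum_k circuit_relation a k * a k 0 i = 0.
    by rewrite -[RHS]ba; apply: eq_bigr => k _; rewrite mxE.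
  by rewrite mul0r.
by rewrite add0r => /eqP; rewrite subr_eq0 => /eqP.
Qed.

Definition sheet (m : int) : set 'rV[angle R]_n :=
  T @` [set t | off_coamoeba b c (phi t) /\ linked (sheet_arg m t)].

Lemma sheet_open m : open (sheet m).
Proof.
apply: torus_of_open; rewrite openE => t [off lt].
have [e e0 he] : exists2 e : R, 0 < e & forall x : 'I_n.+2 * 'I_n.+2,
    (if (0 < b x.1) && (b x.2 < 0) then `|sheet_arg m t x.1 - sheet_arg m t x.2| else 0) < pi - e.
  apply: fin_lt_margin => -[p l] /=; case: ifPn => [/andP[bp bl]|_]; first exact: lt.
  exact: pi_gt0.
have e20 : 0 < e / 2 by rewrite divr_gt0.
have [r r0 ra] := small_linear (fun k i => (a k 0 i)%:~R : R) e20.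
have offn : nbhs t [set s | off_coamoeba b c (phi s)].
  have : nbhs t (T @^-1` S).
    apply: torus_of_continuous; apply: open_nbhs_nbhs; split.
      by apply: closed_openC; exact: closed_closure.
    exact/complement_closure_coamoeba.
  by apply: filterS => s /complement_closure_coamoeba.
change (nbhs t [set s | off_coamoeba b c (phi s) /\ linked (sheet_arg m s)]).
apply: filterS (filterI offn (row_cube_nbhs t r0)) => s [offs sr]; split=> // p l bp bl.
have small k : `|dotz k (s - t)| < e / 2.
  by apply: (ra (fun i => (s - t) 0 i)) => i; rewrite !mxE; exact: sr.
rewrite -[s](subrKC t) !sheet_argD.
have := he (p, l); rewrite /= bp bl/=; have := small p; have := small l.
have -> : sheet_arg m t p + dotz p (s - t) - (sheet_arg m t l + dotz l (s - t)) =
  (sheet_arg m t p - sheet_arg m t l) + (dotz p (s - t) - dotz l (s - t)) by ring.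
move: (sheet_arg m t p - _) (dotz p _) (dotz l _) => x y z hz hy hx.
apply: (le_lt_trans (ler_normD _ _)); have := ler_normB y z.
by move=> yz; lra.
Qed.

Lemma sheets_cover x : S x <-> exists2 m : int,
  `|relation_arg + m%:~R * (2 * pi)| < pi * positive_mass & sheet m x.
Proof.
have [t <-] := torus_of_surjective x; split.
  move=> /complement_closure_coamoeba off.
  have [m [t' [t't lt km]]] := sheet_cover off; exists m => //; exists t' => //; split=> //.
  by apply/complement_closure_coamoeba; rewrite t't; exact/complement_closure_coamoeba.
by move=> [m _ [s [off _] <-]]; exact/complement_closure_coamoeba.
Qed.

(** The sheets are open, disjoint, and cover [S], so each of them is also closed in [S]. *)
Lemma component_sub_sheet m x : sheet m x -> connected_component S x `<=` sheet m.
Proof.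
move=> mx; set C := connected_component S x.
have xS : S x by have [t [off _] <-] := mx; exact/complement_closure_coamoeba.
have : C `&` sheet m = C.
  apply: (@component_connected _ S x).
  - by exists x; split=> //; exact: connected_component_refl.
  - by exists (sheet m) => //; exact: sheet_open.
  - exists (~` \bigcup_(m' in [set m' | m' != m]) sheet m').
      by apply: open_closedC; apply: bigcup_open => m' _; exact: sheet_open.
    apply/seteqP; split=> y [Cy ym]; split=> //.
      move=> [m' /= m'm [t [off lt] ty]].
      have [s [_ ls] sy] := ym.
      by move/eqP: m'm; apply; apply: (linked_sheet_unique lt ls); rewrite ty.
    have /sheets_cover[m' _ ym'] := connected_component_sub Cy.
    have [<-//|mm'] := eqVneq m' m.
    by case: ym; exists m'.
by move=> <- y [].
Qed.

(** All points of a sheet are joined to its lopsided part, which is convex in the lifted arguments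
    and nonempty exactly for the admissible [m]; [g] picks the component of a lopsided point. *)
Lemma components_sheets : exists g : int -> set 'rV[angle R]_n,
  set_bij [set m : int | `|relation_arg + m%:~R * (2 * pi)| < pi * positive_mass]
    (components S) g.
Proof.
set D := [set m : int | _].
have ch m : {t : 'rV[R]_n | D m -> lopsided (sheet_arg m t)}.
  apply: cid; have [Dm|nDm] := pselect (D m); last by exists 0.
  by have [t lt] := sheet_center Dm; exists t.
pose t m := sval (ch m); have tP m : D m -> lopsided (sheet_arg m (t m)) := svalP (ch m).
have tS m : D m -> sheet m (T (t m)).
  move=> Dm; exists (t m) => //; split; first exact: lopsided_off (tP m Dm).
  exact: lopsided_linked (tP m Dm).
have inS m : D m -> S (T (t m)).
  by move=> Dm; apply/sheets_cover; exists m => //; exact: tS.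
exists (fun m => connected_component S (T (t m))); split.
- by move=> m Dm /=; exists (T (t m)) => //; exact: inS.
- move=> m m' /set_mem Dm /set_mem Dm' e.
  have : connected_component S (T (t m')) (T (t m)).
    by rewrite -e; apply: connected_component_refl; exact: inS.
  move/(component_sub_sheet (tS m' Dm')) => [s [_ ls] st].
  by apply/esym; apply: (linked_sheet_unique ls _ st); exact: lopsided_linked (tP m Dm).
- move=> _ [x /sheets_cover[m Dm [s [off ls] <-]] <-] /=.
  exists m => //; have [s' lop cs] := sheet_to_lopsided off ls.
  apply/esym; apply: same_connected_component; apply: connected_component_trans cs _.
  exact: lopsided_component lop (tP m Dm).
Qed.

End CoamoebaArguments.

(** * Counting the sheets *)

Lemma int_interval_card (R : realType) (x y : R) (l : int) (N : nat) :
  (forall m : int, x < m%:~R < y = (l <= m < l + N%:Z)) ->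
  ([set m : int | x < m%:~R < y] #= `I_N)%card.
Proof.
move=> xy; apply/card_set_bijP; exists (fun m : int => `|m - l|%N); split.
- by move=> m /=; rewrite xy => h; lia.
- by move=> m m' /set_mem /= + /set_mem /=; rewrite !xy => h h'; lia.
- by move=> j /= jN; exists (l + j%:Z); rewrite /= ?xy; lia.
Qed.

(** An integral [x] excludes both endpoints, which costs one integer. *)
Lemma open_interval_int_card (R : realType) (x : R) (N : nat) : (0 < N)%N ->
  ((exists m : int, x = m%:~R) -> ([set m : int | x < m%:~R < x + N%:R] #= `I_N.-1)%card) /\
  (~ (exists m : int, x = m%:~R) -> ([set m : int | x < m%:~R < x + N%:R] #= `I_N)%card).
Proof.
move=> N0; split=> [[l ->]|xl].
  apply: (@int_interval_card _ _ _ (l + 1)) => m.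
  by rewrite -[N%:R]/(N%:Z%:~R) -rmorphD/= !ltr_int; lia.
apply: (@int_interval_card _ _ _ (Num.floor x + 1)) => m.
have /andP[fx xf] := mem_rg1_floor x.
have {}fx : (Num.floor x)%:~R < x.
  by rewrite lt_neqAle fx andbT; apply/eqP => e; apply: xl; exists (Num.floor x).
have lt1 (k : int) : (x < k%:~R) = (Num.floor x + 1 <= k).
  apply/idP/idP => h; first by rewrite lezD1 -(ltr_int R) (lt_trans fx).
  by apply: (lt_le_trans xf); rewrite -[1]/(1%:~R) -rmorphD/= ler_int.
have -> : (m%:~R < x + N%:R) = (m < Num.floor x + 1 + N%:Z).
  rewrite -ltrBlDr -[N%:R]/(N%:Z%:~R) -rmorphB/= -ltrBlDr.
  rewrite [in RHS]ltNge -lt1 -leNgt le_eqVlt; case: eqVneq => [e|//] /=.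
  by exfalso; apply: xl; exists (m - N%:Z).
by rewrite lt1.
Qed.

Lemma sum0_positive (R : realType) N (b : 'I_N.+1 -> R) :
  (forall k, b k != 0) -> \sum_k b k = 0 -> exists k, 0 < b k.
Proof.
move=> b0 sb; apply: contrapT => /forallNP h.
have bneg k : 0 <= - b k by rewrite oppr_ge0 leNgt; apply/negP/h.
have : \sum_k - b k == 0 by rewrite sumrN sb oppr0.
rewrite psumr_eq0// => /allP/(_ ord0 (mem_index_enum _)).
by rewrite /= oppr_eq0 (negbTE (b0 _)).
Qed.

(** * Volume and signs for a vertex circuit *)

Section VertexCircuit.
Variables (R : realType) (n : nat) (a : 'I_n.+2 -> 'rV[int]_n).
Local Notation b := (real_relation R a).
Local Notation pt k := (map_mx intr (a k) : 'rV[R]_n).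
Hypothesis b0 : forall k, b k != 0.

Lemma newton_barycentric_hull : newton R a = barycentric_hull (fun k => pt k).
Proof. exact: convex_hull_range. Qed.

Lemma sum_real_relation_pt : \sum_k b k *: pt k = 0.
Proof.
apply/rowP => i; rewrite summxE mxE.
have := sum_relation_dotz a (delta_mx 0 i : 'rV[R]_n) => h; rewrite -[RHS]h.
apply: eq_bigr => k _; rewrite !mxE; congr (_ * _).
rewrite /dotz (bigD1 i)//= mxE !eqxx mulr1 big1 ?addr0// => j /negbTE ji.
by rewrite mxE ji andbF mulr0.
Qed.

Lemma Vol_positive_mass : Vol R a = (positive_mass R a)%:E.
Proof.
have [k0 bk0] := sum0_positive b0 (sum_real_relation R a).
rewrite /Vol newton_barycentric_hull.
have det k : `|\det (edge_mx ((fun k => pt k) \o lift k))| = `|b k|.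
  exact: det_face_circuit_relation.
apply: (volume_circuit_hull (sum_real_relation R a) sum_real_relation_pt _ bk0).
- by move=> k bk; rewrite unitmxE unitfE -normr_eq0 det normr_eq0.
- by move=> k bk; rewrite det gtr0_norm.
Qed.

Lemma positive_mass_nat : exists2 V : nat, (0 < V)%N & positive_mass R a = V%:R.
Proof.
exists (\sum_(k | (0 < b k)%R) `|circuit_relation a k|)%N.
  have [k0 bk0] := sum0_positive b0 (sum_real_relation R a).
  rewrite (bigD1 k0)//= addn_gt0 absz_gt0.
  by move: (b0 k0); rewrite intr_eq0 => ->.
rewrite natr_sum; apply: eq_bigr => k bk.
by rewrite natr_absz gtr0_norm// -(ltr0z R).
Qed.

Lemma vertex_circuit_signs : vertex_circuit R a -> exists p1 p2 n1 n2,
  [/\ 0 < b p1, 0 < b p2, b n1 < 0, b n2 < 0 & (p1 != p2) && (n1 != n2)].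
Proof.
move=> [[aI _] vert]; have sb := sum_real_relation R a.
have ptI : injective (fun k => pt k).
  move=> i j /rowP ij; apply: aI; apply/rowP => l; have := ij l; rewrite !mxE.
  by move=> /eqP; rewrite eqr_int => /eqP.
have vp k : vertices (barycentric_hull (fun k => pt k)) (pt k).
  by rewrite -newton_barycentric_hull -vert; exists k.
have [p1 bp1] := sum0_positive b0 sb.
have [p2 p21 bp2] := vertices_two_positive ptI vp b0 sb sum_real_relation_pt bp1.
have b0N k : - b k != 0 by rewrite oppr_eq0.
have sbN : \sum_k - b k = 0 by rewrite sumrN sb oppr0.
have sbpN : \sum_k - b k *: pt k = 0.
  by under eq_bigr do rewrite scaleNr; rewrite sumrN sum_real_relation_pt oppr0.
have [n1 bn1] := sum0_positive b0N sbN.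
have [n2 n21 bn2] := vertices_two_positive ptI vp b0N sbN sbpN bn1.
exists p1, p2, n1, n2; rewrite -[b n1 < 0]oppr_gt0 -[b n2 < 0]oppr_gt0; split => //.
by rewrite eq_sym p21 eq_sym.
Qed.

End VertexCircuit.

Theorem theorem4p2 (R : realType) (n : nat) (a : 'I_n.+2 -> 'rV[int]_n)
    (Delta : mpoly n.+2 R[i]) (f : 'rV[R[i]]_(n.+2))
    (ha : vertex_circuit R a) (hlattice : affinely_generates a)
    (hDelta : is_discriminant a Delta) (hf : nonvanishing f) :
  U a 1 f <-> coamoeba (fun g => meval (g 0) Delta) (Arg f).
Proof.
have b0 k : real_relation R a k != 0.
  by rewrite intr_eq0; exact: circuit_relation_neq0 hlattice hDelta k.
have [p1 [p2 [n1 [n2 [bp1 bp2 bn1 bn2 /andP[p12 n12]]]]]] := vertex_circuit_signs b0 ha.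
have [v bv] := circuit_relation_unit hlattice.
have polar_f k : {ra : R * R | 0 < ra.1 & f 0 k = (ra.1)%:C * cis ra.2}.
  apply: cid2; have [r r0 fr] := norm_pos (hf k); have [t ft] := polar (f 0 k).
  by exists (r, t) => //=; rewrite ft fr.
pose rho k := (s2val (polar_f k)).1; pose alpha k := (s2val (polar_f k)).2.
have rho0 k : 0 < rho k := s2valP (polar_f k).
have fE k : f 0 k = (rho k)%:C * cis (alpha k) := s2valP' (polar_f k).
have [V V0 VE] := positive_mass_nat b0.
have pi0 := @pi_gt0 R; have pi2 : 0 < 2 * pi :> R by rewrite mulr_gt0.
(* This [x] turns the bound on [kappa + 2 pi m] into [x < m < x + V], and it is an integer exactly
   when [kappa = pi V] modulo [2 pi]. *)
pose x := - (relation_arg a alpha + pi * V%:R) / (2 * pi).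
have turns : (exists m : int, relation_arg a alpha + pi * positive_mass R a = m%:~R * (2 * pi)) <->
    exists m : int, x = m%:~R.
  rewrite VE /x; split=> -[m mE]; exists (- m).
    by rewrite mE rmorphN/= mulNr mulfK// gt_eqF.
  by rewrite rmorphN/= -mE !mulNr opprK divfK// gt_eqF.
have [g [gD gI gS]] := components_sheets rho0 fE hlattice b0 bv bp1 bp2 bn1 bn2 p12 n12.
have cardE : (components (~` closure (coamoeba (leval a f))) #=
    [set m : int | (x < m%:~R < x + V%:R)%R])%card.
  have -> : [set m : int | (x < m%:~R < x + V%:R)%R] =
      [set m : int | (`|relation_arg a alpha + m%:~R * (2 * pi)| < pi * positive_mass R a)%R].
    have xE : x * (2 * pi) = - (relation_arg a alpha + pi * V%:R) by rewrite divfK// gt_eqF.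
    suff E (y : R) : (x < y < x + V%:R) = (`|relation_arg a alpha + y * (2 * pi)| < pi * V%:R).
      by apply/seteqP; split=> m /=; rewrite VE E.
    rewrite ltr_norml; congr (_ && _).
      by rewrite -[LHS](ltr_pM2r pi2) xE; apply/idP/idP; lra.
    by rewrite -[LHS](ltr_pM2r pi2) (mulrDl x) xE; apply/idP/idP; lra.
  have -> : components (~` closure (coamoeba (leval a f))) =
      g @` [set m : int | (`|relation_arg a alpha + m%:~R * (2 * pi)| < pi * positive_mass R a)%R].
    by apply/seteqP; split=> [y /gS//|_ [m Dm <-]]; exact: gD.
  exact: inj_card_eq gI.
have disc := discriminant_coamoeba rho0 fE hlattice b0 bv hDelta.
have [card1 card0] := open_interval_int_card x V0.
split=> [[_ [m [cm]]]|].
  rewrite (Vol_positive_mass b0) VE -EFinB => -[mV].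
  apply: disc.2; apply: turns.2.
  (* If [x] were not an integer there would be [V] components, whereas [m = V - 1]. *)
  apply: contrapT => /card0 cV.
  have /card_eq_II Vm : (`I_V #= `I_m)%card.
    by rewrite (card_eql (card_esym cV)) (card_eql (card_esym cardE)).
  by move: mV; rewrite -Vm => /eqP; rewrite eq_sym subr_eq -subr_eq0 opprD addNKr oppr_eq0 oner_eq0.
move=> /disc.1/turns.1/card1 cV.
split=> //; exists V.-1; split; first by rewrite (card_eql cardE).
rewrite (Vol_positive_mass b0) VE -EFinB; congr _%:E.
by rewrite -subn1 natrB.
Qed.
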